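(* For each integer $n\ge 1$ let $\kappa_n(t,r(x,y))$ be the heat kernel of the unit sphere $\mathbb{S}^n$, where $r(x,y)\in[0,\pi]$ is the geodesic distance. Then, for all $t>0$ and $r\in[0,\pi]$: (1) For $n=1,2,\dots$, $$\kappa_{n+2}(t,r)=-\frac{e^{nt}}{2\pi\sin r}\,\partial_r\kappa_n(t,r).$$ (2) For $n=2,3,\dots$, $$\begin{aligned} \kappa_n(t,r)=\;&\sqrt 2\,e^{-\frac{2n-1}{4}t}\int_{r}^{\pi}\frac{\kappa_{n+1}(t,\rho)\sin\rho}{(\cos r-\cos\rho)^{1/2}}\,d\rho\\ &+(n-1)2^{n-1}\omega_{n-2}\int_0^t e^{-\frac{2n-1}{4}s}\,\kappa_{n+1}(s,\pi)\int_0^\pi \sin^{n-1}\!\left(\tfrac{\rho}{2}\right)\cos^{n-2}\!\left(\tfrac{\rho}{2}\right)\\ &\qquad\times\int_0^\pi \kappa_n\bigl(t-s,\arccos(\cos r\cos\rho+\sin r\sin\rho\cos\theta)\bigr)\sin^{n-2}\theta\,d\theta\,d\rho\,ds . \end{aligned}$$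
   Context: $\mathbb{S}^n$ is the unit $n$-sphere with its standard round metric of curvature $1$ (for $n=1$, the circle of length $2\pi$). The heat kernel is the fundamental solution of $\partial_t u=\Delta_n u$, where $\Delta_n$ is the (nonpositive) Laplace–Beltrami operator of $\mathbb{S}^n$, with respect to the Riemannian volume. It depends only on $t$ and the distance $r=r(x,y)$, and is written $\kappa_n(t,r)$, $t>0$, $0\le r\le\pi$. For functions of $r$ alone, $\Delta_n h=h_{rr}+(n-1)\cot(r)\,h_r$. The expression $\frac{1}{\sin r}\partial_r\kappa_n$ at $r=0,\pi$ is understood by continuous extension. $\omega_{k}=\frac{2\pi^{(k+1)/2}}{\Gamma((k+1)/2)}$ is the volume of the unit $k$-sphere (so $\omega_0=2$). *)

(* Defs.v *)
From HB Require Import structures.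
From mathcomp Require Import all_boot all_order all_algebra.
From mathcomp Require Import all_classical all_reals all_analysis.

Set Implicit Arguments.
Unset Strict Implicit.
Unset Printing Implicit Defensive.

Import Order.TTheory GRing.Theory Num.Theory.
Import numFieldNormedType.Exports.

Local Open Scope classical_set_scope.
Local Open Scope ring_scope.

Definition Gamma {R : realType} (z : R) : R :=
  \int[lebesgue_measure]_(x in `]0%R, +oo[) (x `^ (z - 1) * expR (- x)).

(* The volume of the unit k-sphere. *)
Definition omega {R : realType} (k : nat) : R :=
  2 * pi `^ (k.+1%:R / 2) / Gamma (k.+1%:R / 2).

(* C^infinity on an open set A: all iterated directional derivatives exist
   and are continuous at every point of A. *)
Fixpoint iter_derive {R : realType} {V : normedModType R}
    (s : seq V) (f : V -> R) : V -> R :=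
  if s is v :: s' then 'D_v (iter_derive s' f) else f.

Definition smooth_on {R : realType} {V : normedModType R}
    (A : set V) (f : V -> R) : Prop :=
  forall s x, A x ->
    {for x, continuous (iter_derive s f)} /\
    (forall v, derivable (iter_derive s f) x v).

(* The norm of the library on 'rV[R]_m is the sup norm, hence the explicit
   Euclidean inner product. *)
Definition dotp {R : realType} {m : nat} (x y : 'rV[R]_m) : R :=
  \sum_(i < m) x 0 i * y 0 i.

Definition sphere {R : realType} (n : nat) : set 'rV[R]_n.+1 :=
  [set x | dotp x x = 1].
Arguments sphere {R} n.

Definition radial_proj {R : realType} {m : nat} (x : 'rV[R]_m) : 'rV[R]_m :=
  (Num.sqrt (dotp x x))^-1 *: x.

Definition geodesic_dist {R : realType} {m : nat} (x y : 'rV[R]_m) : R :=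
  acos (dotp x y).

Definition laplacian {R : realType} {m : nat} (f : 'rV[R]_m -> R)
    (x : 'rV[R]_m) : R :=
  \sum_(i < m) 'D_(delta_mx 0 i) ('D_(delta_mx 0 i) f) x.

(* On the unit sphere of R^m, the Laplace-Beltrami operator of f is the
   restriction to the sphere of the Euclidean Laplacian of the extension of f
   that is homogeneous of degree 0. *)
Definition sphere_laplacian {R : realType} {m : nat} (f : 'rV[R]_m -> R)
    (x : 'rV[R]_m) : R :=
  laplacian (f \o @radial_proj R m) x.

(* Integral against the Riemannian volume of the n-sphere, in hyperspherical
   coordinates x = (cos phi, sin phi * w) with w in the (n-1)-sphere, in which
   the round metric is dphi^2 + sin^2 phi dw^2 and the volume element is
   sin^(n-1) phi dphi dw; the 0-sphere carries the counting measure.  Used for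
   continuous integrands only. *)
Fixpoint sphere_integral {R : realType} (n : nat) :
    ('rV[R]_n.+1 -> R) -> R :=
  match n return ('rV[R]_n.+1 -> R) -> R with
  | 0 => fun f => f (const_mx 1) + f (const_mx (- 1))
  | m.+1 => fun f =>
      \int[lebesgue_measure]_(phi in `[0%R, pi])
        (sin phi ^+ m *
         sphere_integral (fun w : 'rV[R]_m.+1 =>
           f (row_mx (cos phi)%:M (sin phi *: w) : 'rV[R]_(1 + m.+1))))
  end.

(* k is the heat kernel of the n-sphere, written as a function of time and
   geodesic distance: for every source y, (t, x) |-> k t (r(y, x)) is smooth on
   (0, +oo) x S^n, solves the heat equation and tends to the Dirac mass at y as
   t tends to 0.  Smoothness on the sphere is that of the extension homogeneous
   of degree 0.  Only the values k t r with 0 < t and 0 <= r <= pi matter. *)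
Definition is_heat_kernel {R : realType} (n : nat) (k : R -> R -> R) : Prop :=
  forall y : 'rV[R]_n.+1, sphere n y ->
  [/\ smooth_on [set p : R * 'rV[R]_n.+1 | 0 < p.1 /\ p.2 != 0]
        (fun p => k p.1 (geodesic_dist y (radial_proj p.2))),
      forall (t : R) (x : 'rV[R]_n.+1), 0 < t -> sphere n x ->
        'D_1 (fun s : R => k s (geodesic_dist y x)) t =
        sphere_laplacian (fun z => k t (geodesic_dist y z)) x
    & forall f : 'rV[R]_n.+1 -> R, {within sphere n, continuous f} ->
        sphere_integral (fun x => k t (geodesic_dist y x) * f x)
          @[t --> 0^'+] --> f y].

(* Main.v *)
Require Import Defs.
From HB Require Import structures.
From mathcomp Require Import all_boot all_order all_algebra.
From mathcomp Require Import all_classical all_reals all_analysis.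
From mathcomp Require Import ring lra.
Import Order.TTheory GRing.Theory Num.Theory.
Import numFieldNormedType.Exports.
Local Open Scope classical_set_scope.
Local Open Scope ring_scope.

(* Write x = cos r.  The heat kernel of S^n centred at a pole is a function f_n(t, x),
   and for every eigenpolynomial p of L_n = (1 - x^2) d^2/dx^2 - n x d/dx, with
   L_n p = - l p, its moment against p for the weight sin^(n-1) r dr is
   e^(-l t) p(1) / vol S^(n-1).  As polynomials are dense, these moments determine f_n.

   (1) The adjoint of d/dx maps eigenpolynomials of L_(n+2) for l to eigenpolynomials of
   L_n for l + n, so d f_n/dx and 2 pi e^(- n t) f_(n+2) have the same moments.

   (2) The Abel transform J h (r) = int_r^pi h(cos rho) sin rho (cos r - cos rho)^(-1/2) drho
   intertwines L_(n+1) with L_n + (2 n - 1) / 4, up to a multiple of h(-1) (cos (r/2))^(-1).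
   Convolve e^(-(2 n - 1) s / 4) J f_(n+1)(s) with the zonal function f_n(t - s): by the
   Funk-Hecke formula the derivative in s only consists of that antipodal term, which
   integrates to the double integral of the statement.  At s = t the convolution is the
   first integral of the statement; at s = 0, f_(n+1)(s) concentrates at the pole and the
   convolution is f_n(t), up to constants. *)

(** Origin of (2 n - 1) / 4: up to a factor the Abel transform sends (1 + x)^k to (1 + x)^(k + 1/2).
    The top coefficients of the operators on these powers are - k (k + n) in dimension n + 1 and -
    (k + 1/2) (k + n - 1/2) in dimension n, and they differ by exactly that number.

    Two obstacles shape the proof. Regularity at the poles: smoothness on the sphere yields
    derivatives in x for -1 < x < 1 only, with a vanishing flux at the ends. The recursion repairs
    this, since d f_n/dx is a multiple of the continuous f_(n+2); formula (2) thus uses the kernels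
    of dimensions n + 3 and n + 5 to make f_(n+1) of class C^2 up to the poles. Positivity is not
    part of the definition of the kernel. It comes from a maximum principle for polynomials; it
    yields monotonicity in the distance, hence decay away from the pole, and the nonnegative
    integrands by which improper integrals are reached through monotone convergence.

    No spectral expansion is ever summed: a moment against an eigenpolynomial solves a scalar linear
    equation in t, and the initial condition fixes it. *)

Set Implicit Arguments.
Unset Strict Implicit.
Unset Printing Implicit Defensive.

(** * Integrals over segments *)

Section Int.
Context {R : realType}.
Notation mu := (@lebesgue_measure R).
Implicit Types (a b c : R) (f g F : R -> R).

(* [Int a b f] is 0, not [- Int b a f], when [b < a]. *)
Definition Int a b f : R := \int[mu]_(x in `[a, b]) f x.

Lemma Int_integrable a b f : continuous f -> mu.-integrable `[a, b] (EFin \o f).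
Proof.
move=> cf; apply: continuous_compact_integrable; first exact: segment_compact.
exact: continuous_subspaceT.
Qed.

Lemma EFin_Int a b f : continuous f ->
  (\int[mu]_(x in `[a, b]) (f x)%:E)%E = (Int a b f)%:E.
Proof.
move=> cf; rewrite /Int /Rintegral fineK//.
by apply: integrable_fin_num => //; exact: Int_integrable.
Qed.

Lemma eq_Int a b f g : (forall x, a <= x <= b -> f x = g x) -> Int a b f = Int a b g.
Proof. by move=> fg; apply: eq_Rintegral => x; rewrite inE/= in_itv/= => /fg. Qed.

Lemma IntD a b f g : continuous f -> continuous g ->
  Int a b (fun x => f x + g x) = Int a b f + Int a b g.
Proof. by move=> cf cg; apply: RintegralD => //; exact: Int_integrable. Qed.

Lemma IntB a b f g : continuous f -> continuous g ->
  Int a b (fun x => f x - g x) = Int a b f - Int a b g.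
Proof. by move=> cf cg; apply: RintegralB => //; exact: Int_integrable. Qed.

Lemma IntZl a b c f : continuous f -> Int a b (fun x => c * f x) = c * Int a b f.
Proof. by move=> cf; apply: RintegralZl => //; exact: Int_integrable. Qed.

Lemma IntZr a b c f : continuous f -> Int a b (fun x => f x * c) = Int a b f * c.
Proof. by move=> cf; apply: RintegralZr => //; exact: Int_integrable. Qed.

Lemma Int_cst a b c : a <= b -> Int a b (fun=> c) = c * (b - a).
Proof.
move=> ab; rewrite /Int Rintegral_cst//= lebesgue_measure_itv/= lte_fin.
move: ab; rewrite le_eqVlt => /predU1P[->|->]; last by [].
by rewrite ltxx subrr.
Qed.

Lemma Int0 a b : Int a b (fun=> 0) = 0.
Proof. by rewrite /Int /Rintegral integral0. Qed.

Lemma Int_ge0 a b f : (forall x, a <= x <= b -> 0 <= f x) -> 0 <= Int a b f.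
Proof. by move=> f0; apply: Rintegral_ge0 => x; rewrite /= in_itv/= => /f0. Qed.

Lemma le_Int a b f g : continuous f -> continuous g ->
  (forall x, a <= x <= b -> f x <= g x) -> Int a b f <= Int a b g.
Proof.
move=> cf cg fg; apply: le_Rintegral => //; exact: Int_integrable.
Qed.

Lemma normr_Int_le a b f M : a <= b -> continuous f ->
  (forall x, a <= x <= b -> `|f x| <= M) -> `|Int a b f| <= M * (b - a).
Proof.
move=> ab cf fM; rewrite -(Int_cst M ab) ler_norml; apply/andP; split.
  rewrite lerNl -mulN1r -IntZl//; apply: le_Int.
  - by move=> x; apply: cvgM; [exact: cvg_cst|exact: cf].
  - by move=> x; exact: cvg_cst.
  - by move=> x /fM; rewrite ler_norml mulN1r lerNl => /andP[].
apply: le_Int => //; first by move=> x; exact: cvg_cst.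
by move=> x /fM; rewrite ler_norml => /andP[].
Qed.

Lemma IntS a b c f : continuous f -> a <= b <= c -> Int a c f = Int a b f + Int b c f.
Proof.
move=> cf /andP[ab bc].
have [->|anb] := eqVneq b a.
  by rewrite [Int a a _]/Int set_itv1 Rintegral_set1 add0r.
have ab' : a < b by rewrite lt_def anb.
have := @Rintegral_itvB _ f (BLeft a) (BRight c) b (@Int_integrable a c f cf).
rewrite !bnd_simp => /(_ ab bc)/eqP; rewrite subr_eq => /eqP.
rewrite Rintegral_itv_obnd_cbnd; last first.
  apply: integrableS (@Int_integrable b c f cf) => //.
  exact: subset_itv_oc_cc.
by rewrite addrC.
Qed.

Lemma FTC a b f F : a <= b -> continuous f ->
  (forall x, a < x < b -> is_derive x 1 F (f x)) ->
  {within `[a, b], continuous F} -> Int a b f = F b - F a.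
Proof.
rewrite le_eqVlt => /predU1P[-> _ _ _|ab cf dF cF].
  by rewrite /Int set_itv1 Rintegral_set1 subrr.
apply: EFin_inj; rewrite EFinB -EFin_Int//.
apply: continuous_FTC2 => //; first exact: continuous_subspaceT.
  have [_ Fa Fb] := (continuous_within_itvP F ab).1 cF; split => // x.
  by rewrite in_itv/= => /dF[].
by move=> x; rewrite in_itv/= => /dF[_]; rewrite derive1E.
Qed.

Lemma FTCT a b f F : a <= b -> continuous f ->
  (forall x : R, is_derive x 1 F (f x)) -> Int a b f = F b - F a.
Proof.
move=> ab cf dF; apply: FTC => //; apply: continuous_subspaceT => x.
by have [dx _] := dF x; apply/differentiable_continuous/derivable1_diffP.
Qed.

End Int.

(** * Integrals depending on a parameter *)

Section param.
Context {R : realType}.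
Implicit Types (a b c : R).

(** Compactness of the segment turns pointwise joint continuity along {x0} x [a, b] into uniformity
    in y. It plays the part of dominated convergence in what follows. *)
Lemma tube (T : topologicalType) (f : T -> R -> R) (x0 : T) a b (e : R) :
  (forall y, a <= y <= b -> {for (x0, y), continuous (fun p : T * R => f p.1 p.2)}) ->
  0 < e -> \forall x \near x0, forall y, a <= y <= b -> `|f x y - f x0 y| < e.
Proof.
move=> cf e0.
have /compact_near_coveringP K := @segment_compact R a b.
have : \forall x \near x0, `[a, b]%classic `<=` (fun y => `|f x y - f x0 y| < e).
  apply: K => y; rewrite /= in_itv/= => yab.
  have e20 : 0 < e / 2 by rewrite divr_gt0.
  have /cvgrPdist_lt/(_ _ e20) := cf y yab.
  rewrite /= => -[[A B]/= [nA nB] AB].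
  exists (B, A) => //= -[y' x']/= [By' Ax'].
  have h1 := AB (x', y') (conj Ax' By').
  have h2 := AB (x0, y') (conj (nbhs_singleton nA) By').
  rewrite /= in h1 h2.
  rewrite (splitr e) -[X in `|X|](subrKA (f x0 y)).
  by rewrite (le_lt_trans (ler_normD _ _))// ltrD// distrC.
by apply: filterS => x H y yab; apply: H; rewrite /= in_itv.
Qed.

Lemma continuous_Int (T : topologicalType) (f : T -> R -> R) (x0 : T) a b :
  a <= b ->
  (forall y, a <= y <= b -> {for (x0, y), continuous (fun p : T * R => f p.1 p.2)}) ->
  (\forall x \near x0, continuous (f x)) ->
  {for x0, continuous (fun x => Int a b (f x))}.
Proof.
move=> ab cf cfx; apply/cvgrPdist_le => e e0.
have cx0 := nbhs_singleton cfx.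
have ba1 : 0 < b - a + 1 by rewrite ltr_wpDl// subr_ge0.
have e'0 : 0 < e / (b - a + 1) by rewrite divr_gt0.
near=> x.
have cx : continuous (f x) by near: x.
rewrite distrC -IntB//.
apply: (@le_trans _ _ (e / (b - a + 1) * (b - a))).
  apply: normr_Int_le => // [y|y yab].
    by apply: cvgB; [exact: cx|exact: cx0].
  by apply/ltW; move: y yab; near: x; exact: tube.
rewrite mulrAC ler_pdivrMr// ler_pM2l// lerDl//.
Unshelve. all: by end_near. Qed.

End param.

Section param2.
Context {R : realType}.
Implicit Types (a b c d x h e df : R) (f F : R -> R).

Lemma is_derive_cvg f x df :
  h^-1 * (f (x + h) - f x) @[h --> 0^'] --> df -> is_derive x 1 f df.
Proof.
move=> H.
have H' : h^-1 *: (f (h *: 1 + x) - f x) @[h --> 0^'] --> df.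
  rewrite (_ : (fun h => _) = (fun h => h^-1 * (f (x + h) - f x)))//.
  by apply/funext => h; rewrite [_%:A]mulr1 (addrC h).
split; first by apply/cvg_ex; exists df.
exact: (cvg_lim _ H').
Qed.

Lemma near_gt a x : a < x -> \forall y \near x, a < y.
Proof.
move=> ax; have := @near_in_itvoy R a x; rewrite in_itv/= ax => /(_ isT).
by apply: filterS => y; rewrite in_itv/= andbT.
Qed.

Lemma near_lt a x : x < a -> \forall y \near x, y < a.
Proof.
move=> ax; have := @near_in_itvNyo R a x; rewrite in_itv/= ax => /(_ isT).
by apply: filterS => y; rewrite in_itv/=.
Qed.

Lemma is_derive_continuous f x df : is_derive x 1 f df -> {for x, continuous f}.
Proof. by move=> [dx _]; apply/differentiable_continuous/derivable1_diffP. Qed.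

Lemma MVT_ball f (df : R -> R) (x0 e h : R) : (forall x : R, `|x - x0| < e -> is_derive x 1 f (df x)) ->
  `|h| < e -> exists2 c, `|c - x0| <= `|h| & f (x0 + h) - f x0 = df c * h.
Proof.
move=> fdf he.
have [h0|h0] := leP 0 h.
  have [|||c] := @MVT_segment R f df x0 (x0 + h); first by rewrite lerDl.
  - move=> x; rewrite in_itv/= => /andP[x1 x2]; apply: fdf.
    rewrite (ger0_norm h0) in he; rewrite ger0_norm ?subr_ge0 ?(ltW x1)//; lra.
  - apply: derivable_within_continuous => x; rewrite in_itv/= => /andP[x1 x2].
    rewrite (ger0_norm h0) in he; apply: ex_derive.
    by apply: fdf; rewrite ger0_norm ?subr_ge0//; lra.
  - rewrite in_itv/= => /andP[x1 x2] E; exists c; last by rewrite E addrAC subrr add0r.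
    rewrite (ger0_norm h0) ger0_norm ?subr_ge0//; lra.
have [|||c] := @MVT_segment R f df (x0 + h) x0; first lra.
- move=> x; rewrite in_itv/= => /andP[x1 x2]; apply: fdf.
  rewrite (ltr0_norm h0) in he; rewrite ltr0_norm ?subr_lt0//; lra.
- apply: derivable_within_continuous => x; rewrite in_itv/= => /andP[x1 x2].
  rewrite (ltr0_norm h0) in he; apply: ex_derive.
  by apply: fdf; rewrite ler0_norm ?subr_le0//; lra.
- rewrite in_itv/= => /andP[x1 x2] E; exists c.
    rewrite (ltr0_norm h0) ler0_norm ?subr_le0//; lra.
  by rewrite -opprB E opprD addrA subrr add0r mulrN opprK.
Qed.

(** The mean value theorem replaces the difference quotient at y by [g c y] with c between x0 and x0
    + h, and [tube] makes this uniformly close to [g x0 y]. *)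
Lemma is_derive_Int (G g : R -> R -> R) (x0 : R) a b : a <= b ->
  (\forall x \near x0, forall y : R, a <= y <= b -> is_derive (x : R) 1 (G^~ y) (g x y)) ->
  (forall y, a <= y <= b -> {for (x0, y), continuous (fun p : R * R => g p.1 p.2)}) ->
  (\forall x \near x0, continuous (G x)) -> continuous (g x0) ->
  is_derive x0 1 (fun x => Int a b (G x)) (Int a b (g x0)).
Proof.
move=> ab dG cg cG cg0; apply: is_derive_cvg; apply/cvgrPdist_le => e e0.
have ba1 : 0 < b - a + 1 by rewrite ltr_wpDl// subr_ge0.
have e'0 : 0 < e / (b - a + 1) by rewrite divr_gt0.
have cG0 := nbhs_singleton cG.
have /= dGcg := @filterI _ (nbhs x0) (nbhs_filter x0) _ _ dG (tube cg e'0).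
move/nbhs_ballP : dGcg => [r /= r0 Br].
near=> h.
have hr : `|h| < r by near: h; apply: dnbhs0_lt.
have h0 : h != 0 by near: h; exact: nbhs_dnbhs_neq.
have cGh : continuous (G (x0 + h)).
  near: h; apply: nbhs_dnbhs.
  have : (x0 + h) @[h --> nbhs (0 : R)] --> x0.
    by rewrite -[X in _ --> X]addr0; apply: cvgD; [exact: cvg_cst|exact: cvg_id].
  by move=> /(_ _ cG).
rewrite -IntB// -IntZl; last by move=> y; apply: cvgB; [exact: cGh|exact: cG0].
rewrite -IntB//; last first.
  move=> y; apply: cvgM; first exact: cvg_cst.
  by apply: cvgB; [exact: cGh|exact: cG0].
apply: (@le_trans _ _ (e / (b - a + 1) * (b - a))); last first.
  by rewrite mulrAC ler_pdivrMr// ler_pM2l// lerDl//.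
apply: normr_Int_le => // [y|y yab].
  apply: cvgB; first exact: cg0.
  apply: cvgM; first exact: cvg_cst.
  by apply: cvgB; [exact: cGh|exact: cG0].
have [|c cx ->] := @MVT_ball (G^~ y) (g^~ y) x0 r h _ hr.
  by move=> x xr; apply: (Br x _).1 => //; rewrite /ball/= distrC.
rewrite mulrC mulfK// distrC; apply/ltW.
by apply: (Br c _).2 => //; rewrite /ball/= distrC (le_lt_trans cx).
Unshelve. all: by end_near. Qed.

Lemma is_derive_primitive a x f : a < x -> continuous f ->
  is_derive x 1 (fun x => Int a x f) (f x).
Proof.
move=> ax cf.
have [|d1 d2] := @continuous_FTC1_closed R f a x (x + 1) _
  (@Int_integrable _ a (x + 1) f cf) ax (cf x); first by rewrite ltrDl.
by apply: DeriveDef; [exact: d1 | rewrite -derive1E; exact: d2].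
Qed.

(** Fubini by calculus: as functions of the upper end of the x-interval, both iterated integrals
    have the same derivative. *)
Lemma Int_swap (f : R -> R -> R) a b c d : a <= b -> c <= d ->
  continuous (fun p : R * R => f p.1 p.2) ->
  Int a b (fun x => Int c d (f x)) = Int c d (fun y => Int a b (f^~ y)).
Proof.
move=> ab cd cf.
have cfl x : continuous (f x).
  by move=> y; apply: (cvg_comp2 (cvg_cst x) (cvg_id) (cf (x, y))).
have cfr y : continuous (f^~ y).
  by move=> x; apply: (cvg_comp2 (cvg_id) (cvg_cst y) (cf (x, y))).
(* Starting at a - 1 makes [P] differentiable at x = a too, since [Int] vanishes on reversed bounds
   and would have a corner there. *)
pose P x y := Int (a - 1) x (f^~ y).
have cP x : a - 1 <= x -> continuous (P x).
  move=> ax y; apply: (@continuous_Int R _ (fun y x => f x y)) => //.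
    by move=> x' _; apply: (cvg_comp2 cvg_snd cvg_fst (cf (x', y))).
  by near=> y'; exact: cfr.
have a1 : a - 1 < a by rewrite ltrBlDr ltrDl.
have dP x : a <= x -> is_derive x 1 (fun x => Int c d (P x)) (Int c d (f x)).
  move=> ax; have a1x := lt_le_trans a1 ax.
  apply: is_derive_Int => //.
  - near=> x'; move=> y _; apply: is_derive_primitive => //.
    by near: x'; exact: near_gt.
  - by move=> y _; exact: cf.
  - near=> x'; apply: cP; near: x'; apply: filterS (near_gt a1x) => z /ltW; exact.
transitivity (Int c d (P b) - Int c d (P a)).
  apply: (@FTC _ a b (fun x => Int c d (f x)) (fun x => Int c d (P x))) => //.
  - move=> x; apply: continuous_Int => // [y _|]; first exact: cf.
    by near=> x'.
  - by move=> x /andP[/ltW ax _]; exact: dP.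
  - apply: derivable_within_continuous => x; rewrite in_itv/= => /andP[ax _].
    by apply: ex_derive; exact: dP.
rewrite -IntB; [|exact: (cP _ (le_trans (ltW a1) ab))|exact: (cP _ (ltW a1))].
apply: eq_Int => y _; rewrite /P (@IntS _ (a - 1) a b) ?(ltW a1)//.
by rewrite addrAC subrr add0r.
Unshelve. all: by end_near. Qed.
End param2.

Section ctn.
Context {R : realType} {T : topologicalType}.
Implicit Types (f g : T -> R) (x : T).

Lemma ctn_cst (c : R) x : {for x, continuous (fun _ : T => c)}.
Proof. exact: cvg_cst. Qed.

Lemma ctn_id (x : T) : {for x, continuous (fun y : T => y)}.
Proof. by move=> A. Qed.

Lemma ctn_fst (U V : topologicalType) (x : U * V) : {for x, continuous (fun y : U * V => y.1)}.
Proof. exact: cvg_fst. Qed.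

Lemma ctn_snd (U V : topologicalType) (x : U * V) : {for x, continuous (fun y : U * V => y.2)}.
Proof. exact: cvg_snd. Qed.

Lemma ctnD f g x : {for x, continuous f} -> {for x, continuous g} ->
  {for x, continuous (fun y => f y + g y)}.
Proof. exact: cvgD. Qed.

Lemma ctnN f x : {for x, continuous f} -> {for x, continuous (fun y => - f y)}.
Proof. exact: cvgN. Qed.

Lemma ctnM f g x : {for x, continuous f} -> {for x, continuous g} ->
  {for x, continuous (fun y => f y * g y)}.
Proof. exact: cvgM. Qed.

Lemma ctnX f n x : {for x, continuous f} -> {for x, continuous (fun y => f y ^+ n)}.
Proof.
move=> cf; apply: (@continuous_comp _ _ _ f (fun y => y ^+ n)) => //.
exact: exprn_continuous.
Qed.

Lemma ctn_comp (U V : topologicalType) (h : U -> V) (f : T -> U) x :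
  {for f x, continuous h} -> {for x, continuous f} ->
  {for x, continuous (fun y => h (f y))}.
Proof. by move=> ch cf; apply: (@continuous_comp _ _ _ f h). Qed.

Lemma ctn_comp2 (U V W : topologicalType) (h : U -> V -> W) (f : T -> U) (g : T -> V) x :
  {for (f x, g x), continuous (fun p => h p.1 p.2)} ->
  {for x, continuous f} -> {for x, continuous g} ->
  {for x, continuous (fun y => h (f y) (g y))}.
Proof. by move=> ch cf cg; apply: (cvg_comp2 cf cg ch). Qed.

Lemma ctn_max f g x : {for x, continuous f} -> {for x, continuous g} ->
  {for x, continuous (fun y => Num.max (f y) (g y))}.
Proof. exact: continuous_max. Qed.

Lemma ctn_min f g x : {for x, continuous f} -> {for x, continuous g} ->
  {for x, continuous (fun y => Num.min (f y) (g y))}.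
Proof. exact: continuous_min. Qed.

End ctn.

Ltac ctn1 :=
  first
  [ match goal with
    | |- {for _, continuous (fun _ => ?cst)} => apply: ctn_cst
    | H : {for ?pt, continuous ?fn} |- {for ?pt, continuous ?fn} => exact: H
    | |- {for _, continuous (fun y => y)} => apply: ctn_id
    | H : continuous ?hn |- {for _, continuous ?hn} => exact: H
    | |- {for _, continuous (fun y => _ + _)} => apply: ctnD
    | |- {for _, continuous (fun y => - _)} => apply: ctnN
    | |- {for _, continuous (fun y => _ * _)} => apply: ctnM
    | |- {for _, continuous (fun y => _ ^+ _)} => apply: ctnX
    | |- {for _, continuous fst} => apply: ctn_fst
    | |- {for _, continuous snd} => apply: ctn_snd
    | |- {for _, continuous (fun y => y.1)} => apply: ctn_fst
    | |- {for _, continuous (fun y => y.2)} => apply: ctn_snd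
    | |- {for _, continuous ( *%R _)} => apply: ctnM
    | |- {for _, continuous ( +%R _)} => apply: ctnD
    | |- {for _, continuous -%R} => apply: ctnN
    | |- {for _, continuous sin} => exact: continuous_sin
    | |- {for _, continuous cos} => exact: continuous_cos
    | |- {for _, continuous expR} => exact: continuous_expR
    | |- {for _, continuous Num.norm} => exact: norm_continuous
    | |- {for _, continuous Num.sqrt} => exact: sqrt_continuous
    | |- {for _, continuous (horner _)} => exact: continuous_horner
    | |- {for _, continuous (Num.min _)} => apply: ctn_min
    | |- {for _, continuous (Num.max _)} => apply: ctn_max
    | |- {for _, continuous (fun y => Num.max _ _)} => apply: ctn_max
    | |- {for _, continuous (fun y => Num.min _ _)} => apply: ctn_min
    | |- {for _, continuous (fun y => `|_|)} =>
        apply: ctn_comp; [exact: norm_continuous|]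
    | |- {for _, continuous (fun y => sin _)} =>
        apply: ctn_comp; [exact: continuous_sin|]
    | |- {for _, continuous (fun y => cos _)} =>
        apply: ctn_comp; [exact: continuous_cos|]
    | |- {for _, continuous (fun y => expR _)} =>
        apply: ctn_comp; [exact: continuous_expR|]
    | |- {for _, continuous (fun y => Num.sqrt _)} =>
        apply: ctn_comp; [exact: sqrt_continuous|]
    | |- {for _, continuous (fun y => _.[_])} =>
        apply: ctn_comp; [exact: continuous_horner|]
    | H : continuous ?hn |- {for _, continuous (fun y => ?hn _)} =>
        apply: (ctn_comp (H _))
    end | assumption ].
Ltac ctn := repeat ctn1.
Ltac Ctn :=
  match goal with |- continuous ?fn =>
    let x := fresh "x" in move=> x; change {for x, continuous fn}; ctn end.

Section clamp.
Context {R : realType}.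
Implicit Types (a b x : R).

(** Composing with the retraction onto [a, b] extends a function controlled only on the segment to
    one continuous on the whole line, which is what the rules for [Int] ask for. *)
Definition clamp a b x := Num.max a (Num.min b x).

Lemma clamp_id a b x : a <= x <= b -> clamp a b x = x.
Proof. by move=> /andP[ax xb]; rewrite /clamp (min_idPr xb) (max_idPr ax). Qed.

Lemma clamp_itv a b x : a <= b -> a <= clamp a b x <= b.
Proof. by move=> ab; rewrite /clamp le_max lexx/= ge_max ab/= ge_min lexx. Qed.

Lemma continuous_clamp a b : continuous (clamp a b).
Proof. by move=> x; rewrite /clamp/=; apply: ctn_max; ctn. Qed.

Lemma continuous_clamp_comp (V : topologicalType) a b (f : R -> V) : a <= b ->
  {within `[a, b], continuous f} -> continuous (fun x => f (clamp a b x)).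
Proof.
move=> ab /subspace_continuousP cf x.
have := cf (clamp a b x); rewrite /= in_itv/= clamp_itv// => /(_ isT).
apply: (@cvg_comp _ _ _ (clamp a b) f).
move=> A wA.
have : \forall y \near x, `[a, b]%classic (clamp a b y) -> A (clamp a b y).
  exact: (@continuous_clamp a b x _ wA).
move=> wA'; change (\forall y \near x, A (clamp a b y)).
near=> y; have : `[a, b]%classic (clamp a b y) by rewrite /= in_itv/= clamp_itv.
by near: y.
Unshelve. all: by end_near.
Qed.

(* [acos] is specified on [-1, 1] only. *)
Definition acosc (x : R) : R := acos (clamp (- 1) 1 x).

Lemma continuous_acosc : continuous acosc.
Proof.
have h : (- 1 : R) <= 1 by lra.
apply: continuous_clamp_comp => //.
have := @segment_can_ge_continuous R 0 pi cos acos (pi_ge0 R).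
by rewrite cospi cos0; apply; [apply: continuous_subspaceT; exact: continuous_cos|exact: cosK].
Qed.

Lemma acosc_cos (x : R) : 0 <= x <= pi -> acosc (cos x) = x.
Proof. by move=> xpi; rewrite /acosc clamp_id ?cos_geN1 ?cos_le1// cosK. Qed.

Lemma cos_acosc (x : R) : - 1 <= x <= 1 -> cos (acosc x) = x.
Proof. by move=> xpi; rewrite /acosc clamp_id// acosK. Qed.

Lemma acosc_itv (x : R) : 0 <= acosc x <= pi.
Proof. by rewrite /acosc acos_ge0 ?acos_lepi// clamp_itv//; lra. Qed.
End clamp.

Section Int_more.
Context {R : realType}.
Implicit Types (a b x : R) (f : R -> R).

Lemma Int_eq0 a b f : a < b -> continuous f -> (forall x, a <= x <= b -> 0 <= f x) ->
  Int a b f = 0 -> forall x, a <= x <= b -> f x = 0.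
Proof.
move=> ab cf f0 I0 x xab; apply/eqP; rewrite eq_le f0// andbT leNgt; apply/negP => fx0.
have fx20 : f x / 2 < f x by lra.
have : \forall y \near x, f x / 2 < f y.
  exact: (@cvgr_gt _ _ (nbhs x) _ f (f x) (cf x)).
move=> /nbhs_ballP[d /= d0 Bd].
pose c := Num.max a (x - d / 2); pose e := Num.min b (x + d / 2).
have [ax xb] := andP xab.
have ac : a <= c by rewrite le_max lexx.
have eb : e <= b by rewrite ge_min lexx.
have xdc : x - d / 2 <= c by rewrite le_max lexx orbT.
have exd : e <= x + d / 2 by rewrite ge_min lexx orbT.
have ce : c < e.
  have h1 : a < x + d / 2 by lra.
  have h2 : x - d / 2 < b by lra.
  have h3 : x - d / 2 < x + d / 2 by lra.
  by rewrite lt_min !gt_max ab h1 h2 h3.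
clearbody c e.
have : Int a b f = Int a c f + (Int c e f + Int e b f).
  by rewrite -(@IntS _ c e b)// ?(ltW ce)//= -(@IntS _ a c b)// ac (le_trans (ltW ce)).
have h1 : 0 <= Int a c f by apply: Int_ge0 => y /andP[? ?]; apply: f0; lra.
have h2 : 0 <= Int e b f by apply: Int_ge0 => y /andP[? ?]; apply: f0; lra.
have h3 : f x / 2 * (e - c) <= Int c e f.
  rewrite -(Int_cst _ (ltW ce)); apply: le_Int => //; first by move=> ?; exact: cvg_cst.
  move=> y /andP[cy ye]; apply/ltW; apply: Bd; rewrite /ball/= ltr_norml; lra.
have : 0 < f x / 2 * (e - c) by rewrite mulr_gt0 ?subr_gt0// divr_gt0.
rewrite I0; lra.
Qed.

Lemma continuous_bounded a b f : continuous f ->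
  exists2 M : R, 0 <= M & forall x, a <= x <= b -> `|f x| <= M.
Proof.
move=> cf; have [ab|ab] := leP a b; last first.
  by exists 0 => // x /andP[ax xb]; exfalso; lra.
have [|c _ H] := @EVT_max R (fun x => `|f x|) a b ab.
  by apply: continuous_subspaceT; Ctn.
exists `|f c|; first exact: normr_ge0.
by move=> x xab; apply: H; rewrite in_itv.
Qed.

Lemma uniform_continuous a b f (e : R) : continuous f -> 0 < e ->
  exists2 d : R, 0 < d & forall x y, a <= x <= b -> `|y - x| < d -> `|f y - f x| < e.
Proof.
move=> cf e0.
(* Heine's theorem is the tube lemma for (h, y) |-> f (y + h) at h = 0. *)
have [|d /= d0 Bd] := @tube R R (fun h y => f (y + h)) 0 a b e _ e0.
  by move=> y _; ctn. exists d => // x y xab xyd.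
have := Bd (y - x); rewrite /ball/= sub0r normrN => /(_ xyd x xab).
by rewrite addrCA subrr !addr0.
Qed.
End Int_more.

(** * Density of polynomials *)

Section weierstrass.
Context {R : realType}.
Implicit Types (x e : R) (f : R -> R).

Definition bern N k x : R := 'C(N, k)%:R * (x ^+ k * (1 - x) ^+ (N - k)).

(** Probability generating function of the binomial law. Its value and first two derivatives at 1
    are the factorial moments, from which [bern_var] obtains the variance. *)
Let gen N x : {poly R} := \sum_(k < N.+1) bern N k x *: 'X^k.

Let genE N x : gen N x = ((1 - x)%:P + x *: 'X) ^+ N.
Proof.
rewrite exprDn; apply: eq_bigr => k _.
rewrite exprZn -polyC_exp mul_polyC scalerA -scaler_nat scalerA.
by rewrite /bern (mulrC (x ^+ k)).
Qed.

Lemma bern_sum N x : \sum_(k < N.+1) bern N k x = 1.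
Proof.
have := congr1 (horner^~ 1) (genE N x).
rewrite /= horner_sum horner_exp !hornerE subrK expr1n => <-.
by apply: eq_bigr => k _; rewrite !hornerE expr1n mulr1.
Qed.

Let dlin n x : (((1 - x)%:P + x *: 'X : {poly R}) ^+ n)^`() =
  (x * n%:R) *: (((1 - x)%:P + x *: 'X) ^+ n.-1).
Proof.
rewrite deriv_exp derivD derivC derivZ derivX add0r -scalerAl mul1r.
by rewrite -scaler_nat scalerA mulrC.
Qed.

Let lin1 n x : (((1 - x)%:P + x *: 'X : {poly R}) ^+ n).[1] = 1.
Proof. by rewrite !hornerE subrK expr1n. Qed.

Lemma bern_sum1 N x : \sum_(k < N.+1) bern N k x * k%:R = x * N%:R.
Proof.
have := congr1 (fun p : {poly R} => p^`().[1]) (genE N x).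
rewrite /= dlin hornerZ lin1 mulr1 => <-.
rewrite raddf_sum/= horner_sum; apply: eq_bigr => k _.
by rewrite derivZ derivXn hornerZ hornerMn hornerXn expr1n.
Qed.

Lemma bern_sum2 N x :
  \sum_(k < N.+1) bern N k x * (k * k.-1)%:R = x ^+ 2 * (N * N.-1)%:R.
Proof.
have := congr1 (fun p : {poly R} => p^`()^`().[1]) (genE N x).
rewrite /= dlin derivZ dlin scalerA hornerZ lin1 mulr1 => H.
rewrite natrM expr2 mulrACA -H raddf_sum/= raddf_sum/= horner_sum.
apply: eq_bigr => k _.
rewrite derivZ derivXn derivZ derivMn derivXn hornerZ !hornerMn hornerXn expr1n.
by congr (_ * _); rewrite natrM mulrC mulr_natr.
Qed.

Lemma bern_var N x :
  \sum_(k < N.+1) bern N k x * (k%:R - x * N%:R) ^+ 2 = N%:R * (x * (1 - x)).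
Proof.
transitivity (\sum_(k < N.+1) (bern N k x * (k * k.-1)%:R +
   ((1 - 2 * (x * N%:R)) * (bern N k x * k%:R) + (x * N%:R) ^+ 2 * bern N k x))).
  apply: eq_bigr => -[[|k] _] _ /=; first by rewrite mul0n; ring.
  rewrite natrM -natr1; ring.
rewrite big_split/= big_split/= -!mulr_sumr bern_sum2 bern_sum1 bern_sum.
case: N => [|N]; first by rewrite muln0; ring.
rewrite /= natrM -natr1; ring.
Qed.

Lemma bern_ge0 N k x : 0 <= x <= 1 -> 0 <= bern N k x.
Proof. by move=> /andP[x0 x1]; rewrite !mulr_ge0// exprn_ge0// subr_ge0. Qed.

Definition bernp N f : {poly R} :=
  \sum_(k < N.+1) (f (k%:R / N%:R) * 'C(N, k)%:R) *: ('X^k * (1 - 'X) ^+ (N - k)).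

Lemma bernpE N f x : (bernp N f).[x] = \sum_(k < N.+1) bern N k x * f (k%:R / N%:R).
Proof.
rewrite horner_sum; apply: eq_bigr => k _.
rewrite hornerZ hornerM !horner_exp !hornerE /bern /=; ring.
Qed.

(** Bernstein's argument: the weights [bern N k x] have mass 1 and concentrate near k = x N by the
    variance bound, so the average of f (k / N) is close to f x. *)
Lemma weierstrass01 f e : continuous f -> 0 < e ->
  exists p : {poly R}, forall x, 0 <= x <= 1 -> `|f x - p.[x]| <= e.
Proof.
move=> cf e0; have e20 : 0 < e / 2 by rewrite divr_gt0.
have [d d0 Hd] := uniform_continuous 0 1 cf e20.
have [M M0 HM] := continuous_bounded 0 1 cf.
(* Where |k/N - x| >= d, the oscillation 2 M is at most K (k/N - x)^2. Averaged, this costs K x (1 -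
   x) / N, and N is chosen so that K / N <= e / 2. *)
pose K := 2 * M / d ^+ 2.
have K0 : 0 <= K by rewrite /K divr_ge0 ?mulr_ge0 ?exprn_ge0 ?(ltW d0).
pose N := (Num.truncn (2 * K / e)).+1.
have NK : 2 * K / e < N%:R by exact: truncnS_gt.
have N0 : 0 < N%:R :> R by rewrite ltr0n.
exists (bernp N f) => x x01; rewrite bernpE.
have -> : f x = \sum_(k < N.+1) bern N k x * f x by rewrite -mulr_suml bern_sum mul1r.
rewrite -sumrB; apply: le_trans (ler_norm_sum _ _ _) _.
apply: (@le_trans _ _ (\sum_(k < N.+1)
  (e / 2 * bern N k x + K / N%:R ^+ 2 * (bern N k x * (k%:R - x * N%:R) ^+ 2)))).
  apply: ler_sum => k _; rewrite -mulrBr normrM (ger0_norm (bern_ge0 _ _ x01)).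
  have -> : e / 2 * bern N k x + K / N%:R ^+ 2 * (bern N k x * (k%:R - x * N%:R) ^+ 2)
    = bern N k x * (e / 2 + K * (k%:R / N%:R - x) ^+ 2).
    by field; rewrite lt0r_neq0.
  rewrite ler_wpM2l ?bern_ge0//.
  have kN : 0 <= (k%:R / N%:R : R) <= 1.
    by rewrite divr_ge0//= ler_pdivrMr// mul1r ler_nat -ltnS.
  have [kx|kx] := ltP `|k%:R / N%:R - x| d.
    rewrite distrC; apply: (le_trans (ltW (Hd _ _ x01 kx))).
    by rewrite lerDl mulr_ge0// sqr_ge0.
  apply: (@le_trans _ _ (2 * M)).
    apply: le_trans (ler_normB _ _) _.
    by rewrite mulr2n mulrDl mul1r lerD// HM.
  apply: (@le_trans _ _ (K * (k%:R / N%:R - x) ^+ 2)); last by rewrite lerDr ltW.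
  rewrite /K mulrAC ler_pdivlMr ?exprn_gt0//.
  rewrite ler_wpM2l ?mulr_ge0// -[X in _ <= X]real_normK ?num_real//.
  by rewrite ler_pXn2r ?nnegrE// ltW.
rewrite big_split/= -!mulr_sumr bern_sum bern_var mulr1.
have xx : x * (1 - x) <= 1 by case/andP: x01 => ? ?; nra.
have -> : K / N%:R ^+ 2 * (N%:R * (x * (1 - x))) = K / N%:R * (x * (1 - x)).
  by field; rewrite lt0r_neq0.
have : K / N%:R <= e / 2.
  move: NK; rewrite ltr_pdivrMr// => NK; rewrite ler_pdivrMr//; lra.
have KN : 0 <= K / N%:R by rewrite divr_ge0// ltW.
move=> h; have := ler_wpM2l KN xx; lra.
Qed.

Lemma weierstrass f e : continuous f -> 0 < e ->
  exists p : {poly R}, forall x, - 1 <= x <= 1 -> `|f x - p.[x]| <= e.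
Proof.
move=> cf e0; have [|p Hp] := @weierstrass01 (fun x => f (2 * x - 1)) e _ e0.
  by Ctn.
exists (p \Po (2^-1 *: ('X + 1))) => x /andP[x0 x1].
have -> : f x = f (2 * (2^-1 * (x + 1)) - 1) by congr f; field.
have -> : (p \Po (2^-1 *: ('X + 1))).[x] = p.[2^-1 * (x + 1)].
  by rewrite horner_comp !hornerE.
apply: Hp; lra.
Qed.

End weierstrass.

Section density.
Context {R : realType}.

(** Only a Lipschitz bound in the sup norm on [-1, 1] is asked of [L]. This is how identities
    checked on polynomials pass to continuous functions. *)
Lemma eq0_functional (L : (R -> R) -> R) (C : R) :
  (forall (f g : R -> R) (e : R), continuous f -> continuous g ->
    (forall x : R, - 1 <= x <= 1 -> `|f x - g x| <= e) -> `|L f - L g| <= C * e) ->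
  (forall p : {poly R}, L (horner p) = 0) -> forall f : R -> R, continuous f -> L f = 0.
Proof.
move=> LC Lp f cf; apply/eqP; rewrite -normr_le0; apply/ler_addgt0Pl => e e0.
have C1 : 0 < `|C| + 1 by rewrite ltr_wpDl.
have [p Hp] := weierstrass cf (divr_gt0 e0 C1).
have := LC f (horner p) _ cf (@continuous_horner _ p) Hp.
rewrite Lp subr0 addr0 => /le_trans; apply.
rewrite mulrA ler_pdivrMr// [leRHS]mulrC ler_wpM2r ?(ltW e0)//.
by rewrite (le_trans (ler_norm C))// lerDl.
Qed.

(** Approximate u o acos itself by polynomials: the vanishing moments give that the integral of u^2
    is 0. *)
Lemma eq0_moments (u : R -> R) : continuous u ->
  (forall p : {poly R}, Int 0 pi (fun r => u r * p.[cos r]) = 0) ->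
  forall r, 0 <= r <= pi -> u r = 0.
Proof.
move=> cu up.
have [M M0 HM] := continuous_bounded 0 pi cu.
have cac := @continuous_acosc R.
suff I0 : Int 0 pi (fun r => u r * u r) = 0.
  move=> r rpi; have := @Int_eq0 R 0 pi (fun r => u r * u r) (pi_gt0 R) _ _ I0 r rpi.
  move=> /(_ _ _)/eqP; rewrite mulf_eq0 orbb => H; apply/eqP/H.
    by Ctn.
  by move=> x _; rewrite -expr2 sqr_ge0.
have -> : Int 0 pi (fun r => u r * u r) = Int 0 pi (fun r => u r * u (acosc (cos r))).
  by apply: eq_Int => r rpi; rewrite acosc_cos.
apply: (@eq0_functional (fun f => Int 0 pi (fun r => u r * f (cos r))) (M * pi) _ _ (fun x => u (acosc x))).
  move=> f g e cf cg fg; rewrite -IntB; [|by Ctn..].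
  have -> : M * pi * e = M * e * (pi - 0) by ring.
  apply: normr_Int_le; [exact: pi_ge0|by Ctn|move=> x xpi].
  rewrite -mulrBr normrM ler_pM// ?HM// fg// cos_geN1 cos_le1//.
- exact: up.
- by Ctn.
Qed.
End density.

(** * The zonal Laplacian on polynomials *)

Section lapl.
Context {R : realType}.
Implicit Types (p q f : {poly R}) (n i : nat).

Definition lapl n p : {poly R} := (1 - 'X^2) * p^`()^`() - n%:R *: ('X * p^`()).

Lemma laplD n p q : lapl n (p + q) = lapl n p + lapl n q.
Proof. by rewrite /lapl !derivD !mulrDr scalerDr opprD addrACA. Qed.

Lemma laplZ n a p : lapl n (a *: p) = a *: lapl n p.
Proof. by rewrite /lapl !derivZ -!scalerAr scalerBr !scalerA (mulrC a). Qed.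

Lemma lapl_sum n (I : Type) (r : seq I) (P : pred I) (F : I -> {poly R}) :
  lapl n (\sum_(i <- r | P i) F i) = \sum_(i <- r | P i) lapl n (F i).
Proof.
apply: (big_morph (lapl n) (@laplD n)).
by rewrite /lapl !deriv0 !mulr0 scaler0 subr0.
Qed.

Lemma laplE n p x :
  (lapl n p).[x] = (1 - x ^+ 2) * p^`()^`().[x] - n%:R * (x * p^`().[x]).
Proof. by rewrite /lapl !hornerE. Qed.

Definition ev n i : R := i%:R * (i%:R + n%:R - 1).

Lemma ev_ge0 n i : (0 < n)%N -> 0 <= ev n i.
Proof.
by case: n => // n _; rewrite /ev mulr_ge0// -natr1 addrA addrK -natrD.
Qed.

Lemma ev_lt n i j : (0 < n)%N -> (i < j)%N -> ev n i < ev n j.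
Proof.
case: n => // n _ ij; rewrite /ev -subr_gt0.
have -> : j%:R * (j%:R + n.+1%:R - 1) - i%:R * (i%:R + n.+1%:R - 1) =
  (j%:R - i%:R) * (j%:R + i%:R + n%:R) :> R by rewrite -natr1; ring.
rewrite mulr_gt0 ?subr_gt0 ?ltr_nat// -!natrD ltr0n.
by rewrite -addnA ltn_addr// (leq_ltn_trans _ ij).
Qed.

Definition eigenbasis n (P : nat -> {poly R}) := forall i,
  [/\ size (P i) = i.+1, P i \is monic & lapl n (P i) = - ev n i *: P i].

Lemma monic_basis (P : nat -> {poly R}) d p :
  (forall i, (i < d)%N -> size (P i) = i.+1 /\ P i \is monic) -> (size p <= d)%N ->
  exists a : nat -> R, p = \sum_(i < d) a i *: P i.
Proof.
elim: d p => [|d IH] p HP sp.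
  by exists (fun=> 0); rewrite big_ord0; apply/eqP; rewrite -size_poly_eq0 -leqn0.
have [sPd mPd] := HP d (ltnSn d).
have [||a Ha] := IH (p - p`_d *: P d).
- by move=> i id; apply: HP; rewrite ltnW.
- apply/leq_sizeP => j; rewrite leq_eqVlt => /predU1P[<-|dj].
    rewrite coefB coefZ; move: mPd; rewrite monicE /lead_coef sPd/= => /eqP ->.
    by rewrite mulr1 subrr.
  have -> : (p - p`_d *: P d)`_j = p`_j - p`_d * (P d)`_j by rewrite coefB coefZ.
  by rewrite [p`_j]nth_default ?[(P d)`_j]nth_default ?mulr0 ?subrr ?sPd// (leq_trans sp).
exists (fun i => if i == d then p`_d else a i).
rewrite big_ord_recr/= eqxx -[LHS](subrK (p`_d *: P d)) Ha; congr (_ + _).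
by apply: eq_bigr => i _; rewrite ltn_eqF.
Qed.

(** On monomials [lapl n] is triangular with diagonal entries [- ev n d]. For d < 2 the truncated
    exponent [d.-2] is harmless, its coefficient being 0. *)
Lemma lapl_Xn n d : lapl n 'X^d + ev n d *: 'X^d = (d * d.-1)%:R *: 'X^(d.-2).
Proof.
rewrite /lapl /ev derivXn; case: d => [|[|d]]/=.
- by rewrite mulr0n derivC !mulr0 scaler0 mul0r !scale0r subr0 addr0.
- rewrite expr0 expr1 mulr1 derivC mulr0 sub0r mul1r scale0r.
  by rewrite addrAC subrr add0r addrC subrr.
rewrite derivMn derivXn /= -!mulrnA mulrnAr mulrnAr -exprS mulrBl mul1r -exprD add2n.
rewrite -[X in X - _ + _]scaler_nat -[X in n%:R *: X]scaler_nat scalerBr !scalerA.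
have -> : (d.+2%:R * (d.+2%:R + n%:R - 1)) *: 'X^(d.+2) =
    (d.+1 * d.+2)%:R *: 'X^(d.+2) + (n%:R * d.+2%:R) *: 'X^(d.+2) :> {poly R}.
  rewrite -scalerDl natrM -(natr1 d.+1); congr (_ *: _); ring.
by rewrite -[X in X + _]addrA -opprD subrK mulnC.
Qed.

Lemma exists_eigenbasis n : (0 < n)%N -> exists P, eigenbasis n P.
Proof.
move=> n0; suff H d : exists Pd : {poly R},
    [/\ size Pd = d.+1, Pd \is monic & lapl n Pd = - ev n d *: Pd].
  by have [P HP] := choice H; exists P.
elim/ltn_ind: d => d IH.
have H i : exists Pi : {poly R}, (i < d)%N ->
    [/\ size Pi = i.+1, Pi \is monic & lapl n Pi = - ev n i *: Pi].
  by have [/IH[Pi HPi]|?] := ltnP i d; [exists Pi|exists 0].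
have [P HP] := choice H.
have [||a Ha] := @monic_basis P d ((d * d.-1)%:R *: 'X^(d.-2)).
- by move=> i /HP[].
- case: d {IH H HP} => [|[|d]]; rewrite ?scale0r ?size_poly0//.
  by rewrite (leq_trans (size_scale_leq _ _))// size_polyXn.
(* The remainder of [lapl_Xn] is expanded in the lower eigenpolynomials and divided by the spectral
   gaps, nonzero because [ev n] is strictly increasing for n > 0. *)
pose c i := a i / (ev n d - ev n i).
have sr : (size (- (\sum_(i < d) c i *: P i)) <= d)%N.
  rewrite size_polyN; apply: (leq_trans (size_sum _ _ _)); apply/bigmax_leqP => i _.
  have [sPi _ _] := HP i (ltn_ord i).
  by rewrite (leq_trans (size_scale_leq _ _))// sPi.
exists ('X^d - \sum_(i < d) c i *: P i); split.
- by rewrite size_polyDl size_polyXn// ltnS.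
- by rewrite monicE lead_coefDl ?size_polyXn ?ltnS// lead_coefXn.
have Lr : lapl n (\sum_(i < d) c i *: P i) = - ev n d *: (\sum_(i < d) c i *: P i) +
   (d * d.-1)%:R *: 'X^(d.-2).
  rewrite Ha lapl_sum scaler_sumr -big_split/=; apply: eq_bigr => i _.
  have [_ _ LPi] := HP i (ltn_ord i).
  rewrite laplZ LPi !scalerA -scalerDl; congr (_ *: _).
  rewrite /c; field; rewrite subr_eq0 gt_eqF// ev_lt//.
have LX : lapl n 'X^d = (d * d.-1)%:R *: 'X^(d.-2) - ev n d *: 'X^d.
  by rewrite -(lapl_Xn n) addrK.
rewrite -scaleN1r laplD laplZ Lr LX.
rewrite -!mul_polyC; move: (\sum_(i < d) _) ('X^d) ('X^(d.-2)) => S A B.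
rewrite !polyCN polyC1; move: ((ev n d)%:P) (_%:R%:P) => e f; ring.
Qed.

End lapl.

(** * Maximum principle and positivity of the heat flow on polynomials *)

Section closure_ineq.
Context {R : realType}.
Implicit Types (f g : R -> R) (a b x : R).

Lemma near_right f b x : {for x, continuous f} -> x < b ->
  (forall y, x < y < b -> 0 <= f y) -> 0 <= f x.
Proof.
move=> cf xb f0; rewrite leNgt; apply/negP => fx0.
have fx : \forall y \near x, f y < 0 by exact: (@cvgr_lt _ _ (nbhs x) _ f (f x) cf).
have [d /= d0 Bd] := (nbhs_ballP _ _).1 fx.
pose m := Num.min (d / 2) ((b - x) / 2).
have m1 : m <= d / 2 by rewrite ge_min lexx.
have m2 : m <= (b - x) / 2 by rewrite ge_min lexx orbT.
have m0 : 0 < m by rewrite lt_min !divr_gt0 ?subr_gt0.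
clearbody m.
have /Bd : ball x d (x + m).
  by rewrite /ball/= opprD addrA subrr add0r normrN gtr0_norm//; lra.
by rewrite ltNge f0//; lra.
Qed.

Lemma near_left f a x : {for x, continuous f} -> a < x ->
  (forall y, a < y < x -> 0 <= f y) -> 0 <= f x.
Proof.
move=> cf ax f0; rewrite leNgt; apply/negP => fx0.
have fx : \forall y \near x, f y < 0 by exact: (@cvgr_lt _ _ (nbhs x) _ f (f x) cf).
have [d /= d0 Bd] := (nbhs_ballP _ _).1 fx.
pose m := Num.min (d / 2) ((x - a) / 2).
have m1 : m <= d / 2 by rewrite ge_min lexx.
have m2 : m <= (x - a) / 2 by rewrite ge_min lexx orbT.
have m0 : 0 < m by rewrite lt_min !divr_gt0 ?subr_gt0.
clearbody m.
have /Bd : ball x d (x - m).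
  by rewrite /ball/= opprB addrC subrK gtr0_norm//; lra.
by rewrite ltNge f0//; lra.
Qed.

Lemma closure_ge0 f a b : a < b -> continuous f ->
  (forall x, a < x < b -> 0 <= f x) -> forall x, a <= x <= b -> 0 <= f x.
Proof.
move=> ab cf f0 x /andP[]; rewrite le_eqVlt => /predU1P[<- _|ax].
  exact: (@near_right f b a (cf a)).
rewrite le_eqVlt => /predU1P[->|xb]; first exact: (@near_left f a b (cf b)).
by apply: f0; rewrite ax.
Qed.

Lemma closure_eq f g a b : a < b -> continuous f -> continuous g ->
  (forall x, a < x < b -> f x = g x) -> forall x, a <= x <= b -> f x = g x.
Proof.
move=> ab cf cg fg x xab; apply/eqP; rewrite eq_le -subr_ge0 -(subr_ge0 (g x)); apply/andP; split.
  by apply: (@closure_ge0 (fun y => g y - f y) a b) => //; [Ctn|move=> y /fg ->; rewrite subrr].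
by apply: (@closure_ge0 (fun y => f y - g y) a b) => //; [Ctn|move=> y /fg ->; rewrite subrr].
Qed.
End closure_ineq.

Section positivity.
Context {R : realType}.
Implicit Types (p q f : {poly R}) (n i : nat) (x t h : R).

(** Write f - f(x0) = q (X - x0). At an end of [-1, 1] the second-order coefficient vanishes and the
    sign of q(x0) decides. Inside, q(x0) = 0, so q = s (X - x0) and f''(x0) = 2 s(x0) >= 0. *)
Lemma lapl_at_min n f x0 : - 1 <= x0 <= 1 ->
  (forall x, - 1 <= x <= 1 -> f.[x0] <= f.[x]) -> 0 <= (lapl n f).[x0].
Proof.
move=> /andP[xa xb] fmin.
have [q fq] : exists q, f - f.[x0]%:P = q * ('X - x0%:P).
  by apply/factor_theorem; rewrite rootE !hornerE subrr.
have fE : f = q * ('X - x0%:P) + f.[x0]%:P by rewrite -fq subrK.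
have q0 x : - 1 <= x <= 1 -> 0 <= q.[x] * (x - x0).
  by move=> /fmin; rewrite [in leRHS]fE !hornerE lerDr.
have d1 : f^`().[x0] = q.[x0].
  by rewrite fE derivD derivC addr0 derivM derivXsubC !hornerE subrr mulr0 add0r.
have d2 : f^`()^`().[x0] = q^`().[x0] *+ 2.
  rewrite fE derivD derivC addr0 derivM derivXsubC derivD mulr1 derivM derivXsubC.
  by rewrite !hornerE subrr mulr0 add0r mulr2n.
have cq := @continuous_horner _ q.
rewrite laplE d1 d2; move: xa; rewrite le_eqVlt => /predU1P[x0E|xa].
  rewrite -x0E expr2 mulrNN mulr1 subrr mul0r sub0r mulN1r mulrN opprK mulr_ge0//.
  rewrite x0E in q0 *; apply: (@near_right _ (horner q) 1); first exact: cq; first lra.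
  move=> y /andP[y1 y2]; have := q0 y; rewrite pmulr_lge0 ?subr_gt0//; apply; lra.
move: xb; rewrite le_eqVlt => /predU1P[x0E|xb].
  rewrite x0E expr1n subrr mul0r sub0r mul1r -mulrN mulr_ge0//.
  rewrite -x0E; apply: (@near_left _ (fun y => - q.[y]) (- 1)); [ctn|lra|].
  move=> y /andP[y1 y2]; have := q0 y; rewrite -mulrNN pmulr_lge0 ?opprB ?subr_gt0//; apply; lra.
have qx0 : q.[x0] = 0.
  apply/eqP; rewrite eq_le -oppr_ge0; apply/andP; split.
    apply: (@near_left _ (fun y => - q.[y]) (- 1)); [ctn|lra|].
    move=> y /andP[y1 y2]; have := q0 y; rewrite -mulrNN pmulr_lge0 ?opprB ?subr_gt0//; apply; lra.
  apply: (@near_right _ (horner q) 1); [exact: cq|lra|].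
  move=> y /andP[y1 y2]; have := q0 y; rewrite pmulr_lge0 ?subr_gt0//; apply; lra.
have [s qs] : exists s, q = s * ('X - x0%:P).
  by apply/factor_theorem; rewrite rootE qx0.
have dq : q^`().[x0] = s.[x0].
  by rewrite qs derivM derivXsubC !hornerE subrr mulr0 add0r.
rewrite qx0 !mulr0 subr0 dq mulr_ge0//; first by rewrite subr_ge0; nra.
rewrite mulrn_wge0//.
apply: (@near_right _ (horner s) 1); [exact: continuous_horner|lra|].
move=> y /andP[y1 y2]; have := q0 y; rewrite qs !hornerE -mulrA pmulr_lge0; last first.
  by rewrite mulr_gt0// subr_gt0.
apply; lra.
Qed.

(** Maximum principle for an implicit Euler step: at a minimum x0 of f one has f(x0) >= (f - h L
    f)(x0), because L f (x0) >= 0. *)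
Lemma resolvent_ge0 n h f : 0 <= h ->
  (forall x, - 1 <= x <= 1 -> 0 <= (f - h *: lapl n f).[x]) ->
  forall x, - 1 <= x <= 1 -> 0 <= f.[x].
Proof.
move=> h0 H x x1.
have N11 : (- 1 : R) <= 1 by lra.
have [|x0] := @EVT_min R (horner f) (- 1) 1 N11.
  by apply: continuous_subspaceT; exact: continuous_horner.
rewrite in_itv/= => x01 fmin.
have fmin' y : - 1 <= y <= 1 -> f.[x0] <= f.[y] by move=> y1; apply: fmin; rewrite in_itv.
apply: le_trans (fmin' _ x1).
have := H _ x01; have := mulr_ge0 h0 (lapl_at_min n x01 fmin').
rewrite !hornerE; lra.
Qed.

(** With y = x / (k + 1), squeeze between exp(- x) and exp(- x + x^2 / (k + 1)), using 1 + y <= exp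
    y and (1 + y)^-1 = 1 - y / (1 + y) <= exp(- y / (1 + y)). *)
Lemma cvg_exp_inv x : 0 <= x -> ((1 + x / k.+1%:R) ^- k.+1) @[k --> \oo] --> expR (- x).
Proof.
move=> x0.
have k0 k : 0 < k.+1%:R :> R by rewrite ltr0n.
apply: (@squeeze_cvgr _ _ _ _ (fun=> expR (- x)) (fun k => expR (- x + x ^+ 2 * k.+1%:R^-1))).
- near=> k; set y := x / k.+1%:R.
  have y0 : 0 <= y by rewrite divr_ge0.
  have xE : x = y * k.+1%:R by rewrite /y divfK// gt_eqF.
  clearbody y; apply/andP; split.
    rewrite expRN lef_pV2 ?posrE ?expR_gt0 ?exprn_gt0//; last by rewrite ltr_pwDl.
    rewrite xE mulrC expRM_natl ?lerXn2r ?nnegrE ?expR_ge0//.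
      by rewrite addr_ge0.
    exact: expR_ge1Dx.
  apply: (@le_trans _ _ (expR (- (y / (1 + y))) ^+ k.+1)).
    rewrite -exprVn lerXn2r ?nnegrE ?expR_ge0 ?invr_ge0//; first by rewrite addr_ge0.
    apply: le_trans (expR_ge1Dx _).
    have -> : 1 + - (y / (1 + y)) = (1 + y)^-1 by field; rewrite gt_eqF// ltr_pwDl.
    exact: lexx.
  rewrite -expRM_natl ler_expR.
  have -> : x ^+ 2 / k.+1%:R = y ^+ 2 * k.+1%:R 
    by rewrite xE exprMn -mulrA; congr (_ * _); rewrite expr2 mulfK// gt_eqF.
  have -> : - x + y ^+ 2 * k.+1%:R = k.+1%:R * (y ^+ 2 - y) by rewrite xE; ring.
  rewrite ler_wpM2l// lerNl opprB ler_pdivlMr ?ltr_pwDl//; nra.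
- exact: cvg_cst.
- have -> : expR (- x) = expR (- x + x ^+ 2 * 0) by rewrite mulr0 addr0.
  apply: continuous_cvg; first exact: continuous_expR.
  apply: cvgD; first exact: cvg_cst.
  apply: cvgM; first exact: cvg_cst.
  exact: cvg_harmonic.
Unshelve. all: by end_near. Qed.

(** The heat flow is the limit of k + 1 implicit Euler steps of length t / (k + 1), each of which
    preserves nonnegativity. The flow is read off at x = 1, the pole, the only value that moments
    involve. *)
Lemma heat_poly_ge0 n P (a : nat -> R) N t : (0 < n)%N -> eigenbasis n P -> 0 <= t ->
  (forall x, - 1 <= x <= 1 -> 0 <= (\sum_(i < N) a i *: P i).[x]) ->
  0 <= \sum_(i < N) a i * expR (- ev n i * t) * (P i).[1].
Proof.
move=> n0 HP t0 H.
(* An Euler step divides the i-th coefficient by 1 + h [ev n i], so it never leaves the span of the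
   [P i]. *)
have pos (k : nat) h : 0 <= h -> forall x, - 1 <= x <= 1 ->
    0 <= (\sum_(i < N) (a i / (1 + h * ev n i) ^+ k) *: P i).[x].
  move=> h0; elim: k => [|k IH].
    by under eq_bigr do rewrite expr0 divr1.
  apply: (@resolvent_ge0 n h _ h0) => x x1; apply: le_trans (IH x x1) _.
  rewrite le_eqVlt; apply/orP; left; apply/eqP; congr (_.[x]).
  rewrite lapl_sum scaler_sumr -sumrB; apply: eq_bigr => i _.
  have [_ _ LP] := HP i; rewrite laplZ LP !scalerA -scalerBl; congr (_ *: _).
  have hp : 1 + h * ev n i != 0 by rewrite gt_eqF// ltr_pwDl// mulr_ge0// ev_ge0.
  by rewrite exprS; field; rewrite hp expf_neq0.
have C : (\sum_(i < N) a i * ((1 + ev n i * t / k.+1%:R) ^- k.+1) * (P i).[1]) @[k --> \oo] -->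
    \sum_(i < N) a i * expR (- ev n i * t) * (P i).[1].
  apply: cvg_big => [|i _]; first exact: add_continuous.
  apply: cvgM; last exact: cvg_cst.
  apply: cvgM; first exact: cvg_cst.
  by rewrite mulNr; apply: cvg_exp_inv; rewrite mulr_ge0// ev_ge0.
rewrite -(cvg_lim (@Rhausdorff R) C); apply: limr_ge.
  by apply/cvg_ex; eexists; exact: C.
near=> k.
have tk : 0 <= t / k.+1%:R by rewrite divr_ge0.
have x1 : - 1 <= (1 : R) <= 1 by lra.
have := pos k.+1 _ tk 1 x1; rewrite horner_sum; congr (_ <= _).
apply: eq_bigr => i _; rewrite hornerZ; congr (_ / (_ + _) ^+ _ * _).
by rewrite mulrC mulrA.
Unshelve. all: by end_near. Qed.

End positivity.

(** * From the sphere to functions of one variable *)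

Section der.
Context {R : realType}.
Implicit Types (f g : R -> R) (x a b : R).

(* Unlike [is_derive] this is not a typeclass, so that [apply] does not search for
   instances. *)
Definition has_der f x a := is_derive x 1 f a.

Lemma der_eq f x a b : has_der f x a -> a = b -> has_der f x b.
Proof. by move=> df <-. Qed.

Lemma der_cst (c : R) x : has_der (fun _ : R => c) x 0.
Proof. exact: is_derive_cst. Qed.

Lemma der_id x : has_der (fun y : R => y) x 1.
Proof. exact: is_derive_id. Qed.

Lemma derD f g x a b : has_der f x a -> has_der g x b ->
  has_der (fun y => f y + g y) x (a + b).
Proof. by move=> df dg; exact: is_deriveD. Qed.

Lemma derN f x a : has_der f x a -> has_der (fun y => - f y) x (- a).
Proof. by move=> df; exact: is_deriveN. Qed.

Lemma derM f g x a b : has_der f x a -> has_der g x b ->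
  has_der (fun y => f y * g y) x (f x * b + g x * a).
Proof. by move=> df dg; exact: is_deriveM. Qed.

Lemma derX f n x a : has_der f x a ->
  has_der (fun y => f y ^+ n) x (n%:R * f x ^+ n.-1 * a).
Proof.
move=> df; elim: n => [|n IH].
  rewrite !mul0r (_ : (fun _ => _) = fun=> 1); first exact: der_cst.
  by apply/funext => y; rewrite expr0.
rewrite (_ : (fun _ => _) = fun y => f y * f y ^+ n); last first.
  by apply/funext => y; rewrite exprS.
apply: (der_eq (derM df IH)).
by case: n {IH} => [|n]; rewrite /= -?natr1 ?exprS; ring.
Qed.

Lemma derV f x a : has_der f x a -> f x != 0 ->
  has_der (fun y => (f y)^-1) x (- f x ^- 2 * a).
Proof. by move=> df f0; exact: is_deriveV. Qed.

Lemma der_comp f g x a b : has_der g (f x) b -> has_der f x a ->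
  has_der (fun y => g (f y)) x (b * a).
Proof. by move=> dg df; exact: (@is_derive1_comp _ g f). Qed.

Lemma der_sqrt f x a : has_der f x a -> 0 < f x ->
  has_der (fun y => Num.sqrt (f y)) x ((2 * Num.sqrt (f x))^-1 * a).
Proof. by move=> df fx; apply: (der_comp (is_derive1_sqrt fx)). Qed.

End der.

Ltac der1 :=
  first
  [ match goal with
    | |- has_der (fun _ => ?cst) _ _ => apply: der_cst
    | H : has_der ?fn ?pt _ |- has_der ?fn ?pt _ => exact: H
    | |- has_der (fun y => y) _ _ => apply: der_id
    | |- has_der id _ _ => apply: der_id
    | |- has_der (fun y => _ + _) _ _ => apply: derD
    | |- has_der (fun y => - _) _ _ => apply: derN
    | |- has_der (fun y => _ * _) _ _ => apply: derM
    | |- has_der (fun y => _ ^+ _) _ _ => apply: derX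
    | |- has_der ( *%R _) _ _ => apply: derM
    | |- has_der ( +%R _) _ _ => apply: derD
    | |- has_der -%R _ _ => apply: derN
    | |- has_der (fun y => sin _) _ _ => apply: (der_comp (is_derive_sin _))
    | |- has_der (fun y => cos _) _ _ => apply: (der_comp (is_derive_cos _))
    | |- has_der (fun y => expR _) _ _ => apply: (der_comp (is_derive_expR _))
    | |- has_der sin _ _ => exact: is_derive_sin
    | |- has_der cos _ _ => exact: is_derive_cos
    | |- has_der expR _ _ => exact: is_derive_expR
    | H : is_derive _ _ ?fn _ |- has_der ?fn _ _ => exact: H
    | H : forall x, is_derive x _ ?fn _ |- has_der ?fn _ _ => exact: H
    | H : forall x, is_derive x _ ?fn _ |- has_der (fun y => ?fn _) _ _ =>
        apply: (der_comp (H _))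
    | |- has_der (horner _) _ _ => exact: is_derive_poly
    | |- has_der (fun y => horner _ _) _ _ => apply: (der_comp (is_derive_poly _ _))
    end | assumption ].
Ltac der := repeat der1.
Ltac Der := apply: der_eq; [der|rewrite /=].

Lemma cos_oo {R : realType} (r : R) : 0 < r < pi -> - 1 < cos r < 1.
Proof.
move=> /andP[r0 rpi].
have h0 : (0 : R) \in `[0, pi] by rewrite in_itv/= lexx pi_ge0.
have hr : r \in `[0, pi] by rewrite in_itv/= !ltW.
have hpi : (pi : R) \in `[0, pi] by rewrite in_itv/= lexx pi_ge0.
have := ltr_cos h0 hr; have := ltr_cos hr hpi; rewrite cos0 cospi => -> ->.
by rewrite r0 rpi.
Qed.

Section lines.
Context {R : realType}.

Lemma derive_line (V : normedModType R) (F : V -> R) (p v : V) (s : R) :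
  'D_v F (p + s *: v) = 'D_1 (fun u : R => F (p + u *: v)) s.
Proof.
rewrite /derive; set A := (fun h => _); set B := (fun h => _).
suff -> : A = B by [].
by apply/funext => h; rewrite /A /B/= [h%:A]mulr1 scalerDl addrCA.
Qed.

Lemma is_derive_line (V : normedModType R) (F : V -> R) (p v : V) (s : R) :
  derivable F (p + s *: v) v ->
  is_derive s 1 (fun u : R => F (p + u *: v)) ('D_v F (p + s *: v)).
Proof.
rewrite derive_line => dF; apply/derivableP; move: dF; rewrite /derivable.
set A := (fun h => _); set B := (fun h => _).
suff -> : A = B by [].
by apply/funext => h; rewrite /A /B/= [h%:A]mulr1 scalerDl addrCA.
Qed.

Lemma derive2_line (V : normedModType R) (F : V -> R) (p v : V) :
  'D_v ('D_v F) p = 'D_1 (fun s : R => 'D_1 (fun u : R => F (p + u *: v)) s) (0 : R).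
Proof.
rewrite -[p in LHS]addr0 -(scale0r v) derive_line.
have -> : (fun u : R => 'D_v F (p + u *: v)) =
  fun s : R => 'D_1 (fun u : R => F (p + u *: v)) s by apply/funext => s; exact: derive_line.
by [].
Qed.

Lemma is_derive_near (f g : R -> R) (x df : R) :
  (\forall y \near x, f y = g y) -> is_derive x 1 f df -> is_derive x 1 g df.
Proof. by move=> fg; apply: near_eq_is_derive; rewrite ?oner_eq0. Qed.

(* Second derivative at 0 of [g] along the curve [(c + a s) / sqrt (1 + 2 b s + s^2)],
   which is the first coordinate of the radial projection of [x + s e_i]. *)
Lemma derive2_curve (g g1 : R -> R) (g2 a b c : R) :
  (\forall y \near c, is_derive (y : R) 1 g (g1 y)) -> is_derive c 1 g1 g2 ->
  let phi := fun s => g ((c + a * s) / Num.sqrt (1 + 2 * b * s + s ^+ 2)) in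
  'D_1 (fun s => 'D_1 phi s) (0 : R) =
  g2 * (a - c * b) ^+ 2 + g1 c * (3 * c * b ^+ 2 - 2 * a * b - c).
Proof.
move=> dg dg1 phi.
pose q (s : R) : R := 1 + 2 * b * s + s ^+ 2.
pose w (s : R) : R := (Num.sqrt (q s))^-1.
pose Z (s : R) : R := (c + a * s) * w s.
pose Z1 (s : R) : R := a * w s - (c + a * s) * (b + s) * w s ^+ 3.
have q0 : q 0 = 1 by rewrite /q; ring.
have w0 : w 0 = 1 by rewrite /w q0 sqrtr1 invr1.
have Z0 : Z 0 = c by rewrite /Z w0; ring.
have cq : continuous q by rewrite /q; Ctn.
have qp : \forall s \near (0 : R), 0 < q s.
  by apply: (@cvgr_gt _ _ (nbhs (0 : R)) _ q (q 0) (cq 0)); rewrite q0.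
have dq (s : R) : is_derive s 1 q (2 * b + 2 * s).
  by rewrite /q; Der; ring.
have dw (s : R) : 0 < q s -> is_derive s 1 w (- (b + s) * w s ^+ 3).
  move=> qs.
  have sq : 0 < Num.sqrt (q s) by rewrite sqrtr_gt0.
  have sq0 : Num.sqrt (q s) != 0 by rewrite gt_eqF.
  apply: (der_eq (derV (der_sqrt (dq s) qs) sq0)).
  by rewrite /w; field.
have dZ (s : R) : 0 < q s -> is_derive s 1 Z (Z1 s).
  by move=> /dw ?; rewrite /Z /Z1; Der; ring.
have dZ1 : is_derive (0 : R) 1 Z1 (3 * c * b ^+ 2 - 2 * a * b - c).
  have ? : is_derive (0 : R) 1 w (- (b + 0) * w 0 ^+ 3) by apply: dw; rewrite q0.
  by rewrite /Z1; Der; rewrite w0; ring.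
have cZ : {for 0, continuous Z}.
  by apply: is_derive_continuous; apply: dZ; rewrite q0.
have dphi : \forall s \near (0 : R), g1 (Z s) * Z1 s = 'D_1 phi s.
  have dgZ : \forall s \near (0 : R), is_derive (Z s) 1 g (g1 (Z s)).
    by apply: (cZ (fun y => is_derive y 1 g (g1 y))); rewrite Z0.
  near=> s.
  have qs : 0 < q s by near: s.
  have dgs : is_derive (Z s) 1 g (g1 (Z s)) by near: s.
  by have [_ <-] := der_comp dgs (dZ s qs).
have dg10 : is_derive (Z 0) 1 g1 g2 by rewrite Z0.
have dZ0 : is_derive (0 : R) 1 Z (Z1 0) by apply: dZ; rewrite q0.
have := is_derive_near dphi (derM (der_comp dg10 dZ0) dZ1) => -[_ ->].
by rewrite Z0 /Z1 w0; ring.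
Unshelve. all: by end_near. Qed.

End lines.

Section section_continuity.
Context {R : realType}.

Lemma continuous_sectionr (f : R -> R -> R) (t x : R) :
  {for (t, x), continuous (fun p : R * R => f p.1 p.2)} -> {for x, continuous (f t)}.
Proof. by move=> cf; apply: (cvg_comp2 (cvg_cst t) cvg_id cf). Qed.

Lemma continuous_sectionl (f : R -> R -> R) (t x : R) :
  {for (t, x), continuous (fun p : R * R => f p.1 p.2)} ->
  {for t, continuous (fun s => f s x)}.
Proof. by move=> cf; apply: (cvg_comp2 cvg_id (cvg_cst x) cf). Qed.

End section_continuity.

Section radial.
Context {R : realType}.
Implicit Types (f : R -> R -> R) (t x r : R).

(** Recursive in the way [sphere_integral] is, so that integrals of zonal functions produce it
    directly; it is identified with the Gamma quotient [omega] in [omegaE]. *)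
Fixpoint sphere_vol (n : nat) : R :=
  if n is m.+1 then sphere_vol m * Int 0 pi (fun r => sin r ^+ m) else 2.

Definition dt f t x : R := 'D_1 (fun s => f s x) t.
Definition dx f t x : R := 'D_1 (f t) x.
Definition dxx f t x : R := 'D_1 (dx f t) x.

(* A kernel as a function [f t x] of the time [t] and of the cosine [x] of the distance to
   the pole; [rk_flux0] and [rk_fluxpi] are the regularity at the two poles. *)
Record radial_kernel (n : nat) f : Prop := RadialKernel {
  rk_cont : forall t x, 0 < t -> {for (t, x), continuous (fun p : R * R => f p.1 p.2)} ;
  rk_dt : forall t x, 0 < t -> is_derive t 1 (fun s => f s x) (dt f t x) ;
  rk_dt_cont : forall t x, 0 < t ->
    {for (t, x), continuous (fun p : R * R => dt f p.1 p.2)} ;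
  rk_dx : forall t x, 0 < t -> - 1 < x < 1 -> is_derive x 1 (f t) (dx f t x) ;
  rk_dxx : forall t x, 0 < t -> - 1 < x < 1 -> is_derive x 1 (dx f t) (dxx f t x) ;
  rk_heat : forall t x, 0 < t -> - 1 < x < 1 ->
    dt f t x = (1 - x ^+ 2) * dxx f t x - n%:R * x * dx f t x ;
  rk_flux0 : forall t, 0 < t -> sin r * dx f t (cos r) @[r --> 0^'+] --> 0 ;
  rk_fluxpi : forall t, 0 < t -> sin r * dx f t (cos r) @[r --> pi^'-] --> 0 ;
  rk_init : forall q : R -> R, continuous q ->
    Int 0 pi (fun r => f t (cos r) * q (cos r) * sin r ^+ n.-1) @[t --> 0^'+]
      --> q 1 / sphere_vol n.-1
}.

Lemma sphere_vol_gt0 n : 0 < sphere_vol n.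
Proof.
elim: n => //= m IH; rewrite mulr_gt0// lt_def Int_ge0 ?andbT; last first.
  by move=> x xpi; rewrite exprn_ge0// sin_ge0_pi.
apply/eqP => I0.
have pi0 := pi_gt0 R.
have : sin (pi / 2 : R) ^+ m = 0.
  apply: (@Int_eq0 _ 0 pi (fun x => sin x ^+ m)) => //.
  - by Ctn.
  - by move=> x xpi; rewrite exprn_ge0// sin_ge0_pi.
  - lra.
by rewrite sin_pihalf expr1n => /eqP; rewrite oner_eq0.
Qed.

Lemma sphere_integral_cst n (c : R) : sphere_integral (fun _ : 'rV[R]_n.+1 => c) = c * sphere_vol n.
Proof.
elim: n c => [|n IH] c /=; first by rewrite mulr_natr mulr2n.
under eq_Rintegral do rewrite IH mulrC.
rewrite -[LHS]/(Int 0 pi (fun r => c * sphere_vol n * sin r ^+ n)) IntZl; last by Ctn.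
by rewrite mulrA.
Qed.

End radial.

(** * Restriction of a heat kernel to the great circle through [e0] and [e1] *)

Section from_kernel.
Context {R : realType}.
Variables (m : nat) (k : R -> R -> R).
Hypothesis kP : is_heat_kernel m.+1 k.
Implicit Types (t x r a b s : R).
Local Notation V := 'rV[R]_m.+2.

Let f t x := k t (acosc x).
Let e0 : V := delta_mx 0 0.
Let e1 : V := delta_mx 0 (lift 0 0).
Let F (p : R * V) := k p.1 (geodesic_dist e0 (radial_proj p.2)).
Let vec a b : V := a *: e0 + b *: e1.

Let e0E (i : 'I_m.+2) : e0 0 i = (i == 0)%:R.
Proof. by rewrite /e0 mxE eqxx. Qed.

Let dotpe0 (x : V) : dotp e0 x = x 0 0.
Proof.
rewrite /dotp (bigD1 0)//= e0E eqxx mul1r big1 ?addr0// => i i0.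
by rewrite e0E (negbTE i0) mul0r.
Qed.

Let sphere_e0 : sphere m.+1 e0.
Proof. by rewrite /sphere/= dotpe0 e0E. Qed.

Let vec0 a b : vec a b 0 0 = a.
Proof. by rewrite !mxE/= mulr1 mulr0 addr0. Qed.

Let dotp_vec a b : dotp (vec a b) (vec a b) = a ^+ 2 + b ^+ 2.
Proof.
rewrite /dotp 2!big_ord_recl/= big1 ?addr0; last first.
  by move=> i _; rewrite !mxE/= !mulr0 addr0 mul0r.
by rewrite !mxE/= !mulr1 !mulr0 addr0 add0r !expr2.
Qed.

Let Zle (x : V) : - 1 <= x 0 0 / Num.sqrt (dotp x x) <= 1.
Proof.
have H : x 0 0 ^+ 2 <= dotp x x.
  rewrite /dotp (bigD1 0)//= -expr2 lerDl.
  by apply: sumr_ge0 => i _; rewrite -expr2 sqr_ge0.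
have [d0|d0] := eqVneq (Num.sqrt (dotp x x)) 0.
  by rewrite d0 invr0 mulr0; lra.
have dp : 0 < Num.sqrt (dotp x x) by rewrite lt_def d0 sqrtr_ge0.
rewrite -ler_norml normrM normfV (gtr0_norm dp) ler_pdivrMr// mul1r.
by rewrite -sqrtr_sqr ler_wsqrtr.
Qed.

Let FE t (x : V) : F (t, x) = f t (x 0 0 / Num.sqrt (dotp x x)).
Proof.
rewrite /F /f /geodesic_dist dotpe0 /radial_proj mxE /acosc clamp_id ?Zle//.
by rewrite mulrC.
Qed.

Let Fvec t a b : F (t, vec a b) = f t (a / Num.sqrt (a ^+ 2 + b ^+ 2)).
Proof. by rewrite FE vec0 dotp_vec. Qed.

Let vec_neq0 a b : a ^+ 2 + b ^+ 2 != 0 -> vec a b != 0.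
Proof.
apply: contra => /eqP v0; rewrite -dotp_vec v0 /dotp big1// => i _.
by rewrite mxE mul0r.
Qed.

Let smooth : smooth_on [set p : R * V | 0 < p.1 /\ p.2 != 0] F.
Proof. by have [] := kP sphere_e0. Qed.

Let cvec (T : topologicalType) (g h : T -> R) (x : T) :
  {for x, continuous g} -> {for x, continuous h} ->
  {for x, continuous (fun y => vec (g y) (h y))}.
Proof.
by move=> cg ch; apply: cvgD; apply: cvgZr_tmp.
Qed.

Let contF (T : topologicalType) (s : seq (R * V)) (g : T -> R) (v : T -> V) (x : T) :
  {for x, continuous g} -> {for x, continuous v} -> 0 < g x -> v x != 0 ->
  {for x, continuous (fun y => iter_derive s F (g y, v y))}.
Proof.
move=> cg cv gx vx.
have [c _] := @smooth s (g x, v x) (conj gx vx).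
apply: (@ctn_comp _ _ _ (iter_derive s F) (fun y => (g y, v y)) x c).
exact: (cvg_pair cg cv).
Qed.

(** The point at cosine x from the pole [e0]. The square root is not differentiable at x = 1 and x =
    -1, so this curve serves for continuity and for time derivatives; derivatives in x go through
    affine charts. *)
Let circ x := vec (clamp (- 1) 1 x) (Num.sqrt (1 - clamp (- 1) 1 x ^+ 2)).

Let clamp1 x : - 1 <= clamp (- 1) 1 x <= 1.
Proof. by apply: clamp_itv; lra. Qed.

Let circ1 x : clamp (- 1) 1 x ^+ 2 + Num.sqrt (1 - clamp (- 1) 1 x ^+ 2) ^+ 2 = 1.
Proof. by have := clamp1 x => c1; rewrite sqr_sqrtr; [ring|nra]. Qed.

Let circ_neq0 x : circ x != 0.
Proof. by apply: vec_neq0; rewrite circ1 oner_eq0. Qed.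

Let Fcirc t x : F (t, circ x) = f t x.
Proof.
rewrite Fvec circ1 sqrtr1 divr1 /f; congr (k t _); rewrite /acosc; congr acos.
exact: clamp_id.
Qed.

Let ccirc : continuous circ.
Proof.
have cc := @continuous_clamp R (- 1) 1.
move=> x; apply: cvec; first exact: cc.
change {for x, continuous (fun y => Num.sqrt (1 - clamp (- 1) 1 y ^+ 2))}; ctn.
Qed.

Let fcont t x : 0 < t -> {for (t, x), continuous (fun p : R * R => f p.1 p.2)}.
Proof.
move=> t0; rewrite (_ : (fun p => _) = fun p : R * R => F (p.1, circ p.2)); last first.
  by apply/funext => p; rewrite Fcirc.
apply: (@contF _ [::] fst (fun p : R * R => circ p.2)).
- exact: ctn_fst.
- by apply: (ctn_comp (@ccirc _)); exact: ctn_snd.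
- exact: t0.
- exact: circ_neq0.
Qed.

Let vt : R * V := (1, 0).

Let fdt t x : 0 < t -> is_derive t 1 (fun s => f s x) ('D_vt F (t, circ x)).
Proof.
move=> t0.
have E s : (0, circ x) + s *: vt = (s, circ x).
  by rewrite /vt [_ + _]surjective_pairing /= add0r [s%:A]mulr1 scaler0 addr0.
rewrite (_ : (fun s => f s x) = fun s => F ((0, circ x) + s *: vt)); last first.
  by apply/funext => s; rewrite E Fcirc.
rewrite -(E t); apply: is_derive_line; rewrite E.
by have [_ d] := @smooth [::] (t, circ x) (conj t0 (circ_neq0 x)); exact: d.
Qed.

Let dtE t x : 0 < t -> dt f t x = 'D_vt F (t, circ x).
Proof. by move=> t0; have [_] := fdt x t0. Qed.

Let fdt_cont t x : 0 < t -> {for (t, x), continuous (fun p : R * R => dt f p.1 p.2)}.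
Proof.
move=> t0.
have H : {for (t, x), continuous (fun p : R * R => iter_derive [:: vt] F (p.1, circ p.2))}.
  apply: (@contF _ [:: vt] fst (fun p : R * R => circ p.2)).
  - exact: ctn_fst.
  - by apply: (ctn_comp (@ccirc _)); exact: ctn_snd.
  - exact: t0.
  - exact: circ_neq0.
rewrite /prop_for/continuous_at /= dtE//.
apply: cvg_trans H; apply: near_eq_cvg; near=> p; rewrite /= dtE//.
by near: p; exact: (@ctn_fst R R (t, x) _ (near_gt t0)).
Unshelve. all: by end_near. Qed.

(* Restriction of [F t] to an affine line; [c] is a constant vector, [d] a direction. *)
Let chart t (c d : V) b := F (t, c + b *: d).
Let chart1 t (c d : V) b := 'D_(0, d) F (t, c + b *: d).
Let chart2 t (c d : V) b := 'D_(0, d) ('D_(0, d) F) (t, c + b *: d).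

Let lineE t (c d : V) b : (t, c) + b *: ((0, d) : R * V) = (t, c + b *: d).
Proof. by rewrite [_ + _]surjective_pairing /= scaler0 addr0. Qed.

Let dchart t (c d : V) b : 0 < t -> c + b *: d != 0 ->
  is_derive b 1 (chart t c d) (chart1 t c d b).
Proof.
move=> t0 cd; rewrite /chart1 /chart -lineE.
rewrite (_ : (fun b => _) = fun b => F ((t, c) + b *: (0, d))); last first.
  by apply/funext => s; rewrite lineE.
apply: is_derive_line; rewrite lineE.
by have [_ dF] := @smooth [::] (t, c + b *: d) (conj t0 cd); exact: dF.
Qed.

Let dchart1 t (c d : V) b : 0 < t -> c + b *: d != 0 ->
  is_derive b 1 (chart1 t c d) (chart2 t c d b).
Proof.
move=> t0 cd; rewrite /chart2 /chart1 -lineE.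
rewrite (_ : (fun b => _) = fun b => 'D_(0, d) F ((t, c) + b *: (0, d))); last first.
  by apply/funext => s; rewrite lineE.
apply: is_derive_line; rewrite lineE.
by have [_ dF] := @smooth [:: (0, d)] (t, c + b *: d) (conj t0 cd); exact: dF.
Qed.

Let e1vec b : e1 + b *: e0 = vec b 1.
Proof. by rewrite /vec scale1r addrC. Qed.

Let e1vec0 b : e1 + b *: e0 != 0.
Proof. by rewrite e1vec vec_neq0// expr1n gt_eqF// ltr_wpDl// sqr_ge0. Qed.

Let near_oo (a b x : R) : a < x < b -> \forall y \near x, a < y < b.
Proof.
move=> /andP[ax xb]; near=> y; apply/andP; split; near: y.
  exact: near_gt.
exact: near_lt.
Unshelve. all: by end_near. Qed.

(** For x = cos r this is 1 / sin r, so [x * B x] is cot r. *)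
Let B x : R := (Num.sqrt (1 - x ^+ 2))^-1.

Let dB x : - 1 < x < 1 -> is_derive x 1 B (x * B x ^+ 3).
Proof.
move=> x1; have q0 : 0 < 1 - x ^+ 2 by nra.
have dq : has_der (fun y => 1 - y ^+ 2) x (- (2 * x)) by Der; ring.
have sq0 : Num.sqrt (1 - x ^+ 2) != 0 by rewrite gt_eqF// sqrtr_gt0.
by apply: (der_eq (derV (der_sqrt dq q0) sq0)); rewrite /B; field.
Qed.

(** By homogeneity of degree 0 the point cos r e0 + sin r e1 may be replaced by e1 + cot r e0.
    Derivatives in x thus become derivatives of [F] along an affine line, for which smoothness is
    assumed. *)
Let fchart t x : - 1 < x < 1 -> f t x = chart t e1 e0 (x * B x).
Proof.
move=> x1; have q0 : 0 < 1 - x ^+ 2 by nra.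
rewrite /chart e1vec Fvec expr1n; congr (f t _).
have sq0 : 0 < Num.sqrt (1 - x ^+ 2) by rewrite sqrtr_gt0.
have E : (x * B x) ^+ 2 + 1 = B x ^+ 2.
  rewrite /B exprMn exprVn sqr_sqrtr ?(ltW q0)//; field.
  by rewrite gt_eqF.
by rewrite E sqrtr_sqr gtr0_norm ?invr_gt0// /B mulfK// invr_eq0 gt_eqF.
Qed.

Let fdx t x : 0 < t -> - 1 < x < 1 ->
  is_derive x 1 (f t) (chart1 t e1 e0 (x * B x) * (B x + x ^+ 2 * B x ^+ 3)).
Proof.
move=> t0 x1.
apply: (@is_derive_near _ (fun y => chart t e1 e0 (y * B y))).
  by near=> y; rewrite fchart//; near: y; exact: near_oo.
have dBx := dB x1.
have dc := dchart t0 (e1vec0 (x * B x)).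
have dxB : has_der (fun y => y * B y) x (B x + x ^+ 2 * B x ^+ 3) by Der; ring.
exact: (@der_comp _ (fun y => y * B y) (chart t e1 e0) x _ _ dc dxB).
Unshelve. all: by end_near. Qed.

Let fdx' t x : 0 < t -> - 1 < x < 1 -> is_derive x 1 (f t) (dx f t x).
Proof. by move=> t0 x1; apply/derivableP; apply: ex_derive; exact: fdx. Qed.

Let fdxx t x : 0 < t -> - 1 < x < 1 -> is_derive x 1 (dx f t) (dxx f t x).
Proof.
move=> t0 x1; apply/derivableP.
have dBx := dB x1.
have dc := dchart1 t0 (e1vec0 (x * B x)).
have dxB : has_der (fun y => y * B y) x (B x + x ^+ 2 * B x ^+ 3) by Der; ring.
have d1 := @der_comp _ (fun y => y * B y) (chart1 t e1 e0) x _ _ dc dxB.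
have d2 : has_der (fun y => B y + y ^+ 2 * B y ^+ 3) x
   (x * B x ^+ 3 + (x ^+ 2 * (3 * B x ^+ 2 * (x * B x ^+ 3)) + B x ^+ 3 * (2 * x))).
  by Der; ring.
have d3 := derM d1 d2.
apply: ex_derive; apply: is_derive_near d3; near=> y.
have y1 : - 1 < y < 1 by near: y; exact: near_oo.
by have [_ <-] := fdx t0 y1.
Unshelve. all: by end_near. Qed.

Let fheat t x : 0 < t -> - 1 < x < 1 ->
  dt f t x = (1 - x ^+ 2) * dxx f t x - m.+1%:R * x * dx f t x.
Proof.
move=> t0 x1.
have q0 : 0 < 1 - x ^+ 2 by nra.
have xcl : clamp (- 1) 1 x = x by apply: clamp_id; lra.
pose z := circ x.
have z0 : z 0 0 = x by rewrite /z vec0.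
have zz : dotp z z = 1 by rewrite dotp_vec circ1.
have [_ /(_ t z t0 zz) H _] := kP sphere_e0.
have gz : geodesic_dist e0 z = acosc x.
  by rewrite /geodesic_dist dotpe0 z0 /acosc xcl.
move: H; rewrite gz -[LHS]/(dt f t x) => ->.
rewrite /sphere_laplacian /laplacian.
clearbody z.
set Phi : V -> R := _ \o _.
have PhiE y : Phi y = f t (y 0 0 / Num.sqrt (dotp y y)) by rewrite -FE.
(* [derive2_curve] with c = x, a = e0_i, b = z_i. The sum over i then uses <e0, e0> = <z, z> = 1 and
   <e0, z> = x, and the last term, repeated m + 2 times, leaves - (m + 1) x after 3 x - 2 x. *)
have dd (i : 'I_m.+2) : 'D_(delta_mx 0 i) ('D_(delta_mx 0 i) Phi) z =
    dxx f t x * (e0 0 i - x * z 0 i) ^+ 2 +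
    dx f t x * (3 * x * z 0 i ^+ 2 - 2 * e0 0 i * z 0 i - x).
  rewrite derive2_line.
  rewrite (_ : (fun u : R => Phi (z + u *: delta_mx 0 i)) = fun s =>
      f t ((x + e0 0 i * s) / Num.sqrt (1 + 2 * z 0 i * s + s ^+ 2))); last first.
    apply/funext => s; rewrite PhiE; congr (f t (_ / Num.sqrt _)).
      by rewrite !mxE/= z0 eq_sym mulrC.
    rewrite /dotp (eq_bigr (fun j => z 0 j * z 0 j +
       (2 * s * (z 0 j * (j == i)%:R) + s ^+ 2 * (j == i)%:R))); last first.
      move=> j _; rewrite !mxE/=; case: (j == i) => /=; ring.
    rewrite big_split/= big_split/= -!mulr_sumr -/(dotp z z) zz.
    rewrite (bigD1 i)//= eqxx big1 => [|j /negbTE ->]; last by rewrite mulr0.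
    rewrite (bigD1 i)//= eqxx big1 => [|j /negbTE ->]; last by [].
    rewrite -[true%:R]/(1 : R); ring.
  apply: derive2_curve; last exact: fdxx.
  by near=> y; apply: fdx' => //; near: y; exact: near_oo.
rewrite (eq_bigr _ (fun i _ => dd i)).
have S1 : \sum_(i < m.+2) e0 0 i * e0 0 i = 1 by have := dotpe0 e0; rewrite e0E.
have S2 : \sum_(i < m.+2) e0 0 i * z 0 i = x by have := dotpe0 z; rewrite z0.
rewrite (eq_bigr (fun i => (dxx f t x * (e0 0 i * e0 0 i) +
   (- (2 * x * dxx f t x + 2 * dx f t x)) * (e0 0 i * z 0 i)) +
   ((dxx f t x * x ^+ 2 + 3 * x * dx f t x) * (z 0 i * z 0 i) - dx f t x * x))); last first.
  by move=> i _; ring.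
rewrite big_split/= [X in X + _]big_split/= big_split/= -!mulr_sumr S1 S2 -/(dotp z z) zz.
have -> : \sum_(i < m.+2) - (dx f t x * x) = - (dx f t x * x) * (m.+1%:R + 1).
  by rewrite natr1 sumr_const card_ord mulr_natr.
ring.
Unshelve. all: by end_near. Qed.

(** Near the pole c = 1 or c = -1, follow the affine line c e0 + b e1 with b = tan r: there - sin r
    [dx f t (cos r)] is the derivative in b divided by cos^2 r, and it tends to its value at b =
    0. *)
Let flux_near t (c : R) r0 (A : set_system R) : Filter A -> 0 < t -> c ^+ 2 = 1 ->
  cos r0 = c -> A --> r0 -> (\forall r \near A, 0 < r < pi) ->
  sin r * dx f t (cos r) @[r --> A] --> 0.
Proof.
move=> FA t0 c1 cr0 Ar0 A0.
have sr0 : sin r0 = 0.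
  by apply/eqP; rewrite -sqrf_eq0 sin2cos2 cr0 c1 subrr.
have vE b : c *: e0 + b *: e1 = vec c b by [].
have v0 b : c *: e0 + b *: e1 != 0.
  by rewrite vE vec_neq0// c1 gt_eqF// ltr_pwDl// sqr_ge0.
(* The kernel is even in b, being a function of the distance to the pole, so its derivative at b = 0
   vanishes. *)
have h0 : chart1 t (c *: e0) e1 0 = 0.
  have d0 := dchart t0 (v0 0).
  have dN : has_der (chart t (c *: e0) e1) (- 0) (chart1 t (c *: e0) e1 0) by rewrite oppr0.
  have := der_comp dN (derN (der_id 0)).
  rewrite (_ : (fun y => _) = chart t (c *: e0) e1); last first.
    by apply/funext => y; rewrite /chart !vE !Fvec sqrrN.
  move=> [_ E]; have [_ E'] := d0; move: E; rewrite E'; lra.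
have cE : {for r0, continuous (fun r => - (chart1 t (c *: e0) e1 (sin r / cos r) * (cos r)^-1 ^+ 2))}.
  have cr : cos r0 != 0 by apply/eqP => cc; move: c1; rewrite -cr0 cc; lra.
  have cV : {for r0, continuous (fun r => (cos r)^-1)}.
    by apply: cvgV => //; exact: continuous_cos.
  have ct : {for r0, continuous (fun r => sin r / cos r)} by ctn.
  apply: ctnN; apply: ctnM; last by ctn.
  apply: (@contF _ [:: (0, e1)] (fun=> t) (fun r => vec c (sin r / cos r))).
  - exact: ctn_cst.
  - by apply: cvec; [exact: ctn_cst|exact: ct].
  - exact: t0.
  - by rewrite -vE.
have E0 : - (chart1 t (c *: e0) e1 (sin r0 / cos r0) * (cos r0)^-1 ^+ 2) = 0.
  by rewrite sr0 mul0r h0 mul0r oppr0.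
have cA : - (chart1 t (c *: e0) e1 (sin r / cos r) * (cos r)^-1 ^+ 2) @[r --> A] --> 0.
  by rewrite -[X in _ --> X]E0 => P PE; apply: Ar0; exact: (cE P PE).
apply: cvg_trans cA; apply: near_eq_cvg.
have cr0' : 0 < c * cos r0 by rewrite cr0 -expr2 c1.
have cc : continuous (fun r => c * cos r) by Ctn.
have crA : \forall r \near A, 0 < c * cos r.
  by apply: Ar0; apply: (@cvgr_gt _ _ (nbhs r0) _ (fun r => c * cos r) _ (cc r0)).
near=> r.
have rpi : 0 < r < pi by near: r.
have ccr : 0 < c * cos r by near: r.
have sr : 0 < sin r by exact: sin_gt0_pi.
have crn0 : cos r != 0 by apply/eqP => E; move: ccr; rewrite E mulr0 ltxx.
have cr1 : - 1 < cos r < 1.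
  exact: cos_oo.
have d1 := der_comp (fdx' t0 cr1) (is_derive_cos r).
have dtan : has_der (fun r => sin r / cos r) r ((cos r)^-1 ^+ 2).
  apply: (der_eq (derM (is_derive_sin r) (derV (is_derive_cos r) crn0))).
  have := cos2Dsin2 r => /(canRL (addKr _)) s2.
  rewrite -(mulr1 ((cos r)^-1 ^+ 2)) -(cos2Dsin2 r); field.
  exact: crn0.
have d2 := @der_comp _ (fun r => sin r / cos r) (chart t (c *: e0) e1) r _ _
  (dchart t0 (v0 (sin r / cos r))) dtan.
have : has_der (fun r => f t (cos r)) r
   (chart1 t (c *: e0) e1 (sin r / cos r) * (cos r)^-1 ^+ 2).
  apply: is_derive_near d2.
  have nr : \forall y \near r, 0 < c * cos y.
    exact: (@cvgr_gt _ _ (nbhs r) _ (fun r => c * cos r) _ (cc r) _ ccr).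
  near=> y; have cy : 0 < c * cos y by near: y.
  rewrite /chart vE Fvec; congr (f t _).
  have cyn0 : cos y != 0 by apply/eqP => E; move: cy; rewrite E mulr0 ltxx.
  have -> : c ^+ 2 + (sin y / cos y) ^+ 2 = (c * cos y)^-1 ^+ 2.
    have -> : (c * cos y)^-1 ^+ 2 = (cos y ^+ 2)^-1 by rewrite exprVn exprMn c1 mul1r.
    by rewrite c1 exprMn sin2cos2 exprVn; field.
  rewrite sqrtr_sqr gtr0_norm ?invr_gt0// invrK mulrA -expr2 c1 mul1r//.
move=> [_ <-]; have [_ ->] := d1; ring.
Unshelve. all: by end_near. Qed.

(** For a zonal integrand the inner spherical integral is that of a constant and contributes the
    factor [sphere_vol m], which is divided out. *)
Let finit (q : R -> R) : continuous q ->
  Int 0 pi (fun r => f t (cos r) * q (cos r) * sin r ^+ m) @[t --> 0^'+]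
      --> q 1 / sphere_vol m.
Proof.
move=> cq.
have [_ _ /(_ (fun x : V => q (x 0 0))) H] := kP sphere_e0.
have cH : {within sphere m.+1, continuous (fun x : V => q (x 0 0))}.
  apply: continuous_subspaceT => x.
  by apply: (@continuous_comp _ _ _ (fun y : V => y 0 0) q); [exact: coord_continuous|exact: cq].
have := H cH; rewrite e0E eqxx => {}H.
have vn0 : sphere_vol m != 0 :> R by rewrite gt_eqF// sphere_vol_gt0.
set SI := (fun t : R => sphere_integral _) in H.
have {}H : SI t / sphere_vol m @[t --> 0^'+] --> q 1 / sphere_vol m.
  by apply: cvgM; [exact: H|exact: cvg_cst].
apply: cvg_trans H; apply: near_eq_cvg; near=> t.
have t0 : 0 < t by near: t; exact: nbhs_right_gt.
rewrite /SI /=.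
have cf : continuous (f t).
  move=> x; change {for x, continuous (f t)}.
  apply: (@continuous_sectionr _ f t x); exact: fcont.
have E phi (w : 'rV[R]_m.+1) :
    (row_mx (cos phi)%:M (sin phi *: w) : 'rV[R]_(1 + m.+1)) 0 0 = cos phi.
  have -> : (0 : 'I_(1 + m.+1)) = lshift m.+1 0 by exact/val_inj.
  by rewrite row_mxEl mxE eqxx.
transitivity (Int 0 pi (fun phi => f t (cos phi) * q (cos phi) * sin phi ^+ m * sphere_vol m)
   / sphere_vol m); last first.
  by rewrite IntZr ?mulfK//; Ctn.
congr (_ / _); apply: eq_Int => phi phi_pi.
rewrite (_ : (fun w => _) = fun=> f t (cos phi) * q (cos phi)); last first.
  apply/funext => w; rewrite /geodesic_dist dotpe0 E; congr (_ * _).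
  by rewrite /f /acosc clamp_id// cos_geN1 cos_le1.
by rewrite sphere_integral_cst mulrCA mulrA.
Unshelve. all: by end_near. Qed.

Lemma radial_kernel_of_heat_kernel : radial_kernel m.+1 (fun t x => k t (acosc x)).
Proof.
split.
- exact: fcont.
- by move=> t x t0; rewrite dtE//; exact: fdt.
- exact: fdt_cont.
- exact: fdx'.
- exact: fdxx.
- exact: fheat.
- move=> t t0; apply: (@flux_near t 1 0) => //; first by rewrite expr1n.
  + exact: cos0.
  + exact: cvg_within.
  + near=> r; apply/andP; split; near: r; first exact: nbhs_right_gt.
    exact: nbhs_right_lt (pi_gt0 R).
- move=> t t0; apply: (@flux_near t (- 1) pi) => //; first by rewrite sqrrN expr1n.
  + exact: cospi.
  + exact: cvg_within.
  + near=> r; apply/andP; split; near: r; last exact: nbhs_left_lt.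
    exact: nbhs_left_gt (pi_gt0 R).
- exact: finit.
Unshelve. all: by end_near. Qed.

End from_kernel.

(** * Moments of the kernel *)

Section FTC_open.
Context {R : realType}.

(** Near the poles only the limit of the flux is known; hence a form in which the primitive has
    one-sided limits and its values at the ends are irrelevant. *)
Lemma FTC_open (a b la lb : R) (f F : R -> R) : a < b -> continuous f ->
  (forall x, a < x < b -> is_derive x 1 F (f x)) ->
  F x @[x --> a^'+] --> la -> F x @[x --> b^'-] --> lb -> Int a b f = lb - la.
Proof.
move=> ab cf dF Fa Fb.
pose G x := if x <= a then la else if b <= x then lb else F x.
have GF x : a < x < b -> G x = F x.
  by move=> /andP[ax xb]; rewrite /G leNgt ax/= leNgt xb.
have dG x : a < x < b -> is_derive x 1 G (f x).
  move=> /andP[ax xb]; have dFx : is_derive x 1 F (f x) by apply: dF; rewrite ax.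
  apply: is_derive_near dFx; near=> y; rewrite GF//; apply/andP; split; near: y.
    exact: near_gt.
  exact: near_lt.
have -> : lb = G b by rewrite /G leNgt ab/= lexx.
have -> : la = G a by rewrite /G lexx.
apply: (FTC (ltW ab) cf dG); apply/continuous_within_itvP => //; split.
- by move=> x; rewrite in_itv/= => /dG; exact: is_derive_continuous.
- rewrite {2}/G lexx; apply: cvg_trans Fa; apply: near_eq_cvg; near=> x.
  apply/esym; apply: GF; apply/andP; split; near: x; first exact: nbhs_right_gt.
  exact: nbhs_right_lt.
- rewrite {2}/G (leNgt b) ab/= lexx; apply: cvg_trans Fb; apply: near_eq_cvg; near=> x.
  apply/esym; apply: GF; apply/andP; split; near: x; last exact: nbhs_left_lt.
  exact: nbhs_left_gt.
Unshelve. all: by end_near. Qed.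

Lemma cvg_at_cont (A : set_system R) {FA : Filter A} (f : R -> R) (x : R) :
  continuous f -> A --> x -> f y @[y --> A] --> f x.
Proof. by move=> cf Ax P /(cf x P); exact: Ax. Qed.

Lemma at_right_cont (f : R -> R) (x : R) : continuous f -> f y @[y --> x^'+] --> f x.
Proof. by move=> cf; apply: cvg_at_cont => //; exact: cvg_within. Qed.

Lemma at_left_cont (f : R -> R) (x : R) : continuous f -> f y @[y --> x^'-] --> f x.
Proof. by move=> cf; apply: cvg_at_cont => //; exact: cvg_within. Qed.

Lemma near_cvg_cst (f : R -> R) (a l c : R) : (forall x, a < x -> f x = c) ->
  f x @[x --> a^'+] --> l -> c = l.
Proof.
move=> fc fl; apply: (@cvg_unique R (@Rhausdorff R) (f x @[x --> a^'+])) fl.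
apply: cvg_near_cst; near=> x; apply: fc.
by near: x; exact: nbhs_right_gt.
Unshelve. all: by end_near. Qed.
End FTC_open.

Section moments.
Context {R : realType}.
Implicit Types (f g : R -> R -> R) (q : R -> R) (p : {poly R}) (n : nat) (t : R).

Definition mom n f t q : R := Int 0 pi (fun r => f t (cos r) * q (cos r) * sin r ^+ n.-1).

Lemma rk_contr n f t : radial_kernel n f -> 0 < t -> continuous (f t).
Proof.
move=> fP t0 x; change {for x, continuous (f t)}.
by apply: continuous_sectionr; exact: (rk_cont fP).
Qed.

Lemma rk_dt_contr n f t : radial_kernel n f -> 0 < t -> continuous (dt f t).
Proof.
move=> fP t0 x; change {for x, continuous (dt f t)}.
by apply: continuous_sectionr; exact: (rk_dt_cont fP).
Qed.

Lemma mom_sum n f t (I : Type) (s : seq I) (a : I -> R) (P : I -> {poly R}) :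
  continuous (f t) ->
  mom n f t (horner (\sum_(i <- s) a i *: P i)) = \sum_(i <- s) a i * mom n f t (horner (P i)).
Proof.
move=> cf; elim: s => [|i s IH].
  rewrite !big_nil /mom; under eq_Int do rewrite horner0 mulr0 mul0r.
  exact: Int0.
rewrite !big_cons -IH /mom -IntZl; last by Ctn.
rewrite -IntD; [|by Ctn..].
by apply: eq_Int => r _; rewrite hornerD hornerZ; ring.
Qed.

Lemma mom_lapl n f t p : (0 < n)%N -> radial_kernel n f -> 0 < t ->
  Int 0 pi (fun r => dt f t (cos r) * p.[cos r] * sin r ^+ n.-1) =
  mom n f t (horner (lapl n p)).
Proof.
move=> n0 fP t0.
have cf := rk_contr fP t0; have cdt := rk_dt_contr fP t0.
apply/eqP; rewrite -subr_eq0 -IntB; [|by Ctn..]; apply/eqP.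
(* Weighted Wronskian of [f t] and p; as d/dr = - sin r d/dx, its derivative is (L f p - f L p)
   sin^(n-1). [F1] regroups it to expose [sin r * dx f t (cos r)], whose limits at the poles are
   known. *)
pose F r := - (sin r ^+ n * (dx f t (cos r) * p.[cos r] - f t (cos r) * p^`().[cos r])).
pose F1 r := - (sin r ^+ n.-1 * p.[cos r] * (sin r * dx f t (cos r)) -
   sin r ^+ n * (f t (cos r) * p^`().[cos r])).
have FF1 : F = F1.
  apply/funext => r; rewrite /F /F1; move: n0; case: (n) => // k _.
  by rewrite [k.+1.-1]/= exprS; ring.
rewrite -[RHS](subrr (0 : R)); apply: (@FTC_open _ _ _ _ _ _ F (pi_gt0 R)).
- by Ctn.
- move=> r /cos_oo cr.
  have d1 := rk_dx fP t0 cr; have d2 := rk_dxx fP t0 cr.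
  have d1' := @der_comp _ cos (f t) r _ _ d1 (is_derive_cos r).
  have d2' := @der_comp _ cos (dx f t) r _ _ d2 (is_derive_cos r).
  rewrite /F; apply: der_eq; first by der.
  rewrite /= (rk_heat fP t0 cr) laplE; have := sin2cos2 r => s2.
  move: n0; case: (n) => // k _; rewrite [k.+1.-1]/= exprS.
  have -> : 1 - cos r ^+ 2 = sin r ^+ 2 by rewrite s2.
  ring.
- rewrite FF1; have E0 : - (sin 0 ^+ n.-1 * p.[cos 0] * 0 -
      sin 0 ^+ n * (f t (cos 0) * p^`().[cos 0])) = 0.
    by rewrite mulr0 sin0 expr0n; case: (n) n0 => // k _; rewrite mul0r subr0 oppr0.
  rewrite -[X in _ --> X]E0.
  apply: cvgN; apply: cvgB; last by apply: (@at_right_cont _ (fun r => sin r ^+ n * (f t (cos r) * p^`().[cos r]))); Ctn.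
  by apply: cvgM; [apply: (@at_right_cont _ (fun r => sin r ^+ n.-1 * p.[cos r])); Ctn|exact: (rk_flux0 fP)].
- rewrite FF1; have E0 : - (sin pi ^+ n.-1 * p.[cos pi] * 0 -
      sin pi ^+ n * (f t (cos pi) * p^`().[cos pi])) = 0.
    by rewrite mulr0 sinpi expr0n; case: (n) n0 => // k _; rewrite mul0r subr0 oppr0.
  rewrite -[X in _ --> X]E0.
  apply: cvgN; apply: cvgB; last by apply: (@at_left_cont _ (fun r => sin r ^+ n * (f t (cos r) * p^`().[cos r]))); Ctn.
  by apply: cvgM; [apply: (@at_left_cont _ (fun r => sin r ^+ n.-1 * p.[cos r])); Ctn|exact: (rk_fluxpi fP)].
Qed.

Lemma mom_derive n f t p : (0 < n)%N -> radial_kernel n f -> 0 < t ->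
  is_derive t 1 (fun s => mom n f s (horner p)) (mom n f t (horner (lapl n p))).
Proof.
move=> n0 fP t0; rewrite -mom_lapl// /mom.
apply: (@is_derive_Int _ (fun s r => f s (cos r) * p.[cos r] * sin r ^+ n.-1)
  (fun s r => dt f s (cos r) * p.[cos r] * sin r ^+ n.-1)); first exact: pi_ge0.
- near=> s; move=> r _; have s0 : 0 < s by near: s; exact: near_gt.
  have d1 := rk_dt fP (cos r) s0.
  by apply: der_eq; [der; exact: d1|rewrite /=; ring].
- move=> r _; have c1 := @rk_dt_cont _ _ _ fP t (cos r) t0.
  have c2 : {for (t, r), continuous (fun q : R * R => dt f q.1 (cos q.2))}.
    by apply: (@ctn_comp2 _ _ _ _ (dt f) fst (fun q : R * R => cos q.2)); [exact: c1|ctn|ctn].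
  by ctn.
- near=> s; have s0 : 0 < s by near: s; exact: near_gt.
  by have cf := rk_contr fP s0; Ctn.
- by have cdt := rk_dt_contr fP t0; Ctn.
Unshelve. all: by end_near. Qed.

Lemma derive0_cst (h : R -> R) : (forall t : R, 0 < t -> is_derive t 1 h 0) ->
  forall t s : R, 0 < t -> 0 < s -> h t = h s.
Proof.
move=> dh; suff H (t s : R) : 0 < t -> t <= s -> h t = h s.
  move=> t s t0 s0; have [/H->//|/ltW/H<-//] := leP t s.
move=> t0 ts; have [|| c _] := @MVT_segment R h (fun=> 0) t s ts.
- by move=> x; rewrite in_itv/= => /andP[tx _]; apply: dh; exact: lt_trans tx.
- apply: derivable_within_continuous => x; rewrite in_itv/= => /andP[tx _].
  by apply: ex_derive; apply: dh; exact: lt_le_trans tx.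
by rewrite mul0r => /eqP; rewrite subr_eq0 => /eqP.
Qed.

(** The moment solves y' = - l y, so exp(l s) times it is constant in s > 0; the constant is its
    limit at 0, given by [rk_init]. *)
Lemma mom_eigen n f t p (l : R) : (0 < n)%N -> radial_kernel n f -> 0 < t ->
  lapl n p = - l *: p ->
  mom n f t (horner p) = expR (- l * t) * (p.[1] / sphere_vol n.-1).
Proof.
move=> n0 fP t0 lp.
pose h s := expR (l * s) * mom n f s (horner p).
have dh (s : R) : 0 < s -> is_derive s 1 h 0.
  move=> s0; have d1 := mom_derive p n0 fP s0.
  rewrite /h; apply: der_eq; first by der; exact: d1.
  rewrite /= lp; have -> : mom n f s (horner (- l *: p)) = - l * mom n f s (horner p).
    have cf := rk_contr fP s0.
    by have := @mom_sum n f s nat [:: 0%N] (fun=> - l) (fun=> p) cf; rewrite !big_seq1.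
  ring.
have cst := derive0_cst dh.
have lim0 : h s @[s --> 0^'+] --> p.[1] / sphere_vol n.-1.
  have := rk_init fP (@continuous_horner _ p) => H0.
  rewrite -[X in _ --> X]mul1r; apply: cvgM; last exact: H0.
  have e0 : expR (l * 0) = 1 by rewrite mulr0 expR0.
  rewrite -[X in _ --> X]e0.
  by apply: (@at_right_cont _ (fun x => expR (l * x))); Ctn.
have ht := near_cvg_cst (fun s s0 => cst s t s0 t0) lim0.
by rewrite -ht /h mulrA -expRD mulNr addNr expR0 mul1r.
Qed.

(** By [mom_eigen] the moment of p is the heat flow of p evaluated at the pole, up to the positive
    volume factor, so [heat_poly_ge0] applies. *)
Lemma mom_ge0 n f t p : (0 < n)%N -> radial_kernel n f -> 0 < t ->
  (forall x, - 1 <= x <= 1 -> 0 <= p.[x]) -> 0 <= mom n f t (horner p).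
Proof.
move=> n0 fP t0 p0.
have [P HP] := @exists_eigenbasis R n n0.
have [|a pE] := @monic_basis R P (size p) p _ (leqnn _).
  by move=> i _; have [] := HP i.
have := heat_poly_ge0 (a := a) (N := size p) n0 HP (ltW t0).
rewrite -pE => /(_ p0) H.
rewrite pE mom_sum; last exact: (rk_contr fP t0).
under eq_bigr => i _.
  have [_ _ LP] := HP i; rewrite (mom_eigen n0 fP t0 LP) !mulrA.
  over.
by rewrite -mulr_suml mulr_ge0// invr_ge0 ltW// sphere_vol_gt0.
Qed.

(** Test the kernel against its own negative part h: since f h = - h^2, a nonnegative moment forces
    h = 0. *)
Lemma rk_ge0 n f t x : (0 < n)%N -> radial_kernel n f -> 0 < t -> - 1 <= x <= 1 ->
  0 <= f t x.
Proof.
move=> n0 fP t0; have cf := rk_contr fP t0.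
pose h x := Num.max (- f t x) 0.
have ch : continuous h by rewrite /h; Ctn.
have h0 y : 0 <= h y by rewrite le_max lexx orbT.
have fh y : f t y * h y = - h y ^+ 2.
  rewrite /h; case: (leP (- f t y) 0) => _; first by rewrite mulr0 expr0n oppr0.
  ring.
have momh : 0 <= mom n f t h.
  apply/ler_addgt0Pl => e e0.
  have [M M0 HM] := continuous_bounded (- 1) 1 cf.
  (* A polynomial within e / C of h becomes nonnegative once e / C is added, and [mom_ge0] applies
     to it; the resulting error in the moment is at most 2 M pi e / C <= e. *)
  pose C := 2 * M * pi + 1.
  have C0 : 0 < C by rewrite ltr_wpDl// !mulr_ge0// pi_ge0.
  have [p Hp] := weierstrass ch (divr_gt0 e0 C0).
  have pe0 y : - 1 <= y <= 1 -> 0 <= (p + (e / C)%:P).[y].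
    by move=> /Hp; rewrite ler_norml hornerD hornerC => /andP[? ?]; have := h0 y; lra.
  apply: le_trans (mom_ge0 n0 fP t0 pe0) _.
  rewrite -lerBlDr -IntB; [|by Ctn..].
  apply: le_trans (ler_norm _) _.
  apply: (@le_trans _ _ (M * (2 * (e / C)) * (pi - 0))); last first.
    rewrite subr0; have -> : M * (2 * (e / C)) * pi = (2 * M * pi) * e / C by ring.
    rewrite ler_pdivrMr// [leRHS]mulrC ler_wpM2r ?(ltW e0)//.
    by rewrite /C lerDl.
  apply: normr_Int_le; [exact: pi_ge0|by Ctn|move=> r rpi].
  have c1 : - 1 <= cos r <= 1 by rewrite cos_geN1 cos_le1.
  rewrite -mulrBl -mulrBr normrM -[leRHS]mulr1 ler_pM//; last first.
    by rewrite normrX exprn_ile1// sin_max.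
  rewrite normrM ler_pM ?HM//.
  have := Hp _ c1; rewrite !ler_norml hornerD hornerC => /andP[? ?]; lra.
have I0 : Int 0 pi (fun r => h (cos r) ^+ 2 * sin r ^+ n.-1) = 0.
  apply/eqP; rewrite eq_le; apply/andP; split; last first.
    by apply: Int_ge0 => r rpi; rewrite mulr_ge0 ?sqr_ge0 ?exprn_ge0 ?sin_ge0_pi.
  rewrite -oppr_ge0 -mulN1r -IntZl; last by Ctn.
  apply: le_trans momh _; rewrite le_eqVlt; apply/orP; left; apply/eqP.
  by apply: eq_Int => r _; rewrite fh; ring.
apply: closure_ge0; [lra|exact: cf|move=> y y1].
have ypi : 0 < acosc y < pi.
  have := acosc_itv y => /andP[]; rewrite le_eqVlt => /predU1P[a0|->].
    have := @cos_acosc _ y; rewrite -a0 cos0; lra.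
  rewrite le_eqVlt => /predU1P[a0|->//].
  have := @cos_acosc _ y; rewrite a0 cospi; lra.
have ypi' : 0 <= acosc y <= pi by exact: acosc_itv.
have := @Int_eq0 _ 0 pi _ (pi_gt0 R) _ _ I0 _ ypi'; rewrite cos_acosc; last lra.
have : 0 < sin (acosc y) ^+ n.-1 by rewrite exprn_gt0// sin_gt0_pi.
move=> s0 /(_ _ _)/eqP; rewrite mulf_eq0 sqrf_eq0 (gt_eqF s0) orbF => H.
have : h y = 0.
  apply/eqP/H; first by Ctn.
  by move=> r rpi; rewrite mulr_ge0 ?sqr_ge0 ?exprn_ge0 ?sin_ge0_pi.
move=> hy; have : - f t y <= h y by rewrite le_max lexx.
by rewrite hy oppr_le0.
Qed.

End moments.

(** * From dimension n to dimension n + 2; monotonicity and decay *)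

Section ladder.
Context {R : realType}.
Implicit Types (f g : R -> R -> R) (p : {poly R}) (n : nat) (t : R).

Lemma Int_sin_rec k : Int 0 pi (fun r : R => sin r ^+ k.+2) =
  k.+1%:R / k.+2%:R * Int 0 pi (fun r : R => sin r ^+ k).
Proof.
have pi0 := pi_ge0 R.
have k20 : k.+2%:R != 0 :> R by rewrite pnatr_eq0.
have H : Int 0 pi (fun r : R => k.+1%:R * sin r ^+ k - k.+2%:R * sin r ^+ k.+2) = 0.
  transitivity (sin pi ^+ k.+1 * cos pi - sin 0 ^+ k.+1 * cos 0 : R); last first.
    by rewrite sin0 sinpi !exprS !mul0r subrr.
  apply: (@FTCT _ 0 pi _ (fun r : R => sin r ^+ k.+1 * cos r)) => //; first by Ctn.
  move=> x; apply: der_eq; first by der.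
  rewrite [k.+1.-1]/=.
  have -> : cos x * (k.+1%:R * sin x ^+ k * cos x) = k.+1%:R * sin x ^+ k * cos x ^+ 2 by ring.
  by rewrite cos2sin2 -(natr1 k.+1) /= !exprS; ring.
rewrite IntB in H; [|by Ctn..].
rewrite !IntZl in H; [|by Ctn..].
apply: (mulfI k20); rewrite mulrA mulrCA mulfV// mulr1.
by apply/eqP; rewrite eq_sym -subr_eq0 H.
Qed.

Lemma Int_sin01 : Int 0 pi (fun r : R => sin r ^+ 0) = pi /\ Int 0 pi (fun r : R => sin r ^+ 1) = 2.
Proof.
split.
  under eq_Int do rewrite expr0.
  by rewrite Int_cst ?pi_ge0// mul1r subr0.
have -> : (2 : R) = - cos pi - (- cos 0) by rewrite cospi cos0; ring.
apply: (@FTCT _ 0 pi _ (fun r : R => - cos r)); [exact: pi_ge0|by Ctn|].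
by move=> x; apply: der_eq; [der|rewrite /=; ring].
Qed.

Lemma Int_sin_mul k : Int 0 pi (fun r : R => sin r ^+ k) * Int 0 pi (fun r : R => sin r ^+ k.+1) =
  2 * pi / k.+1%:R.
Proof.
have [i0 i1] := Int_sin01.
elim: k => [|k IH]; first by rewrite i0 i1 divr1 mulrC.
rewrite Int_sin_rec mulrCA [X in _ * X]mulrC IH.
have k1 : k.+1%:R != 0 :> R by rewrite pnatr_eq0.
have k2 : k.+2%:R != 0 :> R by rewrite pnatr_eq0.
move: k1 k2; move: (k.+1%:R) (k.+2%:R) (pi : R) => a b c a0 b0.
by field; rewrite a0 b0.
Qed.

(** Source of the 2 pi in the recursion for the kernels: two steps in dimension bring in the product
    of two consecutive Wallis integrals, which is elementary. *)
Lemma sphere_vol_rec k : sphere_vol k.+2 = 2 * pi / k.+1%:R * sphere_vol k :> R.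
Proof. by rewrite -Int_sin_mul /=; ring. Qed.

(* Formal adjoint of [f |-> d f / dx] from the weight of [S^(n+2)] to that of [S^n]. *)
Definition lower n p : {poly R} := n%:R *: ('X * p) - (1 - 'X^2) * p^`().

Lemma lowerE n p x : (lower n p).[x] = n%:R * (x * p.[x]) - (1 - x ^+ 2) * p^`().[x].
Proof. by rewrite /lower !hornerE. Qed.

(** Dual to d/dx L_n = (L_(n+2) - n) d/dx. The shift of the eigenvalue by n is the source of the
    factor exp(n t). *)
Lemma lapl_lower n p (l : R) : lapl n.+2 p = - l *: p ->
  lapl n (lower n p) = - (l + n%:R) *: lower n p.
Proof.
move=> H; have lowerZ : lower n (- l *: p) = - l *: lower n p.
  by rewrite /lower derivZ -!scalerAr scalerBr !scalerA (mulrC n%:R).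
suff E : lapl n (lower n p) = lower n (lapl n.+2 p) - n%:R *: lower n p.
  by rewrite E H lowerZ -scalerBl opprD.
rewrite /lapl /lower -(natr1 n.+1) -(natr1 n).
have dX2 : (1 - 'X^2 : {poly R})^`() = - (2%:P * 'X).
  by rewrite derivB derivC sub0r derivXn expr1 mul_polyC scaler_nat.
rewrite -!mul_polyC !(derivB, derivM, derivC, derivX, dX2, derivN, derivD).
rewrite !polyCD; move: (n%:R%:P) => N; move: p^`()^`()^`() p^`()^`() p^`() => p3 p2 p1.
rewrite !polyC1; ring.
Qed.

(** On eigenpolynomials of dimension n + 2 both moments are explicit. The constants agree because
    [lower n p] takes the value n p(1) at 1 and the volumes of S^(n+1) and S^(n-1) have ratio 2 pi /
    n. *)
Lemma mom_lower n f g t p : (0 < n)%N -> radial_kernel n f -> radial_kernel n.+2 g ->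
  0 < t ->
  expR (n%:R * t) / (2 * pi) * mom n f t (horner (lower n p)) = mom n.+2 g t (horner p).
Proof.
move=> n0 fP gP t0.
have [P HP] := @exists_eigenbasis R n.+2 isT.
have [|a pE] := @monic_basis R P (size p) p _ (leqnn _).
  by move=> i _; have [] := HP i.
have cf := rk_contr fP t0; have cg := rk_contr gP t0.
rewrite {2}pE mom_sum//.
have -> : lower n p = \sum_(i < size p) a i *: lower n (P i).
  rewrite {1}pE /lower mulr_sumr scaler_sumr raddf_sum/= mulr_sumr -sumrB.
  by apply: eq_bigr => i _; rewrite derivZ scalerBr -!scalerAr !scalerA (mulrC n%:R).
rewrite mom_sum// mulr_sumr; apply: eq_bigr => i _.
have [_ _ LP] := HP i.
rewrite (mom_eigen _ gP t0 LP)// (mom_eigen n0 fP t0 (lapl_lower LP)).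
have -> : - (ev n.+2 i + n%:R) * t = - ev n.+2 i * t + - (n%:R * t) by ring.
rewrite expRD expRN.
case: n n0 {fP gP HP LP} => // n _.
rewrite [n.+3.-1]/= sphere_vol_rec [n.+1.-1]/=.
have -> : (lower n.+1 (P i)).[1] = n.+1%:R * (P i).[1].
  by rewrite lowerE expr1n subrr mul0r subr0 mul1r.
have p0 : (pi : R) != 0 by rewrite gt_eqF ?pi_gt0.
have v0 : sphere_vol n != 0 :> R by rewrite gt_eqF ?sphere_vol_gt0.
have m0 : n.+1%:R != 0 :> R by rewrite pnatr_eq0.
move: (pi : R) p0 (sphere_vol n : R) v0 (n.+1%:R : R) m0 => B B0 C C0 D D0.
have A0 : expR (D * t) != 0 by rewrite gt_eqF ?expR_gt0.
by field; rewrite A0 B0 C0 D0.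
Qed.

(** Integrate [mom_lower] by parts: the difference of the two sides, weighted by sin^(n+1), has all
    its polynomial moments equal to 0. *)
Lemma ladder n f g t x : (0 < n)%N -> radial_kernel n f -> radial_kernel n.+2 g ->
  0 < t -> - 1 < x < 1 -> dx f t x = 2 * pi * expR (- (n%:R * t)) * g t x.
Proof.
move=> n0 fP gP t0 x1.
have cf := rk_contr fP t0; have cg := rk_contr gP t0.
pose K := expR (n%:R * t) / (2 * pi).
pose v r := K * (sin r * dx f t (cos r)) - sin r * g t (cos r).
(* No limit of [dx f] at the poles is available yet, but [sin r * dx f t (cos r)] tends to 0, so
   extension by 0 is continuous on [0, pi]. *)
pose u r := if (0 < r) && (r < pi) then sin r ^+ n * v r else 0.
have uE r : 0 < r < pi -> u r = sin r ^+ n * v r by rewrite /u => ->.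
have u0 : u 0 = 0 by rewrite /u ltxx.
have upi : u pi = 0 by rewrite /u ltxx andbF.
have cw : {within `[0, pi], continuous u}.
  apply/(continuous_within_itvP _ (pi_gt0 R)); split.
  - move=> r; rewrite in_itv/= => r0.
    have d1 := rk_dxx fP t0 (cos_oo r0).
    have c1 : {for cos r, continuous (dx f t)} by exact: is_derive_continuous d1.
    have c2 : {for r, continuous (fun r => dx f t (cos r))}.
      by apply: (ctn_comp c1); exact: continuous_cos.
    have c3 : {for r, continuous (fun r => sin r ^+ n * v r)} by rewrite /v; ctn.
    rewrite /continuous_at uE//; apply: cvg_trans c3; apply: near_eq_cvg.
    near=> y; rewrite uE//; apply/andP; split; near: y; case/andP: r0 => *.
      exact: near_gt.
    exact: near_lt.
  - rewrite u0.
    have E0 : sin 0 ^+ n * (K * 0 - sin 0 * g t (cos 0)) = 0 by rewrite sin0 mulr0 mul0r subrr mulr0.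
    rewrite -[X in _ --> X]E0.
    have : sin r ^+ n * v r @[r --> 0^'+] --> sin 0 ^+ n * (K * 0 - sin 0 * g t (cos 0)).
      apply: cvgM; first by apply: (@at_right_cont _ (fun r => sin r ^+ n)); Ctn.
      apply: cvgB; last by apply: (@at_right_cont _ (fun r => sin r * g t (cos r))); Ctn.
      by apply: cvgM; [exact: cvg_cst|exact: (rk_flux0 fP)].
    apply: cvg_trans; apply: near_eq_cvg; near=> y; rewrite uE//.
    apply/andP; split; near: y; [exact: nbhs_right_gt|exact: nbhs_right_lt (pi_gt0 R)].
  - rewrite upi.
    have E0 : sin pi ^+ n * (K * 0 - sin pi * g t (cos pi)) = 0.
      by rewrite sinpi mulr0 mul0r subrr mulr0.
    rewrite -[X in _ --> X]E0.
    have : sin r ^+ n * v r @[r --> pi^'-] --> sin pi ^+ n * (K * 0 - sin pi * g t (cos pi)).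
      apply: cvgM; first by apply: (@at_left_cont _ (fun r => sin r ^+ n)); Ctn.
      apply: cvgB; last by apply: (@at_left_cont _ (fun r => sin r * g t (cos r))); Ctn.
      by apply: cvgM; [exact: cvg_cst|exact: (rk_fluxpi fP)].
    apply: cvg_trans; apply: near_eq_cvg; near=> y; rewrite uE//.
    apply/andP; split; near: y; [exact: nbhs_left_gt (pi_gt0 R)|exact: nbhs_left_lt].
have cu := continuous_clamp_comp (pi_ge0 R) cw.
have um p : Int 0 pi (fun r => u (clamp 0 pi r) * p.[cos r]) = 0.
  (* On (0, pi) this is the derivative of - K f p sin^n, which vanishes at both ends. *)
  pose w r := u (clamp 0 pi r) * p.[cos r] + g t (cos r) * p.[cos r] * sin r ^+ n.+1 -
     K * (f t (cos r) * (lower n p).[cos r] * sin r ^+ n.-1).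
  have w0 : Int 0 pi w = 0.
    transitivity (- (K * (f t (cos pi) * p.[cos pi] * sin pi ^+ n)) -
       - (K * (f t (cos 0) * p.[cos 0] * sin 0 ^+ n))); last first.
      by rewrite sin0 sinpi expr0n; case: (n) n0 => // k _; rewrite !mulr0 subrr.
    apply: (@FTC_open _ 0 pi _ _ w (fun r => - (K * (f t (cos r) * p.[cos r] * sin r ^+ n)))
      (pi_gt0 R)).
    - by rewrite /w; Ctn.
    - move=> r r0; have d1 := rk_dx fP t0 (cos_oo r0).
      have d1' := @der_comp _ cos (f t) r _ _ d1 (is_derive_cos r).
      apply: der_eq; first by der; exact: d1'.
      rewrite /w clamp_id ?(ltW (andP r0).1) ?(ltW (andP r0).2)// uE// /v lowerE.
      have -> : 1 - cos r ^+ 2 = sin r ^+ 2 by rewrite cos2sin2; ring.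
      move: n0; case: (n) => // k _; rewrite [k.+1.-1]/= /= !exprS.
      ring.
    - by apply: (@at_right_cont _ (fun r => - (K * (f t (cos r) * p.[cos r] * sin r ^+ n)))); Ctn.
    - by apply: (@at_left_cont _ (fun r => - (K * (f t (cos r) * p.[cos r] * sin r ^+ n)))); Ctn.
  move: w0; rewrite /w IntB; [|by Ctn..].
  rewrite IntD; [|by Ctn..].
  rewrite IntZl; last by Ctn.
  have := mom_lower p n0 fP gP t0; rewrite /mom -/K => ->.
  by rewrite [n.+2.-1]/= addrK.
pose r := acos x.
have r0 : 0 < r < pi by rewrite /r acos_gt0 ?acos_ltpi//; lra.
have cr : cos r = x by rewrite /r acosK// in_itv/=; lra.
have rpi : 0 <= r <= pi by case/andP: r0 => *; rewrite !ltW.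
have := eq0_moments cu um rpi; rewrite clamp_id// uE// /v cr => /eqP.
have sr : sin r != 0 by rewrite gt_eqF// sin_gt0_pi.
rewrite mulf_eq0 expf_eq0 (negbTE sr) andbF/= mulrCA -mulrBr mulf_eq0 (negbTE sr)/=.
rewrite subr_eq0 => /eqP <-; rewrite /K expRN.
have p0 : (pi : R) != 0 by rewrite gt_eqF ?pi_gt0.
have e0 : expR (n%:R * t) != 0 by rewrite gt_eqF ?expR_gt0.
move: (expR (n%:R * t)) e0 (pi : R) p0 => A A0 B B0.
by field; rewrite A0 B0.
Unshelve. all: by end_near. Qed.

(** By [ladder] the derivative in x is a positive multiple of the nonnegative kernel of dimension n
    + 2. *)
Lemma rk_nondecreasing n f g t x y : (0 < n)%N -> radial_kernel n f ->
  radial_kernel n.+2 g -> 0 < t -> - 1 <= x -> x <= y -> y <= 1 -> f t x <= f t y.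
Proof.
move=> n0 fP gP t0 x1; rewrite le_eqVlt => /predU1P[->//|xy] y1.
have cf := rk_contr fP t0.
have [|c] := MVT xy _ (continuous_subspaceT cf) (df := dx f t).
  by move=> z; rewrite in_itv/= => /andP[xz zy]; apply: (rk_dx fP t0); lra.
rewrite in_itv/= => /andP[xc cy] E; rewrite -subr_ge0 E.
have c1 : - 1 < c < 1 by lra.
rewrite (ladder n0 fP gP t0 c1) mulr_ge0 ?subr_ge0 ?(ltW xy)//.
by rewrite !mulr_ge0 ?pi_ge0 ?expR_ge0// (rk_ge0 _ gP)//; lra.
Qed.

(** By monotonicity f t x is at most f t (cos r) for r <= acos x. Weighting by [w], which vanishes
    at the pole, bounds it by a multiple of the moment of 1 - x, which tends to 0. *)
Lemma rk_decay n f g x : (0 < n)%N -> radial_kernel n f -> radial_kernel n.+2 g ->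
  - 1 <= x < 1 -> f t x @[t --> 0^'+] --> 0.
Proof.
move=> n0 fP gP /andP[x1 x2].
pose r0 := acos x.
have r00 : 0 < r0 by rewrite /r0 acos_gt0// x1.
have r0pi : r0 <= pi by rewrite /r0 acos_lepi//; lra.
have cr0 : cos r0 = x by rewrite /r0 acosK// in_itv/=; lra.
pose w r : R := (1 - cos r) * sin r ^+ n.-1.
have cw : continuous w by rewrite /w; Ctn.
have w0 r : 0 <= r <= pi -> 0 <= w r.
  by move=> rpi; rewrite mulr_ge0 ?subr_ge0 ?cos_le1 ?exprn_ge0 ?sin_ge0_pi.
have c0 : 0 < Int 0 r0 w.
  rewrite lt_def Int_ge0 ?andbT; last by move=> r ?; apply: w0; lra.
  apply/eqP => I0; have h : 0 <= r0 / 2 <= r0 by lra.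
  have := Int_eq0 r00 cw _ I0 h => /(_ _)/eqP; rewrite /w.
  have h2 : 0 < r0 / 2 < pi by lra.
  have [_ c2] := andP (cos_oo h2).
  rewrite mulf_eq0 subr_eq0 (gt_eqF c2) expf_eq0 (gt_eqF (sin_gt0_pi h2)) andbF.
  by move=> H; apply: notF; apply: H => r rr; apply: w0; lra.
have cq : continuous (fun x : R => 1 - x) by Ctn.
have := rk_init fP cq; rewrite subrr mul0r => H.
have H0 : mom n f t (fun x => 1 - x) / Int 0 r0 w @[t --> 0^'+] --> (0 : R).
  by rewrite -[X in _ --> X](mul0r (Int 0 r0 w)^-1); apply: cvgM; [exact: H|exact: cvg_cst].
apply: (squeeze_cvgr _ (cvg_cst 0) H0); near=> t.
have t0 : 0 < t by near: t; exact: nbhs_right_gt.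
have cf := rk_contr fP t0.
have f0 y : - 1 <= y <= 1 -> 0 <= f t y by exact: (rk_ge0 n0 fP t0).
rewrite f0/=; last lra.
rewrite ler_pdivlMr// -IntZl//.
apply: (@le_trans _ _ (Int 0 r0 (fun r => f t (cos r) * (1 - cos r) * sin r ^+ n.-1))).
  apply: le_Int; [by Ctn..|move=> r /andP[r1 r2]].
  rewrite -mulrA ler_wpM2r ?w0//; first lra.
  apply: (rk_nondecreasing n0 fP gP t0 x1); last exact: cos_le1.
  rewrite -cr0; move: r2; rewrite le_eqVlt => /predU1P[->//|rr0].
  by rewrite ltW// ltr_cos ?in_itv/= ?r1 ?(ltW r00)//= (le_trans (ltW rr0)).
rewrite /mom (@IntS _ 0 r0 pi) ?(ltW r00)//; last by Ctn.
rewrite lerDl; apply: Int_ge0 => r rr; have rpi : 0 <= r <= pi by lra.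
rewrite -mulrA mulr_ge0 ?w0// f0// cos_geN1 cos_le1//.
Unshelve. all: by end_near. Qed.

End ladder.

(** * Zonal convolution *)

Section funk_hecke.
Context {R : realType}.
Variable m : nat.
Local Notation n := m.+2.
Implicit Types (Q q : R -> R) (P : nat -> {poly R}) (r rho phi theta : R).

(* The cosine of the distance between the points of polar angles [phi] and [rho]
   on the sphere whose meridians make the angle [theta]. *)
Definition zc phi rho theta : R := cos phi * cos rho + sin phi * sin rho * cos theta.

(** Unnormalised mean over a geodesic sphere. With it, [sphere_vol m] times [zconv] is the
    convolution of zonal functions on S^(m+2), the remaining S^m having been integrated out. *)
Definition zavg Q phi rho : R := Int 0 pi (fun theta => Q (zc phi rho theta) * sin theta ^+ m).

Definition zconv Q q rho : R :=
  Int 0 pi (fun phi => q (cos phi) * zavg Q phi rho * sin phi ^+ m.+1).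

Lemma zcC phi rho theta : zc phi rho theta = zc rho phi theta.
Proof. by rewrite /zc; ring. Qed.

Lemma zavgC Q phi rho : zavg Q phi rho = zavg Q rho phi.
Proof. by apply: eq_Int => theta _; rewrite zcC. Qed.

Lemma zc_itv phi rho theta : - 1 <= zc phi rho theta <= 1.
Proof.
rewrite -ler_norml -(@ler_pXn2r _ 2)// ?nnegrE// real_normK ?num_real// expr1n.
have := cos2Dsin2 phi; have := cos2Dsin2 rho; have := cos2Dsin2 theta.
rewrite /zc; move: (cos phi) (sin phi) (cos rho) (sin rho) (cos theta) (sin theta).
move=> a b c d e g H1 H2 H3.
have -> : (a * c + b * d * e) ^+ 2 =
   (a ^+ 2 + b ^+ 2) * (c ^+ 2 + d ^+ 2) - (a * d * e - b * c) ^+ 2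
   - (a * d) ^+ 2 * (1 - e ^+ 2) - (b * d) ^+ 2 * (1 - e ^+ 2) by ring.
have -> : 1 - e ^+ 2 = g ^+ 2 by rewrite -H1; ring.
rewrite H2 H3 mulr1 -!exprMn.
have := sqr_ge0 (a * d * e - b * c); have := sqr_ge0 (a * d * g); have := sqr_ge0 (b * d * g).
lra.
Qed.

Lemma ctn_zavg (T : topologicalType) (Q : T -> R -> R) (a b : T -> R) (x0 : T) :
  (forall y, {for (x0, y), continuous (fun p : T * R => Q p.1 p.2)}) ->
  (\forall x \near x0, continuous (Q x)) ->
  {for x0, continuous a} -> {for x0, continuous b} ->
  {for x0, continuous (fun x => zavg (Q x) (a x) (b x))}.
Proof.
move=> cQ cQx ca cb; apply: (@continuous_Int _ _ (fun x theta => Q x (zc (a x) (b x) theta) * sin theta ^+ m)).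
- exact: pi_ge0.
- move=> y _.
  have ca1 : {for (x0, y), continuous (fun p : T * R => a p.1)} by apply: (ctn_comp ca); ctn.
  have cb1 : {for (x0, y), continuous (fun p : T * R => b p.1)} by apply: (ctn_comp cb); ctn.
  have cz : {for (x0, y), continuous (fun p : T * R => zc (a p.1) (b p.1) p.2)} by rewrite /zc; ctn.
  have cc : {for (x0, y), continuous (fun p : T * R => Q p.1 (zc (a p.1) (b p.1) p.2))}.
    apply: (@ctn_comp (T * R)%type (T * R)%type R (fun p : T * R => Q p.1 p.2) (fun p : T * R => (p.1, zc (a p.1) (b p.1) p.2)) (x0, y) (cQ _)).
    have c1 := @ctn_fst _ _ (x0, y); exact: (cvg_pair c1 cz).
  by ctn.
- near=> x; have cQ' : continuous (Q x) by near: x.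
  by rewrite /zc; Ctn.
Unshelve. all: by end_near. Qed.

Lemma continuous_zavg Q rho : continuous Q -> continuous (zavg Q ^~ rho).
Proof.
move=> cQ x; apply: (@ctn_zavg _ (fun=> Q) (fun y => y) (fun=> rho)) => //.
- by move=> y; apply: (ctn_comp (cQ _)); ctn.
- by near=> y.
- by ctn.
Unshelve. all: by end_near. Qed.

Lemma zavg0 Q rho : continuous Q -> zavg Q 0 rho = Q (cos rho) * Int 0 pi (fun r => sin r ^+ m).
Proof.
move=> cQ; rewrite /zavg -IntZl; last by Ctn.
by apply: eq_Int => theta _; rewrite /zc cos0 sin0 !mul0r addr0 mul1r.
Qed.

Lemma zavg_ge0 Q phi rho : (forall x, - 1 <= x <= 1 -> 0 <= Q x) -> 0 <= zavg Q phi rho.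
Proof.
move=> Q0; apply: Int_ge0 => theta th.
by rewrite mulr_ge0 ?Q0 ?zc_itv// exprn_ge0// sin_ge0_pi.
Qed.

(* Integrate by parts in the coordinates [(phi, theta)] of the sphere. *)
Lemma zconv_lapl (Q q : {poly R}) rho :
  zconv (horner (lapl n Q)) (horner q) rho = zconv (horner Q) (horner (lapl n q)) rho.
Proof.
pose z phi theta := zc phi rho theta.
pose zp phi theta := - sin phi * cos rho + cos phi * sin rho * cos theta.
(* [a] and [b] are the phi and theta components of the field q grad Q - Q grad q times the volume
   density, and [D] is their divergence. [a] vanishes at phi = 0, pi and [b] at theta = 0, pi. *)
pose a phi theta := sin theta ^+ m * (sin phi ^+ m.+1 *
  (q.[cos phi] * (Q^`().[z phi theta] * zp phi theta) + Q.[z phi theta] * (sin phi * q^`().[cos phi]))).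
pose b phi theta := - (q.[cos phi] * sin phi ^+ m * sin rho) *
  (sin theta ^+ m.+1 * Q^`().[z phi theta]).
pose D phi theta := sin phi ^+ m.+1 * sin theta ^+ m *
  (q.[cos phi] * (lapl n Q).[z phi theta] - (lapl n q).[cos phi] * Q.[z phi theta]).
pose db phi theta := - (q.[cos phi] * sin phi ^+ m * sin rho) *
  (sin theta ^+ m * (m.+1%:R * cos theta * Q^`().[z phi theta] -
     sin theta ^+ 2 * sin phi * sin rho * Q^`()^`().[z phi theta])).
pose da phi theta := D phi theta - db phi theta.
have dz1 phi theta : has_der (z ^~ theta) phi (zp phi theta).
  by rewrite /z /zc /zp; apply: der_eq; [der|rewrite /=; ring].
have dz2 phi theta : has_der (z phi) theta (- (sin phi * sin rho * sin theta)).
  by rewrite /z /zc; apply: der_eq; [der|rewrite /=; ring].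
have dzp phi theta : has_der (zp ^~ theta) phi (- z phi theta).
  by rewrite /zp; apply: der_eq; [der|rewrite /z /zc /=; ring].
have dQ (p : {poly R}) phi theta : has_der (fun x => p.[z x theta]) phi (p^`().[z phi theta] * zp phi theta).
  exact: (@der_comp _ (z ^~ theta) (horner p) _ _ _ (is_derive_poly p _) (dz1 _ _)).
have dQ2 (p : {poly R}) phi theta : has_der (fun x => p.[z phi x]) theta
    (p^`().[z phi theta] * - (sin phi * sin rho * sin theta)).
  exact: (@der_comp _ (z phi) (horner p) _ _ _ (is_derive_poly p _) (dz2 _ _)).
have dq (p : {poly R}) phi : has_der (fun x => p.[cos x]) phi (p^`().[cos phi] * - sin phi).
  exact: (@der_comp _ cos (horner p) _ _ _ (is_derive_poly p _) (is_derive_cos _)).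
have dB phi theta : is_derive theta 1 (b phi) (db phi theta).
  have d1 := dQ2 Q^`() phi theta.
  rewrite /b /db; apply: der_eq; first by der.
  by rewrite /= !exprS; ring.
have dA phi theta : is_derive phi 1 (a ^~ theta) (da phi theta).
  have d1 := dQ Q phi theta; have d2 := dQ Q^`() phi theta.
  have d3 := dq q phi; have d4 := dq q^`() phi; have d5 := dzp phi theta.
  rewrite /a; apply: der_eq; first by der.
  (* [k1] says that the gradient of the cosine of the distance has squared norm 1 - z^2; [k2]
     provides the first-order part of the Laplacian of z. *)
  have k1 : zp phi theta ^+ 2 + (sin rho * sin theta) ^+ 2 = 1 - z phi theta ^+ 2.
    have := sin2cos2 theta; have := sin2cos2 rho; have := sin2cos2 phi.
    rewrite /zp /z /zc exprMn => H1 H2 H3; rewrite H2 H3.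
    have -> : 1 - (cos phi * cos rho + sin phi * sin rho * cos theta) ^+ 2 =
      1 - cos phi ^+ 2 * cos rho ^+ 2 - 2 * cos phi * cos rho * sin phi * sin rho * cos theta
       - sin phi ^+ 2 * sin rho ^+ 2 * cos theta ^+ 2 by ring.
    have -> : (- sin phi * cos rho + cos phi * sin rho * cos theta) ^+ 2 =
      sin phi ^+ 2 * cos rho ^+ 2 - 2 * cos phi * cos rho * sin phi * sin rho * cos theta
       + cos phi ^+ 2 * sin rho ^+ 2 * cos theta ^+ 2 by ring.
    by rewrite H1 H2; ring.
  have k2 : cos phi * zp phi theta - sin rho * cos theta = - (sin phi * z phi theta).
    have := sin2cos2 phi => H1; rewrite /zp /z /zc.
    have -> : - (sin phi * (cos phi * cos rho + sin phi * sin rho * cos theta)) =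
      - sin phi * cos phi * cos rho - sin phi ^+ 2 * (sin rho * cos theta) by ring.
    by rewrite H1; ring.
  have k3 := sin2cos2 phi.
  transitivity (sin phi ^+ m * sin theta ^+ m * (
     q.[cos phi] * Q^`()^`().[z phi theta] * sin phi * (zp phi theta ^+ 2 + (sin rho * sin theta) ^+ 2)
     + q.[cos phi] * Q^`().[z phi theta] * (m.+1%:R * (cos phi * zp phi theta - sin rho * cos theta)
        - sin phi * z phi theta)
     + sin phi * Q.[z phi theta] * ((m.+1%:R + 1) * cos phi * q^`().[cos phi] -
         sin phi ^+ 2 * q^`()^`().[cos phi])) - db phi theta).
    by rewrite /db /= !exprS; ring.
  rewrite k1 k2 k3 /da /D !laplE -(natr1 m.+1) !exprS; ring.
have cz : continuous (fun p : R * R => z p.1 p.2) by rewrite /z /zc; Ctn.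
have czl phi : continuous (z phi) by rewrite /z /zc; Ctn.
have czr theta : continuous (z ^~ theta) by rewrite /z /zc; Ctn.
have cdb : continuous (fun p : R * R => db p.1 p.2) by rewrite /db; Ctn.
have cD : continuous (fun p : R * R => D p.1 p.2) by rewrite /D; Ctn.
have cda : continuous (fun p : R * R => da p.1 p.2) by rewrite /da; Ctn.
have cdbl phi : continuous (db phi) by have c1 := czl phi; rewrite /db; Ctn.
have cDl phi : continuous (D phi) by have c1 := czl phi; rewrite /D; Ctn.
have cdal phi : continuous (da phi) by have c1 := cDl phi; have c2 := cdbl phi; rewrite /da; Ctn.
have cdar theta : continuous (da ^~ theta) by have c1 := czr theta; rewrite /da /D /db; Ctn.
have Ib phi : Int 0 pi (db phi) = 0.
  transitivity (b phi pi - b phi 0).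
    by apply: FTCT => //; exact: pi_ge0.
  by rewrite /b sin0 sinpi !exprS !mul0r !mulr0 subrr.
have Ia theta : Int 0 pi (da ^~ theta) = 0.
  transitivity (a pi theta - a 0 theta).
    by apply: FTCT => //; exact: pi_ge0.
  by rewrite /a sin0 sinpi !exprS !mul0r !mulr0 subrr.
have ID : Int 0 pi (fun phi => Int 0 pi (D phi)) = 0.
  transitivity (Int 0 pi (fun phi => Int 0 pi (da phi))).
    apply: eq_Int => phi _; transitivity (Int 0 pi (D phi) - Int 0 pi (db phi)); first by rewrite Ib subr0.
    by rewrite -IntB.
  rewrite Int_swap ?pi_ge0// -[RHS](Int0 0 pi).
  by apply: eq_Int => theta _; exact: Ia.
apply/eqP; rewrite -subr_eq0 -ID; apply/eqP.
have cA (p : {poly R}) := @continuous_zavg (horner p) rho (@continuous_horner _ p).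
have cA1 := cA Q; have cA2 := cA (lapl n Q).
rewrite /zconv -IntB; [|by Ctn..].
apply: eq_Int => phi _; rewrite /zavg -mulrBl.
have ch (p : {poly R}) : continuous (fun theta => p.[zc phi rho theta] * sin theta ^+ m).
  by have := czl phi; rewrite /z => ?; Ctn.
rewrite -!IntZl// -IntB; [|by move=> x; apply: cvgM; [exact: cvg_cst|exact: ch]..].
rewrite -IntZr; last by move=> x; apply: cvgB; (apply: cvgM; [exact: cvg_cst|exact: ch]).
by apply: eq_Int => theta _; rewrite /D -/(z phi theta); ring.
Qed.

Lemma Int_sin_gt0 k : 0 < Int 0 pi (fun r : R => sin r ^+ k).
Proof. by have := sphere_vol_gt0 (R := R) k.+1; rewrite /= pmulr_rgt0// sphere_vol_gt0. Qed.

Lemma ctn_zconv (Q q : R -> R) rho : continuous Q -> continuous q ->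
  continuous (fun phi => q (cos phi) * zavg Q phi rho * sin phi ^+ m.+1).
Proof. by move=> cQ cq; have c := @continuous_zavg Q rho cQ; Ctn. Qed.

Lemma zavgD (Q1 Q2 : R -> R) phi rho : continuous Q1 -> continuous Q2 ->
  zavg (fun x => Q1 x + Q2 x) phi rho = zavg Q1 phi rho + zavg Q2 phi rho.
Proof.
move=> c1 c2; rewrite /zavg -IntD; [|by rewrite /zc; Ctn..].
by apply: eq_Int => theta _; rewrite mulrDl.
Qed.

Lemma zavgZ a (Q : R -> R) phi rho : continuous Q ->
  zavg (fun x => a * Q x) phi rho = a * zavg Q phi rho.
Proof.
move=> c1; rewrite /zavg -IntZl; last by rewrite /zc; Ctn.
by apply: eq_Int => theta _; rewrite mulrA.
Qed.

Lemma zconvDl (Q1 Q2 q : R -> R) rho : continuous Q1 -> continuous Q2 -> continuous q ->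
  zconv (fun x => Q1 x + Q2 x) q rho = zconv Q1 q rho + zconv Q2 q rho.
Proof.
move=> c1 c2 cq; rewrite /zconv -IntD; [|exact: ctn_zconv..].
by apply: eq_Int => phi _; rewrite zavgD// mulrDr mulrDl.
Qed.

Lemma zconvZl a (Q q : R -> R) rho : continuous Q -> continuous q ->
  zconv (fun x => a * Q x) q rho = a * zconv Q q rho.
Proof.
move=> c1 cq; rewrite /zconv -IntZl; last exact: ctn_zconv.
by apply: eq_Int => phi _; rewrite zavgZ//; ring.
Qed.

Lemma zconvDr (Q q1 q2 : R -> R) rho : continuous Q -> continuous q1 -> continuous q2 ->
  zconv Q (fun x => q1 x + q2 x) rho = zconv Q q1 rho + zconv Q q2 rho.
Proof.
move=> c1 c2 cq; rewrite /zconv -IntD; [|exact: ctn_zconv..].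
by apply: eq_Int => phi _; rewrite mulrDl mulrDl.
Qed.

Lemma zconvZr a (Q q : R -> R) rho : continuous Q -> continuous q ->
  zconv Q (fun x => a * q x) rho = a * zconv Q q rho.
Proof.
move=> c1 cq; rewrite /zconv -IntZl; last exact: ctn_zconv.
by apply: eq_Int => phi _; ring.
Qed.

Lemma eq_zconv (Q1 Q2 q1 q2 : R -> R) rho :
  (forall x, - 1 <= x <= 1 -> Q1 x = Q2 x) -> (forall x, - 1 <= x <= 1 -> q1 x = q2 x) ->
  zconv Q1 q1 rho = zconv Q2 q2 rho.
Proof.
move=> h1 h2; apply: eq_Int => phi _; rewrite h2 ?cos_geN1 ?cos_le1//; congr (_ * _ * _).
by apply: eq_Int => theta _; rewrite h1// zc_itv.
Qed.

Lemma zconvZl_poly a (p : {poly R}) (q : R -> R) rho : continuous q ->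
  zconv (horner (a *: p)) q rho = a * zconv (horner p) q rho.
Proof.
move=> cq; rewrite -(zconvZl _ _ (@continuous_horner _ p) cq).
by apply: eq_zconv => // x _; rewrite hornerZ.
Qed.

Lemma zconvZr_poly a (p : {poly R}) (Q : R -> R) rho : continuous Q ->
  zconv Q (horner (a *: p)) rho = a * zconv Q (horner p) rho.
Proof.
move=> cq; rewrite -(zconvZr _ _ cq (@continuous_horner _ p)).
by apply: eq_zconv => // x _; rewrite hornerZ.
Qed.

Lemma zconv_suml (I : Type) (s : seq I) (a : I -> R) (F : I -> {poly R}) (q : R -> R) rho :
  continuous q ->
  zconv (horner (\sum_(i <- s) a i *: F i)) q rho = \sum_(i <- s) a i * zconv (horner (F i)) q rho.
Proof.
move=> cq; elim: s => [|i s IH].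
  by rewrite !big_nil -(scale0r 0) zconvZl_poly// mul0r.
rewrite !big_cons -IH -(zconvZl_poly _ _ _ cq).
rewrite -(zconvDl _ (@continuous_horner _ _) (@continuous_horner _ _) cq).
by apply: eq_zconv => // x _; exact: hornerD.
Qed.

Lemma zconv_sumr (I : Type) (s : seq I) (a : I -> R) (F : I -> {poly R}) (Q : R -> R) rho :
  continuous Q ->
  zconv Q (horner (\sum_(i <- s) a i *: F i)) rho = \sum_(i <- s) a i * zconv Q (horner (F i)) rho.
Proof.
move=> cq; elim: s => [|i s IH].
  by rewrite !big_nil -(scale0r 0) zconvZr_poly// mul0r.
rewrite !big_cons -IH -(zconvZr_poly _ _ _ cq).
rewrite -(zconvDr _ cq (@continuous_horner _ _) (@continuous_horner _ _)).
by apply: eq_zconv => // x _; exact: hornerD.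
Qed.

Lemma zconv0 (Q q : R -> R) : continuous Q -> continuous q ->
  zconv Q q 0 = Int 0 pi (fun r => sin r ^+ m) *
    Int 0 pi (fun phi => Q (cos phi) * q (cos phi) * sin phi ^+ m.+1).
Proof.
move=> cQ cq; rewrite /zconv -IntZl; last by Ctn.
by apply: eq_Int => phi _; rewrite zavgC zavg0//; ring.
Qed.

Lemma zconv_le (Q q1 q2 : R -> R) rho : continuous Q -> continuous q1 -> continuous q2 ->
  (forall x, - 1 <= x <= 1 -> 0 <= Q x) -> (forall x, - 1 <= x <= 1 -> q1 x <= q2 x) ->
  zconv Q q1 rho <= zconv Q q2 rho.
Proof.
move=> cQ c1 c2 Q0 q12; apply: le_Int; [exact: ctn_zconv..|move=> phi ph].
rewrite ler_wpM2r ?exprn_ge0 ?sin_ge0_pi// ler_wpM2r ?zavg_ge0//.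
by rewrite q12// cos_geN1 cos_le1.
Qed.

Section eigen.
Variable P : nat -> {poly R}.
Hypothesis eigP : eigenbasis n P.
Local Notation B := (Int 0 pi (fun r : R => sin r ^+ m)).
Local Notation dot p q := (Int 0 pi (fun phi => p (cos phi) * q (cos phi) * sin phi ^+ m.+1)).

Lemma eq0_eigen_moments (v : R -> R) : continuous v ->
  (forall k, Int 0 pi (fun r => v r * ((P k).[cos r] * sin r ^+ m.+1)) = 0) ->
  forall r, 0 <= r <= pi -> v r = 0.
Proof.
move=> cv mom0 r rp.
suff u0 phi : 0 <= phi <= pi -> v phi * sin phi ^+ m.+1 = 0.
  apply: (@closure_eq _ v (fun=> 0) 0 pi) => //; [exact: pi_gt0|exact: cst_continuous|].
  move=> phi ph; have := u0 phi; rewrite ltW ?ltW//; try by case/andP: ph.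
  move=> /(_ isT)/eqP; rewrite mulf_eq0 => /orP[/eqP//|].
  by rewrite expf_eq0/= gt_eqF// sin_gt0_pi.
move=> ph; apply: (@eq0_moments _ (fun phi => v phi * sin phi ^+ m.+1)) => //; first by Ctn.
have bas (i : nat) : size (P i) = i.+1 /\ P i \is monic by have [] := eigP i.
move=> p; have [a ->] := @monic_basis _ P (size p) p (fun i _ => bas i) (leqnn _).
elim: (size p) => [|N IH].
  by under eq_Int do rewrite big_ord0 horner0 mulr0; rewrite Int0.
transitivity (Int 0 pi (fun r => v r * sin r ^+ m.+1 * (\sum_(i < N) a i *: P i).[cos r]) +
    a N * Int 0 pi (fun r => v r * ((P N).[cos r] * sin r ^+ m.+1))); last first.
  by rewrite IH mom0 mulr0 addr0.
rewrite -IntZl -?IntD; [|by Ctn..].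
by apply: eq_Int => x _; rewrite big_ord_recr/= hornerD hornerZ; ring.
Qed.

(** By [zconv_lapl] the value is multiplied by the same number under two distinct eigenvalues. *)
Lemma zconv_orth j k rho : j != k -> zconv (horner (P j)) (horner (P k)) rho = 0.
Proof.
move=> jk; have [_ _ Ej] := eigP j; have [_ _ Ek] := eigP k.
have := zconv_lapl (P j) (P k) rho; rewrite Ej Ek zconvZl_poly ?zconvZr_poly; [|exact: continuous_horner..].
move/eqP; rewrite -subr_eq0 -mulrBl mulf_eq0 => /orP[|/eqP//].
rewrite opprK addrC subr_eq0; case: (ltngtP j k) jk => // jk _.
  by rewrite gt_eqF// ev_lt.
by rewrite lt_eqF// ev_lt.
Qed.

(** At rho = 0 the zonal convolution reduces to the weighted inner product, up to a positive
    factor. *)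
Lemma dot_orth j k : j != k -> dot (horner (P j)) (horner (P k)) = 0.
Proof.
move=> jk; have := zconv_orth 0 jk; rewrite zconv0; [|exact: continuous_horner..].
by move/eqP; rewrite mulf_eq0 gt_eqF ?Int_sin_gt0//= => /eqP.
Qed.

Lemma dot_suml (I : Type) (s : seq I) (a : I -> R) (F : I -> {poly R}) (q : R -> R) :
  continuous q ->
  dot (horner (\sum_(i <- s) a i *: F i)) q = \sum_(i <- s) a i * dot (horner (F i)) q.
Proof.
move=> cq; apply: (mulfI (lt0r_neq0 (Int_sin_gt0 m))).
rewrite -zconv0 ?zconv_suml//; last exact: continuous_horner.
rewrite mulr_sumr; apply: eq_bigr => i _; rewrite zconv0//; last exact: continuous_horner.
by rewrite mulrCA.
Qed.

(* [zavg (P k) ^~ rho] is orthogonal to every other eigenpolynomial, hence proportional to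
   [P k \o cos]; the factor is found at [phi = 0]. *)
Lemma zconv_diag k rho :
  zconv (horner (P k)) (horner (P k)) rho * (P k).[1] =
  B * (P k).[cos rho] * dot (horner (P k)) (horner (P k)).
Proof.
set N := dot _ _; set Z := zconv _ _ _.
have cz := @continuous_zavg (horner (P k)) rho (@continuous_horner _ _).
pose u phi := N * zavg (horner (P k)) phi rho - Z * (P k).[cos phi].
have cu : continuous u by rewrite /u; Ctn.
have u0 : u 0 = 0.
  apply: eq0_eigen_moments cu _ _ _; last by rewrite lexx pi_ge0.
  move=> j; transitivity (N * zconv (horner (P k)) (horner (P j)) rho - Z * dot (horner (P j)) (horner (P k))).
    rewrite /zconv -!IntZl -?IntB; last 4 first.
    - by move=> x; apply: cvgM; [exact: cvg_cst|apply: (@ctn_zconv (horner (P k)))]; exact: continuous_horner.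
    - by Ctn.
    - by Ctn.
    - by apply: ctn_zconv; exact: continuous_horner.
    by apply: eq_Int => psi _; rewrite /u; ring.
  have [->|jk] := eqVneq j k; first by rewrite -/Z -/N; ring.
  by rewrite dot_orth// zconv_orth 1?eq_sym// !mulr0 subrr.
move: u0; rewrite /u zavg0 ?cos0; last exact: continuous_horner.
by move/eqP; rewrite subr_eq0 => /eqP <-; ring.
Qed.

Lemma zconv_polyE (Q : {poly R}) k rho :
  zconv (horner Q) (horner (P k)) rho * (P k).[1] =
  B * (P k).[cos rho] * dot (horner Q) (horner (P k)).
Proof.
have bas (i : nat) : size (P i) = i.+1 /\ P i \is monic by have [] := eigP i.
have [a ->] := @monic_basis _ P (size Q) Q (fun i _ => bas i) (leqnn _).
rewrite zconv_suml ?dot_suml; [|exact: continuous_horner..].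
rewrite mulr_suml mulr_sumr; apply: eq_bigr => i _.
have [->|ik] := eqVneq (i : nat) k; first by rewrite -mulrA zconv_diag; ring.
by rewrite dot_orth// zconv_orth//; ring.
Qed.

Lemma horner_cos_eq0 (p : {poly R}) : (forall r, 0 < r < pi -> p.[cos r] = 0) -> p = 0.
Proof.
move=> p0; apply/eqP; apply/negPn/negP => pn0.
pose s := [seq cos (pi / i.+2%:R) | i <- iota 0 (size p)] : seq R.
have itv i : 0 < (pi : R) / i.+2%:R < (pi : R).
  by rewrite divr_gt0 ?pi_gt0//= ltr_pdivrMr// -[ltLHS]mulr1 ltr_pM2l ?pi_gt0// ltr1n.
have : (size s < size p)%N.
  apply: max_poly_roots => //.
    by apply/allP => x /mapP[i _ ->]; apply/rootP; exact: p0.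
  rewrite map_inj_in_uniq ?iota_uniq// => i j _ _ /cos_inj.
  have ii k : (pi : R) / k.+2%:R \in `[0, pi] :> bool by rewrite in_itv/=; have /andP[/ltW -> /ltW ->] := itv k.
  move=> /(_ (ii i) (ii j))/(mulfI (lt0r_neq0 (pi_gt0 R)))/invr_inj/eqP.
  by rewrite eqr_nat => /eqP[].
by rewrite size_map size_iota ltnn.
Qed.

(** The [P k] are monic rather than normalised at 1. If P_k(1) were 0, [zconv_polyE] with Q = P_k
    would make P_k(cos rho) times the squared norm of P_k vanish for every rho, hence P_k = 0. *)
Lemma eigen1_neq0 k : (P k).[1] != 0.
Proof.
apply/eqP => P1; have [sP _ _] := eigP k.
suff P0 : P k = 0 by rewrite P0 size_poly0 in sP.
have Z0 rho : (P k).[cos rho] = 0 \/ dot (horner (P k)) (horner (P k)) = 0.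
  have /esym/eqP := zconv_polyE (P k) k rho; rewrite P1 mulr0 -mulrA mulf_eq0 gt_eqF ?Int_sin_gt0//=.
  by rewrite mulf_eq0 => /orP[/eqP|/eqP]; [left|right].
apply: horner_cos_eq0 => r r0.
have [//|D0] := Z0 r.
have : (P k).[cos r] * (P k).[cos r] * sin r ^+ m.+1 = 0.
  apply: (@Int_eq0 _ 0 pi (fun phi => (P k).[cos phi] * (P k).[cos phi] * sin phi ^+ m.+1)) => //.
  - exact: pi_gt0.
  - by Ctn.
  - by move=> x xp; rewrite mulr_ge0 -?expr2 ?sqr_ge0// exprn_ge0// sin_ge0_pi.
  - by have /andP[/ltW -> /ltW ->] := r0.
move/eqP; rewrite mulf_eq0 expf_eq0/= [sin r == 0]gt_eqF ?sin_gt0_pi// orbF.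
by rewrite -expr2 expf_eq0/= => /eqP.
Qed.

(** Both sides are Lipschitz in Q for the sup norm and agree on polynomials, so [eq0_functional]
    extends the identity to heat kernels. *)
Lemma funk_hecke (Q : R -> R) k rho : continuous Q ->
  zconv Q (horner (P k)) rho * (P k).[1] = B * (P k).[cos rho] * dot Q (horner (P k)).
Proof.
move=> cQ; apply/eqP; rewrite -subr_eq0; apply/eqP.
have [M M0 PM] := @continuous_bounded _ (- 1) 1 _ (@continuous_horner _ (P k)).
have s1 x : `|sin x ^+ m| <= 1 :> R by rewrite normrX exprn_ile1// ler_norml sin_geN1 sin_le1.
have s2 x : `|sin x ^+ m.+1| <= 1 :> R by rewrite normrX exprn_ile1// ler_norml sin_geN1 sin_le1.
have PMc x : `|(P k).[cos x]| <= M by apply: PM; rewrite cos_geN1 cos_le1.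
apply: (@eq0_functional _ (fun Q => zconv Q (horner (P k)) rho * (P k).[1] -
   B * (P k).[cos rho] * dot Q (horner (P k)))
   (M * (1 * pi) * pi * `|(P k).[1]| + `|B * (P k).[cos rho]| * (1 * M * pi))) => //; last first.
  by move=> p; rewrite zconv_polyE subrr.
move=> f g e cf cg fge.
pose h x := f x - g x.
have ch : continuous h by rewrite /h; Ctn.
have e0 : 0 <= e by apply: le_trans (fge 0 _); rewrite // ?lerN10 ler01.
have -> : zconv f (horner (P k)) rho * (P k).[1] - B * (P k).[cos rho] * dot f (horner (P k)) -
  (zconv g (horner (P k)) rho * (P k).[1] - B * (P k).[cos rho] * dot g (horner (P k))) =
  zconv h (horner (P k)) rho * (P k).[1] - B * (P k).[cos rho] * dot h (horner (P k)).
  have -> : zconv h (horner (P k)) rho = zconv f (horner (P k)) rho - zconv g (horner (P k)) rho.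
    apply/eqP; rewrite eq_sym subr_eq -(zconvDl _ ch cg (@continuous_horner _ _)).
    by apply/eqP; apply: eq_zconv => // x _; rewrite /h subrK.
  have -> : dot h (horner (P k)) = dot f (horner (P k)) - dot g (horner (P k)).
    by rewrite -IntB; [|by Ctn..]; apply: eq_Int => x _; rewrite /h; ring.
  by move: (zconv f _ _) (zconv g _ _) (dot f _) (dot g _) (B * _) => *; ring.
rewrite (le_trans (ler_normB _ _))// [leRHS]mulrDl !normrM lerD//.
  have -> : M * (1 * pi) * pi * `|(P k).[1]| * e = M * (1 * pi) * pi * e * `|(P k).[1]| by rewrite mulrAC.
  rewrite ler_wpM2r//.
  have -> : M * (1 * pi) * pi * e = M * (e * 1 * pi) * 1 * pi by ring.
  rewrite -[X in _ * X]subr0; apply: normr_Int_le; [exact: pi_ge0|by apply: (@ctn_zconv h) => //; exact: continuous_horner|].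
  move=> phi _; rewrite !normrM ler_pM ?mulr_ge0// ler_pM//.
  rewrite -[X in _ * X]subr0; apply: normr_Int_le; [exact: pi_ge0|by rewrite /zc; Ctn|].
  by move=> theta _; rewrite normrM ler_pM// fge// zc_itv.
rewrite -!mulrA ler_wpM2l// ler_wpM2l//.
have -> : 1 * (M * (pi * e)) = e * M * 1 * pi by ring.
rewrite -[X in _ * X]subr0; apply: normr_Int_le; [exact: pi_ge0|by Ctn|].
by move=> phi _; rewrite !normrM ler_pM ?mulr_ge0// ler_pM// fge// cos_geN1 cos_le1.
Qed.
Lemma ctn_sum (T : topologicalType) N (F : nat -> T -> R) (x : T) :
  (forall i, {for x, continuous (F i)}) ->
  {for x, continuous (fun s => \sum_(i < N) F i s)}.
Proof.
move=> cF; elim: N => [|N IH].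
  have -> : (fun s => \sum_(i < 0) F i s) = (fun=> 0) by apply/funext => s; rewrite big_ord0.
  by ctn.
have -> : (fun s => \sum_(i < N.+1) F i s) = (fun s => \sum_(i < N) F i s + F N s).
  by apply/funext => s; rewrite big_ord_recr.
by have c := cF N; ctn.
Qed.

Lemma zconv_rk f k t rho : radial_kernel n f -> 0 < t ->
  zconv (f t) (horner (P k)) rho = expR (- ev n k * t) * (P k).[cos rho] / sphere_vol m.
Proof.
move=> fP t0; have [_ _ Ek] := eigP k; have cf := rk_contr fP t0.
apply: (mulIf (eigen1_neq0 k)); rewrite funk_hecke//.
have := mom_eigen (isT : (0 < n)%N) fP t0 Ek; rewrite /mom /= => ->.
have v0 := sphere_vol_gt0 (R := R) m; have B0 := Int_sin_gt0 m.
field; by rewrite !gt_eqF.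
Qed.

Lemma zconv_rk1 f t rho : radial_kernel n f -> 0 < t ->
  zconv (f t) (fun=> 1) rho = (sphere_vol m)^-1.
Proof.
move=> fP t0; have [s0 m0 _] := eigP 0.
have P1 : P 0 = 1.
  by rewrite (size1_polyC (eq_leq s0)); move/monicP: m0; rewrite lead_coefE s0 => ->.
transitivity (zconv (f t) (horner (P 0)) rho).
  by apply: eq_zconv => // x _; rewrite P1 hornerC.
by rewrite zconv_rk// P1 hornerC /ev mul0r oppr0 mul0r expR0 !mul1r.
Qed.

(** Convolution with the kernel is a Markov operator: it is positive by [rk_ge0] and preserves
    constants by [zconv_rk1]. *)
Lemma zconv_contraction f t (q1 q2 : R -> R) rho e : radial_kernel n f -> 0 < t ->
  continuous q1 -> continuous q2 -> (forall x, - 1 <= x <= 1 -> `|q1 x - q2 x| <= e) ->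
  `|sphere_vol m * zconv (f t) q1 rho - sphere_vol m * zconv (f t) q2 rho| <= e.
Proof.
move=> fP t0 c1 c2 qe; have cf := rk_contr fP t0.
have f0 x : - 1 <= x <= 1 -> 0 <= f t x by apply: rk_ge0 fP t0.
have v0 := sphere_vol_gt0 (R := R) m.
have c1e : continuous (fun x => q2 x + e * 1) by Ctn.
have c2e : continuous (fun x => q2 x + - e * 1) by Ctn.
have cc : continuous (fun _ : R => 1 : R) by exact: cst_continuous.
have H1 := @zconv_le (f t) q1 _ rho cf c1 c1e f0.
have H2 := @zconv_le (f t) _ q1 rho cf c2e c1 f0.
have E a : sphere_vol m * zconv (f t) (fun x => q2 x + a * 1) rho =
    sphere_vol m * zconv (f t) q2 rho + a.
  rewrite zconvDr//; last by Ctn.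
  by rewrite zconvZr// zconv_rk1// mulrDr mulrCA mulfV ?mulr1// gt_eqF.
have G1 : sphere_vol m * zconv (f t) q1 rho <= sphere_vol m * zconv (f t) q2 rho + e.
  by rewrite -E ler_pM2l// H1// => x xi; have := qe x xi; rewrite ler_norml; lra.
have G2 : sphere_vol m * zconv (f t) q2 rho - e <= sphere_vol m * zconv (f t) q1 rho.
  by rewrite -E ler_pM2l// H2// => x xi; have := qe x xi; rewrite ler_norml; lra.
by rewrite ler_norml; lra.
Qed.

(** On a polynomial the convolution is a finite sum of exponentials, continuous at s = 0. The
    contraction property carries the limit to continuous functions, even when the function moves
    with s. *)
Lemma zconv_rk_cvg f (h : R -> R -> R) (h0 : R -> R) rho : radial_kernel n f ->
  (\forall s \near 0^'+, continuous (h s)) -> continuous h0 ->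
  (forall e, 0 < e -> \forall s \near 0^'+, forall x, - 1 <= x <= 1 -> `|h s x - h0 x| <= e) ->
  sphere_vol m * zconv (f s) (h s) rho @[s --> 0^'+] --> h0 (cos rho).
Proof.
move=> fP ch ch0 hh.
have v0 := sphere_vol_gt0 (R := R) m.
have pol (p : {poly R}) : sphere_vol m * zconv (f s) (horner p) rho @[s --> 0^'+] --> p.[cos rho].
  have bas (i : nat) : size (P i) = i.+1 /\ P i \is monic by have [] := eigP i.
  have [a ->] := @monic_basis _ P (size p) p (fun i _ => bas i) (leqnn _).
  set S := \sum_(i < _) _.
  apply: (@cvg_trans _ ((fun s => \sum_(i < size p) a i * (expR (- ev n i * s) * (P i).[cos rho])) @ 0^'+)).
    apply: near_eq_cvg; near=> s.
    have s0 : 0 < s by near: s; exact: nbhs_right_gt.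
    rewrite zconv_sumr; last exact: rk_contr fP s0.
    rewrite mulr_sumr; apply: eq_bigr => i _; rewrite zconv_rk//.
    by field; rewrite gt_eqF.
  rewrite /S horner_sum.
  have -> : \sum_(i < size p) (a i *: P i).[cos rho] =
    \sum_(i < size p) a i * (expR (- ev n i * 0) * (P i).[cos rho]).
    by apply: eq_bigr => i _; rewrite hornerZ mulr0 expR0 mul1r.
  apply: (@at_right_cont _ (fun s => \sum_(i < size p) a i * (expR (- ev n i * s) * (P i).[cos rho]))).
  by move=> x; apply: (ctn_sum (F := fun i s => a i * (expR (- ev n i * s) * (P i).[cos rho]))) => i; ctn.
apply/cvgrPdist_le => e e0.
have e4 : 0 < e / 4 by rewrite divr_gt0.
have [p hp] := weierstrass ch0 e4.
move/cvgrPdist_le: (pol p) => /(_ _ e4) pc.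
near=> s.
have s0 : 0 < s by near: s; exact: nbhs_right_gt.
have A1 : `|p.[cos rho] - sphere_vol m * zconv (f s) (horner p) rho| <= e / 4 by near: s.
have A2 : forall x, - 1 <= x <= 1 -> `|h s x - h0 x| <= e / 4 by near: s; exact: hh.
have A3 : `|h0 (cos rho) - p.[cos rho]| <= e / 4 by apply: hp; rewrite cos_geN1 cos_le1.
have A4 : `|sphere_vol m * zconv (f s) (h s) rho - sphere_vol m * zconv (f s) (horner p) rho| <= e / 4 + e / 4.
  apply: zconv_contraction => //; [by near: s|exact: continuous_horner|].
  move=> x xi; rewrite (le_trans (ler_distD (h0 x) _ _))// lerD ?A2//; exact: hp.
rewrite !ler_norml in A1 A3 A4 *; lra.
Unshelve. all: by end_near. Qed.
End eigen.

End funk_hecke.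

(** * The Abel transform *)

Section improper.
Context {R : realType}.
Notation mu := (@lebesgue_measure R).

Lemma FTC_itv (a b : R) (f F : R -> R) : a <= b ->
  (forall x, a <= x <= b -> {for x, continuous f}) ->
  (forall x : R, a <= x <= b -> is_derive x 1 F (f x)) ->
  Int a b f = F b - F a.
Proof.
move=> ab cf dF; pose fc x := f (clamp a b x).
transitivity (Int a b fc); first by apply: eq_Int => x xab; rewrite /fc clamp_id.
apply: (FTC ab).
- apply: (continuous_clamp_comp ab); apply: continuous_in_subspaceT => x.
  by rewrite inE/= in_itv/= => /cf.
- by move=> x /andP[x1 x2]; rewrite /fc clamp_id ?(ltW x1) ?(ltW x2)//; apply/dF/andP; rewrite !ltW.
- apply: continuous_in_subspaceT => x; rewrite inE/= in_itv/= => xab.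
  exact: is_derive_continuous (dF x xab).
Qed.

(** Monotone convergence: for a nonnegative integrand the integral in the extended reals is the
    limit over an exhaustion by segments, and its finiteness is part of the conclusion. *)
Lemma integral_exhaustion (a b : nat -> R) (D : set R) (L : R) (F : R -> R) :
  (forall i j, (i <= j)%N -> a j <= a i) -> (forall i j, (i <= j)%N -> b i <= b j) ->
  (forall i, a i <= b i) -> open D -> \bigcup_i `[a i, b i]%classic = D ->
  (forall x, D x -> {for x, continuous F}) -> (forall x, D x -> 0 <= F x) ->
  Int (a i) (b i) F @[i --> \oo] --> L ->
  (\int[mu]_(x in D) (F x)%:E = L%:E)%E.
Proof.
move=> aa bb ab oD abD cF F0 FL.
have abDi i x : a i <= x <= b i -> D x by move=> xi; rewrite -abD; exists i => //=; rewrite in_itv.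
have mF : measurable_fun D F.
  by apply: measurable_realfun.open_continuous_measurable_fun => // x; rewrite inE; exact: cF.
have cvg1 : (\int[mu]_(x in `[a i, b i]) (F x)%:E @[i --> \oo] -->
             \int[mu]_(x in \bigcup_i `[a i, b i]%classic) (F x)%:E)%E.
  apply: ge0_nondecreasing_set_cvg_integral.
  - move=> i j ij; apply/subsetPset => x; rewrite /= !in_itv/=.
    by have := aa _ _ ij; have := bb _ _ ij; lra.
  - by move=> i; exact: measurable_itv.
  - move=> i; apply/measurable_realfun.measurable_EFinP; apply: measurable_funS mF.
      exact: measurable_realfun.open_measurable.
    by move=> x; rewrite /= in_itv/=; exact: abDi.
  - by move=> i x; rewrite /= in_itv/= => /abDi/F0; rewrite lee_fin.
rewrite -abD; apply: (cvg_unique _ cvg1) => //.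
have -> : (fun i => \int[mu]_(x in `[a i, b i]) (F x)%:E)%E = (fun i => (Int (a i) (b i) F)%:E).
  apply/funext => i; pose Fc x := F (clamp (a i) (b i) x).
  have cFc : continuous Fc.
    apply: (continuous_clamp_comp (ab i)); apply: continuous_in_subspaceT => x.
    by rewrite inE/= in_itv/= => /abDi; exact: cF.
  transitivity (\int[mu]_(x in `[a i, b i]) (Fc x)%:E)%E.
    by apply: eq_integral => x; rewrite inE/= in_itv/= => xD; rewrite /Fc clamp_id.
  by rewrite EFin_Int//; congr (_%:E); apply: eq_Int => x xD; rewrite /Fc clamp_id.
by apply: cvg_EFin; [near=> i|exact: FL].
Unshelve. all: by end_near. Qed.

Lemma integral_oo (a b L : R) (F : R -> R) : a < b ->
  (forall x, a < x < b -> {for x, continuous F}) ->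
  (forall x, a < x < b -> 0 <= F x) ->
  Int (a + e) (b - e) F @[e --> 0^'+] --> L ->
  (\int[mu]_(x in `]a, b[) (F x)%:E = L%:E)%E.
Proof.
move=> ab cF F0 FL.
(* The denominator starts at 2 so that a + d i <= b - d i. *)
pose d i : R := (b - a) / i.+2%:R.
have d0 i : 0 < d i by rewrite divr_gt0// subr_gt0.
have d1 i j : (i <= j)%N -> d j <= d i.
  by move=> ij; rewrite ler_pM2l ?subr_gt0// lef_pV2 ?posrE// ler_nat ltnS.
have dcvg : d i @[i --> \oo] --> 0.
  rewrite -[X in _ --> X](mulr0 (b - a)); apply: cvgM; first exact: cvg_cst.
  by have := @cvg_harmonic R; rewrite -(cvg_shiftn 1); under eq_fun do rewrite addn1.
apply: (@integral_exhaustion (fun i => a + d i) (fun i => b - d i)).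
- by move=> i j /d1; rewrite lerD2l.
- by move=> i j /d1; rewrite lerD2l lerN2.
- move=> i; have : d i <= (b - a) / 2 by rewrite ler_pM2l ?subr_gt0// lef_pV2 ?posrE// ler_nat.
  lra.
- exact: interval_open.
- apply/seteqP; split => [x [i _]|x]; rewrite /= !in_itv//=.
    by have := d0 i; lra.
  move=> /andP[ax xb].
  have m0 : 0 < Num.min (x - a) (b - x) by rewrite lt_min !subr_gt0 ax.
  have /cvgrPdist_lt /(_ _ m0)[N _ /(_ N (leqnn N))] := dcvg.
  rewrite sub0r normrN gtr0_norm// lt_min => /andP[h1 h2].
  by exists N => //; rewrite /= in_itv/=; lra.
- by move=> x; rewrite /= in_itv; exact: cF.
- by move=> x; rewrite /= in_itv; exact: F0.
move=> A /FL; rewrite /at_right/= /within/= => /dcvg[N _ NP]; exists N => // i /NP/=.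
by apply; exact: d0.
Qed.

Lemma integral_oo_FTC (a b : R) (F G : R -> R) : a < b ->
  (forall x, a < x < b -> {for x, continuous F}) ->
  (forall x, a < x < b -> 0 <= F x) ->
  (forall x : R, a < x < b -> is_derive x 1 G (F x)) -> continuous G ->
  (\int[mu]_(x in `]a, b[) (F x)%:E = (G b - G a)%:E)%E.
Proof.
move=> ab cF F0 dG cG.
have E : \forall e \near 0^'+, Int (a + e) (b - e) F = G (b - e) - G (a + e).
  near=> e.
  have e0 : 0 < e by near: e; exact: nbhs_right_gt.
  have eh : e < (b - a) / 2 by near: e; apply: nbhs_right_lt; rewrite divr_gt0// subr_gt0.
  have re : a + e <= b - e by lra.
  have oo x : a + e <= x <= b - e -> a < x < b by lra.
  by apply: (FTC_itv re) => x /oo; [exact: cF|exact: dG].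
apply: integral_oo ab cF F0 _.
apply: (@cvg_trans _ ((fun e => G (b - e) - G (a + e)) @ 0^'+)).
  by apply: near_eq_cvg; apply: filterS E => e ->.
have -> : G b - G a = G (b - 0) - G (a + 0) by rewrite subr0 addr0.
apply: (@at_right_cont _ (fun e => G (b - e) - G (a + e))).
by Ctn.
Unshelve. all: by end_near. Qed.

End improper.

Section abel.
Context {R : realType}.
Notation mu := (@lebesgue_measure R).
Implicit Types (h : R -> R) (x r rho : R).

(* The Abel transform of [h] at [x = cos r], after the substitution
   [u ^ 2 = (cos r - cos rho) / (1 + cos r)]. *)
Definition abel h x : R :=
  2 * Num.sqrt (1 + x) * Int 0 1 (fun u => h ((1 + x) * (1 - u ^+ 2) - 1)).

(** The integrand is singular at rho = r, so the endpoints are dropped and an explicit primitive,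
    obtained by the square-root substitution, is used on the open interval. *)
Lemma abel_integral h r : continuous h -> (forall x, - 1 <= x <= 1 -> 0 <= h x) ->
  0 <= r <= pi ->
  (\int[mu]_(rho in `[r, pi]) (h (cos rho) * sin rho / Num.sqrt (cos r - cos rho))%:E
   = (abel h (cos r))%:E)%E.
Proof.
move=> ch h0 /andP[r0]; rewrite le_eqVlt => /predU1P[->|rp].
  by rewrite set_itv1 integral_set1 /abel cospi subrr sqrtr0 mulr0 mul0r.
pose F rho := h (cos rho) * sin rho / Num.sqrt (cos r - cos rho).
have cosr rho : r < rho < pi -> 0 < cos r - cos rho.
  move=> /andP[r1 r2]; rewrite subr_gt0 ltr_cos// in_itv/= ?r0 ?(ltW rp)//.
  by rewrite (ltW r2) (le_trans r0) ?ltW.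
have cF rho : r < rho < pi -> {for rho, continuous F}.
  move=> rr; rewrite /F; apply: ctnM; first by ctn.
  apply: (@ctn_comp _ _ _ (fun y : R => y^-1) (fun rho => Num.sqrt (cos r - cos rho))); last by ctn.
  by apply: inv_continuous; rewrite gt_eqF// sqrtr_gt0 cosr.
rewrite integral_itv_bndoo; last first.
  apply/measurable_realfun.measurable_EFinP; apply: measurable_realfun.open_continuous_measurable_fun; first exact: interval_open.
  by move=> x; rewrite inE/= in_itv/=; exact: cF.
pose a := 1 + cos r.
have a0 : 0 < a by rewrite /a -ltrBlDl sub0r -cospi ltr_cos ?in_itv/= ?r0 ?(ltW rp) ?pi_ge0 ?lexx.
pose phi u := h (a * (1 - u ^+ 2) - 1).
have cphi : continuous phi by rewrite /phi; Ctn.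
(* The lower end -1 makes [Phi] differentiable at U = 0 as well, the value reached at rho = r. *)
pose Phi U := Int (-1) U phi.
have dPhi (U : R) : 0 <= U -> is_derive U 1 Phi (phi U).
  by move=> U0; apply: is_derive_primitive => //; apply: lt_le_trans U0; rewrite ltrN10.
pose u rho := Num.sqrt ((cos r - cos rho) / a).
pose G rho := 2 * Num.sqrt a * Phi (u rho).
have cG : continuous G.
  have cu : continuous u by rewrite /u; Ctn.
  move=> x; have c1 := is_derive_continuous (dPhi _ (sqrtr_ge0 ((cos r - cos x) / a))).
  have c2 : {for x, continuous (fun x => Phi (u x))} by exact: (@ctn_comp _ _ _ Phi u x c1 (cu x)).
  by change {for x, continuous G}; rewrite /G; ctn.
have dG (rho : R) : r < rho < pi -> is_derive rho 1 G (F rho).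
  move=> rr; have c0 := cosr _ rr.
  have q0 : 0 < (cos r - cos rho) / a by rewrite divr_gt0.
  have d1 : has_der u rho (sin rho / (2 * Num.sqrt a * Num.sqrt (cos r - cos rho))).
    have d0 : has_der (fun rho => (cos r - cos rho) / a) rho (sin rho / a).
      by apply: der_eq; [der|rewrite /=; ring].
    apply: der_eq (der_sqrt d0 q0) _.
    rewrite sqrtrM ?ltW// sqrtrV ?ltW//.
    have := sqr_sqrtr (ltW a0); have : 0 < Num.sqrt a by rewrite sqrtr_gt0.
    have : 0 < Num.sqrt (cos r - cos rho) by rewrite sqrtr_gt0.
    move: (Num.sqrt a) (Num.sqrt (cos r - _)) => A C C0 A0 <- /=.
    by field; rewrite !gt_eqF.
  have d2 : has_der (fun rho => Phi (u rho)) rho (phi (u rho) * (sin rho / (2 * Num.sqrt a * Num.sqrt (cos r - cos rho)))).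
    exact: (@der_comp _ u Phi _ _ _ (dPhi _ (sqrtr_ge0 _)) d1).
  rewrite /G; apply: der_eq; first by der.
  rewrite /F /phi /u sqr_sqrtr ?ltW//=.
  have -> : a * (1 - (cos r - cos rho) / a) - 1 = cos rho.
    by rewrite mulrBr mulrCA mulfV ?gt_eqF// /a; ring.
  have : 0 < Num.sqrt a by rewrite sqrtr_gt0.
  have : 0 < Num.sqrt (cos r - cos rho) by rewrite sqrtr_gt0.
  move: (Num.sqrt a) (Num.sqrt (cos r - _)) => A C C0 A0.
  by field; rewrite !gt_eqF.
have -> : abel h (cos r) = G pi - G r.
  have ur : u r = 0 by rewrite /u subrr mul0r sqrtr0.
  have up : u pi = 1 by rewrite /u cospi opprK [cos r + 1]addrC mulfV ?sqrtr1// gt_eqF.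
  rewrite /G ur up; clear up ur u cG dG G.
  rewrite -mulrBr; congr (_ * _); rewrite /Phi.
  have -> : Int (-1) 1 phi = Int (-1) 0 phi + Int 0 1 phi by apply: IntS; rewrite ?lerN10 ?ler01.
  by rewrite [RHS]addrAC subrr add0r.
apply: (@integral_oo_FTC R r pi F G rp cF _ dG cG) => x xr.
rewrite /F divr_ge0 ?sqrtr_ge0// mulr_ge0 ?h0 ?cos_geN1 ?cos_le1//.
by apply: sin_ge0_pi; case/andP: xr => r1 r2; rewrite (ltW r2) (le_trans r0)// ltW.
Qed.

End abel.

(** * Half-angle variables and the Abel transform of powers of 1 + x *)

Section half_angle.
Context {R : realType}.
Implicit Types (r : R) (m k : nat).

(* With these, [sin r = kap r * sig r] and [cos r = kap r ^ 2 - 1], so that all the weights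
   of the half-angle are monomials. *)
Definition kap r : R := Num.sqrt 2 * cos (r / 2).
Definition sig r : R := Num.sqrt 2 * sin (r / 2).

Let sq2 : Num.sqrt 2 ^+ 2 = 2 :> R. Proof. by rewrite sqr_sqrtr. Qed.

Let dbl r : r = r / 2 + r / 2. Proof. by field. Qed.

Lemma kap2 r : kap r ^+ 2 = 1 + cos r.
Proof. by rewrite [in RHS](dbl r) cosD /kap exprMn sq2 -[sin _ * _]expr2 sin2cos2; ring. Qed.

Lemma sig2 r : sig r ^+ 2 = 1 - cos r.
Proof. by rewrite [in RHS](dbl r) cosD /sig exprMn sq2 -[cos _ * _]expr2 cos2sin2; ring. Qed.

Lemma kap_sig r : kap r * sig r = sin r.
Proof. by rewrite [in RHS](dbl r) sinD /kap /sig mulrACA -expr2 sq2; ring. Qed.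

Lemma continuous_kap : continuous kap. Proof. by rewrite /kap; Ctn. Qed.

Lemma continuous_sig : continuous sig. Proof. by rewrite /sig; Ctn. Qed.

Lemma der_kap r : has_der kap r (- sig r / 2).
Proof.
have d : has_der (fun r : R => r / 2) r (2^-1) by apply: der_eq; [der|rewrite /=; ring].
have d' := @der_comp _ _ cos r _ _ (is_derive_cos _) d.
by apply: der_eq; [exact: derM (der_cst _ _) d'|rewrite /sig /=; ring].
Qed.

Lemma der_sig r : has_der sig r (kap r / 2).
Proof.
have d : has_der (fun r : R => r / 2) r (2^-1) by apply: der_eq; [der|rewrite /=; ring].
have d' := @der_comp _ _ sin r _ _ (is_derive_sin _) d.
by apply: der_eq; [exact: derM (der_cst _ _) d'|rewrite /kap /=; ring].
Qed.

Lemma kap_ge0 r : 0 <= r <= pi -> 0 <= kap r.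
Proof.
move=> rp; rewrite mulr_ge0 ?sqrtr_ge0// cos_ge0_pihalf//.
by have := pi_ge0 R; move: (pi : R) rp => *; lra.
Qed.

Lemma sig_ge0 r : 0 <= r <= pi -> 0 <= sig r.
Proof.
move=> rp; rewrite mulr_ge0 ?sqrtr_ge0// sin_ge0_pi//.
by have := pi_ge0 R; move: (pi : R) rp => *; lra.
Qed.

Lemma kap_pi : kap pi = 0. Proof. by rewrite /kap cos_pihalf mulr0. Qed.

Lemma sig_pi : sig pi = Num.sqrt 2. Proof. by rewrite /sig sin_pihalf mulr1. Qed.

Lemma sig_0 : sig 0 = 0. Proof. by rewrite /sig mul0r sin0 mulr0. Qed.

Lemma kap_0 : kap 0 = Num.sqrt 2. Proof. by rewrite /kap mul0r cos0 mulr1. Qed.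

Lemma sqrt_kap r : 0 <= r <= pi -> Num.sqrt (1 + cos r) = kap r.
Proof. by move=> /kap_ge0 k0; rewrite -kap2 sqrtr_sqr ger0_norm. Qed.

Lemma continuous_abel (h : R -> R) : continuous h -> continuous (abel h).
Proof.
move=> ch x.
have c1 : {for x, continuous (fun x : R => Int 0 1 (fun u : R => h ((1 + x) * (1 - u ^+ 2) - 1)))}.
  apply: (@continuous_Int _ _ (fun x u : R => h ((1 + x) * (1 - u ^+ 2) - 1))) => //.
    by move=> y _; ctn.
  by near=> y; Ctn.
by change {for x, continuous (abel h)}; rewrite /abel; ctn.
Unshelve. all: by end_near. Qed.

Lemma abelD (f g : R -> R) x : continuous f -> continuous g ->
  abel (fun y => f y + g y) x = abel f x + abel g x.
Proof. by move=> cf cg; rewrite /abel IntD ?mulrDr//; Ctn. Qed.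

Lemma abelZ a (f : R -> R) x : continuous f -> abel (fun y => a * f y) x = a * abel f x.
Proof. by move=> cf; rewrite /abel IntZl; [ring|Ctn]. Qed.

Lemma abel_itv (x u : R) : - 1 <= x <= 1 -> 0 <= u <= 1 -> - 1 <= (1 + x) * (1 - u ^+ 2) - 1 <= x.
Proof.
move=> x1 u1; have u2 : 0 <= u ^+ 2 <= 1 by rewrite sqr_ge0 expr_le1; case/andP: u1.
by apply/andP; split; nra.
Qed.

Lemma eq_abel (f g : R -> R) x : - 1 <= x <= 1 ->
  (forall y, - 1 <= y <= x -> f y = g y) -> abel f x = abel g x.
Proof.
by move=> x1 fg; congr (_ * _); apply: eq_Int => u u01; apply/fg/abel_itv.
Qed.

(** Euler's Beta value B(1/2, k + 1), after the substitution v = u^2. *)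
Definition beta k : R := 2 * Int 0 1 (fun u : R => (1 - u ^+ 2) ^+ k).

Lemma beta0 : beta 0 = 2.
Proof. by rewrite /beta; under [Int _ _ _]eq_Int do rewrite expr0; rewrite Int_cst// subr0 !mulr1. Qed.

Lemma betaS k : (2 * k%:R + 3) * beta k.+1 = (2 * k%:R + 2) * beta k.
Proof.
have d (u : R) : has_der (fun u : R => u * (1 - u ^+ 2) ^+ k.+1) u
   ((2 * k%:R + 3) * (1 - u ^+ 2) ^+ k.+1 - (2 * k%:R + 2) * (1 - u ^+ 2) ^+ k).
  apply: der_eq; first by der.
  by rewrite /= -(natr1 k) !(exprS _ k); move: (_ ^+ k) => E; ring.
have : Int 0 1 (fun u : R => (2 * k%:R + 3) * (1 - u ^+ 2) ^+ k.+1 - (2 * k%:R + 2) * (1 - u ^+ 2) ^+ k) = 0.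
  transitivity (1 * (1 - 1 ^+ 2) ^+ k.+1 - 0 * (1 - 0 ^+ 2) ^+ k.+1 : R).
    by apply: FTCT ler01 _ d; Ctn.
  by rewrite expr1n subrr exprS !mul0r mulr0 subrr.
rewrite IntB ?IntZl; [|by Ctn..] => /eqP; rewrite subr_eq0 => /eqP E.
by rewrite /beta mulrCA E; ring.
Qed.

(** The transform raises the exponent of 1 + x by one half, so powers of 1 + x are the basis in
    which its action on the Laplacian is computed. *)
Lemma abel_monomial k x : abel (fun y => (1 + y) ^+ k) x = beta k * (Num.sqrt (1 + x) * (1 + x) ^+ k).
Proof.
have -> : beta k * (Num.sqrt (1 + x) * (1 + x) ^+ k) = 2 * Num.sqrt (1 + x) *
   ((1 + x) ^+ k * Int 0 1 (fun u : R => (1 - u ^+ 2) ^+ k)) by rewrite /beta; ring.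
rewrite -IntZl; last by Ctn.
by congr (_ * _); apply: eq_Int => u _; rewrite -exprMn; congr (_ ^+ _); ring.
Qed.

Lemma abel_monomial_cos k r : 0 <= r <= pi ->
  abel (fun y => (1 + y) ^+ k) (cos r) = beta k * kap r ^+ k.*2.+1.
Proof.
move=> rp; rewrite abel_monomial sqrt_kap// -kap2 -exprM mul2n exprS; ring.
Qed.

End half_angle.

Section abel_lapl.
Context {R : realType}.
Variable m : nat.
Local Notation n := m.+2.
Implicit Types (p q : {poly R}) (r : R).

(** Moment of 1 / [kap] for the weight sin^(m+1): that quotient is [sig r ^+ m.+1 * kap r ^+ m],
    free of the singularity at r = pi. *)
Definition abel_bdry p : R := Int 0 pi (fun r => p.[cos r] * (sig r ^+ m.+1 * kap r ^+ m)).

(* [F] is [sin ^ n.-1] times the Wronskian of [kap ^ (2 k + 1)] and [p \o cos]. *)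
Lemma wronskian k p :
  Int 0 pi (fun r => p.[cos r] * (kap r ^+ (m + k.*2) * sig r ^+ m.+1) *
    ((k%:R + 2^-1) * (m.+1%:R + 2 * k%:R) - (k%:R + 2^-1) * (m%:R + k%:R + 3 / 2) * kap r ^+ 2)) =
  Int 0 pi (fun r => (lapl n p).[cos r] * (kap r ^+ (m + k.*2) * sig r ^+ m.+1) * kap r ^+ 2).
Proof.
pose F r := kap r ^+ (m + k.*2).+1 * sig r ^+ m.+2 *
  (- (k%:R + 2^-1) * p.[cos r] + kap r ^+ 2 * p^`().[cos r]).
have cK := @continuous_kap R; have cS := @continuous_sig R.
apply/eqP; rewrite -subr_eq0 -IntB; [|by Ctn..]; apply/eqP.
transitivity (F pi - F 0); last by rewrite /F kap_pi sig_0 !exprS !mul0r !mulr0 !mul0r subrr.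
apply: FTCT; [exact: pi_ge0|by Ctn|move=> r].
have dc (q : {poly R}) : has_der (fun r => q.[cos r]) r (q^`().[cos r] * - sin r).
  exact: (@der_comp _ cos (horner q) _ _ _ (is_derive_poly q _) (is_derive_cos _)).
have d1 := dc p; have d2 := dc p^`(); have d3 := der_kap r; have d4 := der_sig r.
rewrite /F; apply: der_eq; first by der.
rewrite /= laplE.
have : sig r ^+ 2 = 2 - kap r ^+ 2 by rewrite kap2 sig2; ring.
have -> : cos r = kap r ^+ 2 - 1 by rewrite kap2; ring.
rewrite -kap_sig.
have -> : (m + k.*2).+1%:R = m%:R + 1 + 2 * k%:R :> R by rewrite -natr1 natrD -mul2n natrM; ring.
rewrite !(exprS _ m.+1) !(exprS _ (m + k.*2)) -!(natr1 m.+1) -!(natr1 m).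
move: (p.[_]) (p^`().[_]) (p^`()^`().[_]) (kap r ^+ (_ + _)) (sig r ^+ m.+1) => P P1 P2 A B.
move: (kap r) (sig r) => K S HS.
apply/eqP; rewrite -subr_eq0; apply/eqP.
(* The discrepancy is an explicit multiple of the relation sig^2 + kap^2 = 2. *)
transitivity ((S ^+ 2 - (2 - K ^+ 2)) * (A * B * (- (m%:R + 1 + 2 * k%:R) / 2 *
  (- (k%:R + 2^-1) * P + K ^+ 2 * P1) + K ^+ 2 * ((k%:R - 2^-1) * P1 - K ^+ 2 * P2)))).
  by field.
by rewrite HS subrr mul0r.
Qed.

Lemma Int_abel_sum (I : Type) (s : seq I) (a : I -> R) (F : I -> {poly R}) (w : R -> R) :
  continuous w ->
  Int 0 pi (fun r => abel (horner (\sum_(i <- s) a i *: F i)) (cos r) * w r) =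
  \sum_(i <- s) a i * Int 0 pi (fun r => abel (horner (F i)) (cos r) * w r).
Proof.
move=> cw; have cA (q : {poly R}) := continuous_abel (@continuous_horner R q).
elim: s => [|i s IH].
  rewrite !big_nil -[RHS](Int0 0 pi); apply: eq_Int => r _.
  rewrite /abel; under [Int 0 1 _]eq_Int do rewrite horner0.
  by rewrite Int0 mulr0 mul0r.
rewrite !big_cons -IH.
have c1 := cA (F i); have c2 := cA (\sum_(j <- s) a j *: F j).
rewrite -IntZl -?IntD; [|by Ctn..].
apply: eq_Int => r _; rewrite mulrA -mulrDl; congr (_ * _).
have c3 := @continuous_horner R (F i); have c4 := @continuous_horner R (\sum_(j <- s) a j *: F j).
rewrite -abelZ// -abelD//; last by Ctn.
by congr (abel _ _); apply/funext => y; rewrite hornerD hornerZ.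
Qed.

Lemma abel_lapl_monomial k r : 0 <= r <= pi ->
  abel (horner (lapl n.+1 ((1 + 'X) ^+ k))) (cos r) * sin r ^+ m.+1 =
  beta k * (kap r ^+ (m + k.*2) * sig r ^+ m.+1) *
    ((k%:R + 2^-1) * (m.+1%:R + 2 * k%:R) - k%:R * (k%:R + m.+2%:R) * kap r ^+ 2)
  - m.+1%:R * ((1 + 'X) ^+ k).[-1] * (sig r ^+ m.+1 * kap r ^+ m).
Proof.
(* For k = 0 the operator kills the constant, and the boundary term cancels the bulk term; this is
   the only power of 1 + x not vanishing at -1. *)
move=> rp; case: k => [|k].
  rewrite expr0 hornerC beta0 addn0.
  have -> : lapl n.+1 1 = 0 :> {poly R}.
    by rewrite /lapl -[1]/(1%:P) derivC deriv0 !mulr0 scaler0 subrr.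
  rewrite /abel; under [Int 0 1 _]eq_Int do rewrite horner0.
  by rewrite Int0; field.
have -> : ((1 + 'X) ^+ k.+1).[-1] = 0 :> R.
  by rewrite horner_exp hornerD hornerX hornerC subrr exprS mul0r.
rewrite mulr0 mul0r subr0.
(* In dimension N = m + 3 and with a = k + 1, L (1 + x)^a = c1 (1 + x)^(a-1) - c2 (1 + x)^a, where
   c1 = a (2 (a - 1) + N) and c2 = a (a - 1 + N). *)
pose c1 : R := k.+1%:R * (2 * k%:R + m%:R + 3).
pose c2 : R := k.+1%:R * (k.+1%:R + m.+2%:R).
have -> : abel (horner (lapl n.+1 ((1 + 'X) ^+ k.+1))) (cos r) =
    c1 * (beta k * kap r ^+ k.*2.+1) + - c2 * (beta k.+1 * kap r ^+ k.+1.*2.+1).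
  rewrite -!abel_monomial_cos// -!abelZ -?abelD; [|by Ctn..].
  congr (abel _ _); apply/funext => y.
  have E : ((1 + 'X) ^+ k.+1)^`() = k.+1%:R *: (1 + 'X) ^+ k :> {poly R}.
    by rewrite deriv_exp derivD derivX -[1]/(1%:P) derivC add0r mul1r scaler_nat.
  rewrite laplE E derivZ !hornerZ horner_exp hornerD hornerX hornerC /c1 /c2.
  case: k {c1 c2 E} => [|k].
    have -> : ((1 + 'X) ^+ 0)^`() = 0 :> {poly R} by rewrite expr0 -[1]/(1%:P) derivC.
    by rewrite horner0 expr0 -!(natr1 m.+2) -!(natr1 m.+1) -!(natr1 m); ring.
  have E : ((1 + 'X) ^+ k.+1)^`() = k.+1%:R *: (1 + 'X) ^+ k :> {poly R}.
    by rewrite deriv_exp derivD derivX -[1]/(1%:P) derivC add0r mul1r scaler_nat.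
  rewrite E hornerZ horner_exp hornerD hornerX hornerC.
  rewrite -!(natr1 m.+2) -!(natr1 m.+1) -!(natr1 m) -!(natr1 k.+1) -!(natr1 k) !(exprS _ k.+1) !(exprS _ k).
  by move: (_ ^+ k) => A; ring.
have := betaS (R := R) k; rewrite -kap_sig [(kap r * sig r) ^+ _]exprMn doubleS !addnS !exprS exprD /c1 /c2.
rewrite -!(natr1 m.+1) -!(natr1 m) -!(natr1 k).
move: (beta k) (beta k.+1) => b0 b1 H.
have -> : b0 = (2 * k%:R + 3) / (2 * k%:R + 2) * b1.
  have k0 : 2 * k%:R + 2 != 0 :> R by rewrite gt_eqF// ltr_pwDr// mulr_ge0.
  by apply: (mulfI k0); rewrite -H; field.
have k1 : k%:R + 1 != 0 :> R by rewrite gt_eqF// ltr_pwDr.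
have k0 : 2 * k%:R + 2 != 0 :> R by rewrite gt_eqF// ltr_pwDr// mulr_ge0.
by field; rewrite ?k1 ?k0.
Qed.

(* [abel] intertwines [lapl n.+1] and [lapl n] up to the constant [(2 n - 1) / 4] and a
   boundary term at the antipode; both sides are explicit on powers of [1 + 'X]. *)
Lemma abel_lapl phi p :
  Int 0 pi (fun r => abel (horner (lapl n.+1 phi)) (cos r) * (p.[cos r] * sin r ^+ m.+1)) =
  Int 0 pi (fun r => abel (horner phi) (cos r) *
    (((lapl n p).[cos r] + (2 * n%:R - 1) / 4 * p.[cos r]) * sin r ^+ m.+1))
  - m.+1%:R * phi.[-1] * abel_bdry p.
Proof.
have cK := @continuous_kap R; have cS := @continuous_sig R.
have cA (q : {poly R}) := continuous_abel (@continuous_horner R q).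
pose Q k : {poly R} := (1 + 'X) ^+ k.
have bas k : size (Q k) = k.+1 /\ Q k \is monic.
  by rewrite /Q -[1 + _]addrC -[1]opprK -polyCN; split; [rewrite size_exp_XsubC|rewrite monic_exp// monicXsubC].
have [a ->] := @monic_basis _ Q (size phi) phi (fun i _ => bas i) (leqnn _).
rewrite lapl_sum; under eq_bigr do rewrite laplZ.
have cw1 : continuous (fun r => p.[cos r] * sin r ^+ m.+1) by Ctn.
have cw2 : continuous (fun r => ((lapl n p).[cos r] + (2 * n%:R - 1) / 4 * p.[cos r]) * sin r ^+ m.+1) by Ctn.
rewrite (@Int_abel_sum _ _ _ _ (fun r => p.[cos r] * sin r ^+ m.+1) cw1).
rewrite [in RHS](@Int_abel_sum _ _ _ _ (fun r => ((lapl n p).[cos r] + (2 * n%:R - 1) / 4 * p.[cos r]) * sin r ^+ m.+1) cw2).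
rewrite horner_sum mulr_sumr mulr_suml -sumrB; apply: eq_bigr => k _.
rewrite hornerZ mulrCA -mulrA -mulrBr; congr (_ * _).
transitivity (Int 0 pi (fun r => beta k * (p.[cos r] * (kap r ^+ (m + k.*2) * sig r ^+ m.+1) *
    ((k%:R + 2^-1) * (m.+1%:R + 2 * k%:R) - k%:R * (k%:R + m.+2%:R) * kap r ^+ 2)))
    - m.+1%:R * (Q k).[-1] * abel_bdry p).
  rewrite /abel_bdry -IntZl -?IntB; [|by Ctn..].
  apply: eq_Int => r rp; rewrite mulrCA mulrA -mulrA [X in _ * X]abel_lapl_monomial// /Q; ring.
congr (_ - _).
(* With n = m + 2, (k + 1/2) (m + k + 3/2) = k (k + n) + (2 n - 1) / 4: the constant splits off,
   leaving the left side of [wronskian]. *)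
transitivity (beta k * (Int 0 pi (fun r => p.[cos r] * (kap r ^+ (m + k.*2) * sig r ^+ m.+1) *
    ((k%:R + 2^-1) * (m.+1%:R + 2 * k%:R) - (k%:R + 2^-1) * (m%:R + k%:R + 3 / 2) * kap r ^+ 2))
  + Int 0 pi (fun r => (2 * n%:R - 1) / 4 * p.[cos r] * (kap r ^+ (m + k.*2) * sig r ^+ m.+1) * kap r ^+ 2))).
  rewrite -IntD -?IntZl; [|by Ctn..].
  apply: eq_Int => r rp; rewrite -!(natr1 m.+1) -!(natr1 m).
  by move: (_ ^+ (m + _)) (_ ^+ m.+1) => A B; field.
rewrite wronskian -IntD -?IntZl; [|by Ctn..].
apply: eq_Int => r rp.
have -> : abel (horner (Q k)) (cos r) = abel (fun y => (1 + y) ^+ k) (cos r).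
  by congr (abel _ _); apply/funext => y; rewrite /Q horner_exp hornerD hornerX hornerC.
rewrite abel_monomial_cos// -kap_sig [(kap r * sig r) ^+ _]exprMn exprD !exprS.
by move: (_ ^+ m) (_ ^+ m) (_ ^+ k.*2) => A B C; ring.
Qed.

End abel_lapl.

Section C2.
Context {R : realType}.

Lemma exists_antideriv (p : {poly R}) : exists q : {poly R}, q^`() = p.
Proof.
exists (\sum_(i < size p) (p`_i / i.+1%:R) *: 'X^(i.+1)).
rewrite linear_sum/= -[RHS]coefK poly_def; apply: eq_bigr => i _.
by rewrite derivZ derivXn -['X^_ *+ _]scaler_nat scalerA divfK// pnatr_eq0.
Qed.

Lemma antideriv_approx (h h1 : R -> R) (p : {poly R}) e : continuous h -> continuous h1 ->
  (forall y : R, - 1 < y < 1 -> is_derive y 1 h (h1 y)) ->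
  (forall y, - 1 <= y <= 1 -> `|h1 y - p.[y]| <= e) ->
  exists q : {poly R}, [/\ q^`() = p, q.[-1] = h (-1) &
    forall y, - 1 <= y <= 1 -> `|h y - q.[y]| <= 2 * e].
Proof.
move=> ch ch1 dh h1p; have [q0 q0p] := exists_antideriv p.
pose q := q0 + (h (-1) - q0.[-1])%:P.
have q1 : q.[-1] = h (-1) by rewrite /q hornerD hornerC addrC subrK.
have qp : q^`() = p by rewrite /q derivD derivC addr0.
exists q; split=> // y /andP[y1 y2].
have cp := @continuous_horner R p.
have -> : h y - q.[y] = Int (-1) y (fun x => h1 x - p.[x]).
  rewrite IntB//.
  have -> : Int (-1) y h1 = h y - h (-1).
    apply: FTC => //; last exact: continuous_subspaceT.
    by move=> x /andP[x1 x2]; apply: dh; rewrite x1 (lt_le_trans x2).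
  have -> : Int (-1) y (horner p) = q.[y] - q.[-1].
    by apply: FTCT => // x; rewrite -qp; exact: is_derive_poly.
  by rewrite q1; ring.
have e0 : 0 <= e by apply: le_trans (h1p 0 _); rewrite // oppr_le0 ler01.
have c : continuous (fun x => h1 x - p.[x]) by Ctn.
apply: le_trans (normr_Int_le y1 c _) _.
  by move=> x /andP[x1 x2]; apply: h1p; rewrite x1 (le_trans x2).
by rewrite mulrC ler_wpM2r//; lra.
Qed.

(** Approximate the second derivative and integrate twice from -1: each integration at most doubles
    the error, whence e / 4. The value at -1 is exact, as the antipodal term of [abel_lapl]
    requires. *)
Lemma C2_approx (h h1 h2 : R -> R) e : continuous h -> continuous h1 -> continuous h2 ->
  (forall y : R, - 1 < y < 1 -> is_derive y 1 h (h1 y)) ->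
  (forall y : R, - 1 < y < 1 -> is_derive y 1 h1 (h2 y)) -> 0 < e ->
  exists q : {poly R}, q.[-1] = h (-1) /\ forall y, - 1 <= y <= 1 ->
    [/\ `|h y - q.[y]| <= e, `|h1 y - q^`().[y]| <= e & `|h2 y - q^`()^`().[y]| <= e].
Proof.
move=> c0 c1 c2 d0 d1 e0; have e4 : 0 < e / 4 by rewrite divr_gt0.
have [q2 Q2] := weierstrass c2 e4.
have [q1 [E1 _ Q1]] := antideriv_approx c1 c2 d1 Q2.
have [q [E0 N0 Q0]] := antideriv_approx c0 c1 d0 Q1.
exists q; split => // y yi; rewrite E0 E1; split.
- by apply: le_trans (Q0 y yi) _; lra.
- by apply: le_trans (Q1 y yi) _; lra.
- by apply: le_trans (Q2 y yi) _; lra.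
Qed.

Lemma abel_le (f g : R -> R) x e : continuous f -> continuous g -> - 1 <= x <= 1 ->
  (forall y, - 1 <= y <= x -> `|f y - g y| <= e) -> `|abel f x - abel g x| <= 4 * e.
Proof.
move=> cf cg xi fg; rewrite /abel -mulrBr -IntB; [|by Ctn..].
have e0 : 0 <= e by apply: le_trans (fg (-1) _) => //; rewrite lexx; case/andP: xi.
have s2 : 0 <= Num.sqrt (1 + x) <= 2.
  rewrite sqrtr_ge0/= -[X in _ <= X]ger0_norm// -sqrtr_sqr ler_wsqrtr//.
  by case/andP: xi => ? ?; lra.
have c : continuous (fun u : R => f ((1 + x) * (1 - u ^+ 2) - 1) - g ((1 + x) * (1 - u ^+ 2) - 1)).
  by Ctn.
have b := normr_Int_le (M := e) ler01 c.
rewrite !normrM [`|2|]ger0_norm// [`|Num.sqrt _|]ger0_norm ?sqrtr_ge0//.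
have -> : 4 * e = 2 * 2 * (e * (1 - 0)) by ring.
case/andP: s2 => s1 s2; apply: ler_pM; rewrite ?mulr_ge0 ?ler_pM2l//.
by apply: b => u u01; apply/fg/abel_itv.
Qed.

Lemma Int_abel_le (f g w : R -> R) e M : continuous f -> continuous g -> continuous w ->
  (forall y, - 1 <= y <= 1 -> `|f y - g y| <= e) -> (forall r, 0 <= r <= pi -> `|w r| <= M) ->
  `|Int 0 pi (fun r => abel f (cos r) * w r) - Int 0 pi (fun r => abel g (cos r) * w r)|
    <= 4 * M * pi * e.
Proof.
move=> cf cg cw fg wM; have c1 := continuous_abel cf; have c2 := continuous_abel cg.
rewrite -IntB; [|by Ctn..].
have -> : 4 * M * pi * e = 4 * e * M * (pi - 0) by ring.
apply: normr_Int_le; [exact: pi_ge0|by Ctn|move=> r rp].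
rewrite -mulrBl normrM ler_pM ?wM// abel_le ?cos_geN1 ?cos_le1// => y /andP[y1 y2].
by apply: fg; rewrite y1 (le_trans y2)// cos_le1.
Qed.

(** Both sides depend continuously on h and its first two derivatives, so the polynomial identity
    passes to the limit along [C2_approx]. *)
Lemma abel_lapl_C2 m (h h1 h2 : R -> R) p :
  continuous h -> continuous h1 -> continuous h2 ->
  (forall y : R, - 1 < y < 1 -> is_derive y 1 h (h1 y)) ->
  (forall y : R, - 1 < y < 1 -> is_derive y 1 h1 (h2 y)) ->
  Int 0 pi (fun r => abel (fun y => (1 - y ^+ 2) * h2 y - m.+3%:R * y * h1 y) (cos r) *
     (p.[cos r] * sin r ^+ m.+1)) =
  Int 0 pi (fun r => abel h (cos r) *
    (((lapl m.+2 p).[cos r] + (2 * m.+2%:R - 1) / 4 * p.[cos r]) * sin r ^+ m.+1))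
  - m.+1%:R * h (-1) * abel_bdry m p.
Proof.
move=> c0 c1 c2 d0 d1; pose Lh y := (1 - y ^+ 2) * h2 y - m.+3%:R * y * h1 y.
have cL : continuous Lh by rewrite /Lh; Ctn.
pose w1 r := p.[cos r] * sin r ^+ m.+1.
pose w2 r := ((lapl m.+2 p).[cos r] + (2 * m.+2%:R - 1) / 4 * p.[cos r]) * sin r ^+ m.+1.
have cw1 : continuous w1 by rewrite /w1; Ctn.
have cw2 : continuous w2 by rewrite /w2; Ctn.
have [M1 M10 hM1] := @continuous_bounded _ 0 pi _ cw1.
have [M2 M20 hM2] := @continuous_bounded _ 0 pi _ cw2.
rewrite -/Lh -/w1 -/w2.
set I1 := Int _ _ _; set I2 := Int _ _ _; set b := _ * h _ * _.
apply/eqP; rewrite -subr_eq0 -normr_le0; apply/ler_addgt0Pr => e e0; rewrite add0r.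
pose K := 4 * M1 * pi * (m.+3%:R + 1) + 4 * M2 * pi.
have p0 := pi_ge0 R.
have K0 : 0 <= K by apply: addr_ge0; repeat apply: mulr_ge0 => //; exact: addr_ge0.
have d : 0 < e / (K + 1) by rewrite divr_gt0// ltr_pwDr.
have [q [q1 Q]] := C2_approx c0 c1 c2 d0 d1 d.
have := abel_lapl m q p; rewrite q1 -/b => E.
have cl := @continuous_horner R (lapl m.+3 q); have cq := @continuous_horner R q.
have H1 := @Int_abel_le Lh (horner (lapl m.+3 q)) w1 ((m.+3%:R + 1) * (e / (K + 1))) M1 cL cl cw1 _ hM1.
have H2 := @Int_abel_le h (horner q) w2 (e / (K + 1)) M2 c0 cq cw2 _ hM2.
have -> : I1 - (I2 - b) =
  (I1 - Int 0 pi (fun r => abel (horner (lapl m.+3 q)) (cos r) * w1 r)) -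
  (I2 - Int 0 pi (fun r => abel (horner q) (cos r) * w2 r)).
  by rewrite /w1 /w2 E; ring.
apply: (@le_trans _ _ (K * (e / (K + 1)))).
  apply: le_trans (ler_normB _ _) _; rewrite /K [leRHS]mulrDl; apply: lerD.
    rewrite -mulrA; apply: H1 => y yi; have [_ Q1 Q2] := Q y yi.
    rewrite laplE /Lh.
    have -> : (1 - y ^+ 2) * h2 y - m.+3%:R * y * h1 y - ((1 - y ^+ 2) * (q^`())^`().[y] -
        m.+3%:R * (y * q^`().[y])) =
      (1 - y ^+ 2) * (h2 y - q^`()^`().[y]) - m.+3%:R * y * (h1 y - q^`().[y]) by ring.
    apply: le_trans (ler_normB _ _) _; rewrite !normrM addrC [leRHS]mulrDl mul1r; apply: lerD.
      rewrite ler_pM ?mulr_ge0// normr_nat -[leRHS]mulr1 ler_wpM2l// ler_norml; exact: yi.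
    rewrite -[leRHS]mul1r ler_pM// ler_norml; have := sqr_ge0 y.
    have : y ^+ 2 <= 1 by rewrite -[y ^+ 2]real_normK ?num_real// expr_le1// ler_norml.
    lra.
  by apply: H2 => y yi; have [] := Q y yi.
rewrite mulrCA -[leRHS]mulr1 ler_pM2l// ler_pdivrMr ?mul1r ?ltr_pwDr//; lra.
Qed.

Lemma ctn_abel (T : topologicalType) (Q : T -> R -> R) (a : T -> R) (x0 : T) :
  (forall y, {for (x0, y), continuous (fun p : T * R => Q p.1 p.2)}) ->
  (\forall x \near x0, continuous (Q x)) ->
  {for x0, continuous a} ->
  {for x0, continuous (fun x => abel (Q x) (a x))}.
Proof.
move=> cQ cQx ca.
have c1 : {for x0, continuous (fun x => Int 0 1 (fun u => Q x ((1 + a x) * (1 - u ^+ 2) - 1)))}.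
  apply: (@continuous_Int _ _ (fun x (u : R) => Q x ((1 + a x) * (1 - u ^+ 2) - 1))) => //.
    move=> y _.
    have ca1 : {for (x0, y), continuous (fun p : T * R => a p.1)} by apply: (ctn_comp ca); ctn.
    have cz : {for (x0, y), continuous (fun p : T * R => (1 + a p.1) * (1 - p.2 ^+ 2) - 1)} by ctn.
    apply: (@ctn_comp (T * R)%type (T * R)%type R (fun p : T * R => Q p.1 p.2)
      (fun p : T * R => (p.1, (1 + a p.1) * (1 - p.2 ^+ 2) - 1)) (x0, y) (cQ _)).
    have c1 := @ctn_fst _ _ (x0, y); exact: (cvg_pair c1 cz).
  by near=> x; have cQ' : continuous (Q x) by [near: x]; Ctn.
rewrite /abel; ctn.
Unshelve. all: by end_near. Qed.

End C2.

Section abel_heat.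
Context {R : realType}.
Variable m : nat.
Local Notation n := m.+2.
Variables g g3 g5 : R -> R -> R.
Hypothesis gP : radial_kernel n.+1 g.
Hypothesis g3P : radial_kernel n.+3 g3.
Hypothesis g5P : radial_kernel n.+3.+2 g5.

Definition abel_mom s (q : R -> R) : R :=
  Int 0 pi (fun r => abel (g s) (cos r) * (q (cos r) * sin r ^+ m.+1)).

(** [ladder] expresses the first two x-derivatives of [g] through [g3] and [g5], which are
    continuous up to the poles, so [abel_lapl_C2] applies to [g s]. *)
Lemma dt_abel s p : 0 < s ->
  Int 0 pi (fun r => abel (dt g s) (cos r) * (p.[cos r] * sin r ^+ m.+1)) =
  Int 0 pi (fun r => abel (g s) (cos r) *
    (((lapl m.+2 p).[cos r] + (2 * m.+2%:R - 1) / 4 * p.[cos r]) * sin r ^+ m.+1))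
  - m.+1%:R * g s (-1) * abel_bdry m p.
Proof.
move=> s0.
have cg := rk_contr gP s0; have cg3 := rk_contr g3P s0; have cg5 := rk_contr g5P s0.
pose h1 y := 2 * pi * expR (- (n.+1%:R * s)) * g3 s y.
pose h2 y := 2 * pi * expR (- (n.+1%:R * s)) * (2 * pi * expR (- (n.+3%:R * s)) * g5 s y).
have c1 : continuous h1 by rewrite /h1; Ctn.
have c2 : continuous h2 by rewrite /h2; Ctn.
have e1 y : - 1 < y < 1 -> dx g s y = h1 y by move=> yi; rewrite (ladder _ gP g3P s0 yi).
have e2 y : - 1 < y < 1 -> dx g3 s y = 2 * pi * expR (- (n.+3%:R * s)) * g5 s y.
  by move=> yi; rewrite (ladder _ g3P g5P s0 yi).
have d0 (y : R) : - 1 < y < 1 -> is_derive y 1 (g s) (h1 y).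
  by move=> yi; rewrite -e1//; exact: (rk_dx gP).
have d1 (y : R) : - 1 < y < 1 -> is_derive y 1 h1 (h2 y).
  move=> yi; rewrite /h2 -(e2 y yi).
  have d : is_derive y 1 (g3 s) (dx g3 s y) by apply: (rk_dx g3P s0 yi).
  by apply: der_eq; [exact: derM (der_cst _ _) d|rewrite /=; ring].
rewrite -(abel_lapl_C2 _ _ cg c1 c2 d0 d1).
apply: eq_Int => r rp; congr (_ * _); apply: eq_abel; first by rewrite cos_geN1 cos_le1.
have cdt := rk_dt_contr gP s0.
move=> y /andP[y1 y2].
have cr : continuous (fun y : R => (1 - y ^+ 2) * h2 y - m.+3%:R * y * h1 y) by Ctn.
have lt11 : (-1 : R) < 1 by lra.
apply: (@closure_eq _ _ _ (-1) 1 lt11 cdt cr); last by rewrite y1 (le_trans y2)// cos_le1.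
move=> x xi; rewrite (rk_heat gP s0 xi) e1//; congr (_ * _ - _).
have dd : is_derive x 1 (dx g s) (h2 x).
  apply: is_derive_near (d1 _ xi); case/andP: xi => x1 x2; near=> z.
  by rewrite e1//; apply/andP; split; near: z; [exact: near_gt|exact: near_lt].
by rewrite /dxx; exact: derive_val.
Unshelve. all: by end_near. Qed.

(** A scalar linear equation: decay rate l shifted by (2 n - 1) / 4, with the value at the antipode
    as source. *)
Lemma abel_mom_derive (s : R) p (l : R) : 0 < s -> lapl n p = - l *: p ->
  is_derive s 1 (fun s => abel_mom s (horner p))
    (- (l - (2 * n%:R - 1) / 4) * abel_mom s (horner p) - m.+1%:R * g s (-1) * abel_bdry m p).
Proof.
move=> s0 lp; have cg := rk_contr gP s0; have cdt := rk_dt_contr gP s0.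
have near0 : \forall x \near s, 0 < x by exact: near_gt.
have -> : - (l - (2 * n%:R - 1) / 4) * abel_mom s (horner p) - m.+1%:R * g s (-1) * abel_bdry m p =
   Int 0 pi (fun r => abel (dt g s) (cos r) * (p.[cos r] * sin r ^+ m.+1)).
  rewrite dt_abel// /abel_mom -IntZl; last first.
    by have c := continuous_abel cg; Ctn.
  congr (_ - _); apply: eq_Int => r _; rewrite lp hornerZ; ring.
apply: (@is_derive_Int _ (fun s r => abel (g s) (cos r) * (p.[cos r] * sin r ^+ m.+1))
   (fun s r => abel (dt g s) (cos r) * (p.[cos r] * sin r ^+ m.+1))).
- exact: pi_ge0.
- near=> x => r rp; have x0 : 0 < x by near: x.
  have d : is_derive x 1 (fun x => Int 0 1 (fun u => g x ((1 + cos r) * (1 - u ^+ 2) - 1)))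
     (Int 0 1 (fun u => dt g x ((1 + cos r) * (1 - u ^+ 2) - 1))).
    have xn : \forall z \near x, 0 < z by exact: near_gt.
    have cdx := rk_dt_contr gP x0.
    apply: (@is_derive_Int _ (fun x (u : R) => g x ((1 + cos r) * (1 - u ^+ 2) - 1))
       (fun x (u : R) => dt g x ((1 + cos r) * (1 - u ^+ 2) - 1))) => //.
    + near=> z => y _; by apply: (rk_dt gP); near: z.
    + move=> y _.
      have ct z : {for (x, z), continuous (fun p : R * R => dt g p.1 p.2)} by exact: (rk_dt_cont gP x0).
      have cz : {for (x, y), continuous (fun p : R * R => (1 + cos r) * (1 - p.2 ^+ 2) - 1)} by ctn.
      apply: (@ctn_comp (R * R)%type (R * R)%type R (fun p : R * R => dt g p.1 p.2)
        (fun p : R * R => (p.1, (1 + cos r) * (1 - p.2 ^+ 2) - 1)) (x, y) (ct _)).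
      have c1 := @ctn_fst _ _ (x, y); exact: (cvg_pair c1 cz).
    + near=> z; have z0 : 0 < z by near: z.
      by have cz := rk_contr gP z0; Ctn.
    + by Ctn.
  rewrite /abel; apply: der_eq; first exact: derM (derM (der_cst _ _) d) (der_cst _ _).
  by rewrite /=; ring.
- move=> r _.
  have ct z : {for (s, z), continuous (fun p : R * R => dt g p.1 p.2)} by exact: (rk_dt_cont gP s0).
  have c1 : {for (s, r), continuous (fun p : R * R => abel (dt g p.1) (cos p.2))}.
    apply: (@ctn_abel _ _ (fun p : R * R => dt g p.1)); last by ctn.
      move=> y; have c1 : {for (s, r, y), continuous (fun p : (R * R) * R => p.1.1)}.
        exact: (@ctn_comp ((R * R) * R)%type (R * R)%type R fst fst (s, r, y) (@ctn_fst _ _ _) (@ctn_fst _ _ _)).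
      have c2 := @ctn_snd _ _ (s, r, y).
      exact: (@ctn_comp2 ((R * R) * R)%type R R R (dt g) (fun p => p.1.1) snd (s, r, y) (ct y) c1 c2).
    have : \forall x \near (s, r), 0 < x.1 by exact: (cvg_fst (near_gt s0)).
    by apply: filterS => -[x y] /= x0; exact: rk_dt_contr gP x0.
  by ctn.
- near=> x; have x0 : 0 < x by near: x.
  have c := continuous_abel (rk_contr gP x0); by Ctn.
- by have c := continuous_abel cdt; clear cdt cg; move: c; move: (abel _) => A c; Ctn.
Unshelve. all: by end_near. Qed.

End abel_heat.

(** * Concentration at the pole *)

Section half_angle_integrals.
Context {R : realType}.
Implicit Types (a b k m : nat).

(** Beta integrals in the half-angle variables; integration by parts and sig^2 + kap^2 = 2 shift
    either exponent by 2, down to the base cases b = 0 and b = 1. *)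
Definition Int_sk a b : R := Int 0 pi (fun r => sig r ^+ a * kap r ^+ b).

Let cK := @continuous_kap R.
Let cS := @continuous_sig R.

Lemma Int_sk_parts a b : a.+1%:R * Int_sk a b.+2 = b.+1%:R * Int_sk a.+2 b.
Proof.
have c1 := cK; have c2 := cS.
apply/eqP; rewrite -subr_eq0 -!IntZl -?IntB; [|by Ctn..]; apply/eqP.
pose F r : R := 2 * (sig r ^+ a.+1 * kap r ^+ b.+1).
transitivity (F pi - F 0); last by rewrite /F kap_pi sig_0 !expr0n/= !mul0r !mulr0 subrr.
apply: FTCT; [exact: pi_ge0|by Ctn|move=> r].
have d1 := der_kap r; have d2 := der_sig r.
rewrite /F; apply: der_eq; first by der.
by rewrite /= !exprS; move: (sig r ^+ a) (kap r ^+ b) => A B; field.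
Qed.

Lemma Int_sk_add a b : Int_sk a.+2 b + Int_sk a b.+2 = 2 * Int_sk a b.
Proof.
have c1 := cK; have c2 := cS.
rewrite -IntZl -?IntD; [|by Ctn..]; apply: eq_Int => r _.
have : sig r ^+ 2 + kap r ^+ 2 = 2 by rewrite kap2 sig2; ring.
by move=> <-; rewrite !exprS; move: (sig r ^+ a) (kap r ^+ b) => A B; ring.
Qed.

Lemma Int_skr a b : (a%:R + b%:R + 2) * Int_sk a b.+2 = 2 * b.+1%:R * Int_sk a b.
Proof.
have := Int_sk_parts a b; have := Int_sk_add a b; rewrite -!natr1.
by move: (Int_sk _ _) (Int_sk _ _) (Int_sk _ _) => x y z H1 H2; rewrite mulrAC -H1; nra.
Qed.

Lemma Int_skl a b : (a%:R + b%:R + 2) * Int_sk a.+2 b = 2 * a.+1%:R * Int_sk a b.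
Proof.
have := Int_sk_parts a b; have := Int_sk_add a b; rewrite -!natr1.
by move: (Int_sk _ _) (Int_sk _ _) (Int_sk _ _) => x y z H1 H2; rewrite mulrAC -H1; nra.
Qed.

Lemma Int_sk0 a : Int_sk a 0 = Num.sqrt 2 ^+ a * Int 0 pi (fun r => sin r ^+ a).
Proof.
have c2 := cS; have c1 := cK; have q2 : Num.sqrt 2 ^+ 2 = 2 :> R by rewrite sqr_sqrtr.
have [i0 i1] := @Int_sin01 R.
suff : Int_sk a 0 = Num.sqrt 2 ^+ a * Int 0 pi (fun r => sin r ^+ a) /\
   Int_sk a.+1 0 = Num.sqrt 2 ^+ a.+1 * Int 0 pi (fun r => sin r ^+ a.+1) by case.
elim: a => [|a [IH1 IH2]].
  split; first by rewrite expr0 mul1r; apply: eq_Int => r _; rewrite !expr0 mulr1.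
  rewrite i1 expr1.
  pose F r : R := - 2 * kap r.
  have -> : Num.sqrt 2 * 2 = F pi - F 0 :> R by rewrite /F kap_pi kap_0; ring.
  apply: FTCT; [exact: pi_ge0|by Ctn|move=> r]; have d1 := der_kap r.
  by rewrite /F; apply: der_eq; [der|rewrite /=; field].
split => //.
have a0 : a%:R + 0%:R + 2 != 0 :> R by rewrite addr0 gt_eqF// ltr_wpDl.
apply: (mulfI a0); rewrite Int_skl IH1 Int_sin_rec !exprS.
have a1 : a.+2%:R != 0 :> R by rewrite pnatr_eq0.
have -> : a%:R + 0%:R + 2 = a.+2%:R :> R by rewrite -!natr1; ring.
have -> : 2 * a.+1%:R * (Num.sqrt 2 ^+ a * Int 0 pi (fun r => sin r ^+ a)) =
  Num.sqrt 2 ^+ 2 * a.+1%:R * (Num.sqrt 2 ^+ a * Int 0 pi (fun r : R => sin r ^+ a)) by rewrite q2.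
by field.
Qed.

Lemma Int_sk1 a : Int_sk a 1 = 2 / a.+1%:R * Num.sqrt 2 ^+ a.+1.
Proof.
have c2 := cS; have c1 := cK; have a1 : a.+1%:R != 0 :> R by rewrite pnatr_eq0.
pose F r : R := 2 / a.+1%:R * sig r ^+ a.+1.
transitivity (F pi - F 0); last by rewrite /F sig_pi sig_0 expr0n/= mulr0 subr0.
apply: FTCT; [exact: pi_ge0|by Ctn|move=> r]; have d1 := der_sig r.
rewrite /F; apply: der_eq; first by der.
by rewrite /=; field.
Qed.

(** Both sides satisfy the same first-order recurrence in k. *)
Lemma beta_Int_sk m k :
  beta k * Int_sk m.+1 k.*2.+2 = Int 0 pi (fun r : R => sin r ^+ m.+1) * Int_sk m.+2 k.*2.+1.
Proof.
have q2 : Num.sqrt 2 ^+ 2 = 2 :> R by rewrite sqr_sqrtr.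
elim: k => [|k IH].
  rewrite beta0 Int_sk1.
  have := Int_skr m.+1 0; rewrite Int_sk0 addr0 mulr1 => E.
  have m3 : m.+1%:R + 2 != 0 :> R by rewrite gt_eqF// ltr_wpDl.
  apply: (mulfI m3); rewrite mulrCA E !exprS.
  have -> : m.+3%:R = m.+1%:R + 2 :> R by rewrite -!natr1; ring.
  have -> : (m.+1%:R + 2) * (Int 0 pi (fun r : R => sin r ^+ m.+1) * (2 / (m.+1%:R + 2) *
    (Num.sqrt 2 * (Num.sqrt 2 * (Num.sqrt 2 * Num.sqrt 2 ^+ m))))) =
    2 * Num.sqrt 2 ^+ 2 * (Num.sqrt 2 * Num.sqrt 2 ^+ m) * Int 0 pi (fun r : R => sin r ^+ m.+1).
    by field.
  by rewrite q2 ; ring.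
have E1 := Int_skr m.+1 k.*2.+2; have E2 := Int_skr m.+2 k.*2.+1.
have E3 := betaS (R := R) k.
have p1 : 0 < 2 * k%:R + 3 :> R by rewrite ltr_wpDl// mulr_ge0.
have p2 : 0 < m.+1%:R + k.*2.+2%:R + 2 :> R by rewrite ltr_wpDl// addr_ge0.
rewrite doubleS.
apply: (mulfI (lt0r_neq0 p1)); apply: (mulfI (lt0r_neq0 p2)).
have -> : (m.+1%:R + k.*2.+2%:R + 2) * ((2 * k%:R + 3) * (beta k.+1 * Int_sk m.+1 k.*2.+4)) =
  ((2 * k%:R + 3) * beta k.+1) * ((m.+1%:R + k.*2.+2%:R + 2) * Int_sk m.+1 k.*2.+4) by ring.
rewrite E1 E3.
have -> : (2 * k%:R + 2) * beta k * (2 * k.*2.+3%:R * Int_sk m.+1 k.*2.+2) =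
   (2 * k%:R + 2) * (2 * k.*2.+3%:R) * (beta k * Int_sk m.+1 k.*2.+2) by ring.
rewrite IH.
have -> : m.+1%:R + k.*2.+2%:R + 2 = m.+2%:R + k.*2.+1%:R + 2 :> R by rewrite -!natr1; ring.
have -> : (m.+2%:R + k.*2.+1%:R + 2) * ((2 * k%:R + 3) * (Int 0 pi (fun r : R => sin r ^+ m.+1) *
   Int_sk m.+2 k.*2.+3)) =
  (2 * k%:R + 3) * Int 0 pi (fun r : R => sin r ^+ m.+1) *
     ((m.+2%:R + k.*2.+1%:R + 2) * Int_sk m.+2 k.*2.+3) by ring.
rewrite E2 -!(natr1 k.*2.+2) -!(natr1 k.*2.+1) -!(natr1 k.*2) -muln2 natrM.
ring.
Qed.

(** After exchanging the integrals, with y = cos r, the weight [sig r ^+ m.+1 * kap r] produces a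
    Beta integral homogeneous in 1 - cos rho, whence a closed form. Instead of a planar change of
    variables, this is checked on powers of 1 + x. *)
Lemma Int_abel_mass_poly m (p : {poly R}) :
  Int 0 pi (fun r => abel (horner p) (cos r) * (sig r ^+ m.+1 * kap r)) =
  Int 0 pi (fun r : R => sin r ^+ m.+1) * Int 0 pi (fun r => p.[cos r] * (sig r ^+ m.+2 * kap r)).
Proof.
have c2 := cS; have c1 := cK.
pose Q k : {poly R} := (1 + 'X) ^+ k.
have bas k : size (Q k) = k.+1 /\ Q k \is monic.
  by rewrite /Q -[1 + _]addrC -[1]opprK -polyCN; split; [rewrite size_exp_XsubC|rewrite monic_exp// monicXsubC].
have [a ->] := @monic_basis _ Q (size p) p (fun i _ => bas i) (leqnn _).
have cw : continuous (fun r : R => sig r ^+ m.+1 * kap r) by Ctn.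
rewrite (@Int_abel_sum _ _ _ _ _ (fun r => sig r ^+ m.+1 * kap r) cw).
have -> : Int 0 pi (fun r => (\sum_(i < size p) a i *: Q i).[cos r] * (sig r ^+ m.+2 * kap r)) =
  \sum_(i < size p) a i * Int_sk m.+2 i.*2.+1.
  elim: (size p) => [|N IH].
    rewrite [RHS]big_ord0; under [LHS]eq_Int do rewrite big_ord0 horner0 mul0r.
    by rewrite Int0.
  rewrite [RHS]big_ord_recr/= -IH -IntZl -?IntD; [|by Ctn..].
  apply: eq_Int => r _; rewrite big_ord_recr/= hornerD hornerZ mulrDl; congr (_ + _).
  rewrite /Q horner_exp hornerD hornerX hornerC -kap2 -exprM mul2n !exprS.
  by move: (sig r ^+ m) (kap r ^+ _) => A B; ring.
rewrite mulr_sumr; apply: eq_bigr => k _; rewrite mulrCA; congr (_ * _).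
rewrite -beta_Int_sk /Int_sk -IntZl; last by Ctn.
apply: eq_Int => r rp.
have -> : abel (horner (Q k)) (cos r) = abel (fun y => (1 + y) ^+ k) (cos r).
  by congr (abel _ _); apply/funext => y; rewrite /Q horner_exp hornerD hornerX hornerC.
by rewrite abel_monomial_cos// !exprS; move: (sig r ^+ m) (kap r ^+ _) => A B; ring.
Qed.

Lemma Int_abel_mass m (h : R -> R) : continuous h ->
  Int 0 pi (fun r => abel h (cos r) * (sig r ^+ m.+1 * kap r)) =
  Int 0 pi (fun r : R => sin r ^+ m.+1) * Int 0 pi (fun r => h (cos r) * (sig r ^+ m.+2 * kap r)).
Proof.
move=> ch; have c2 := cS; have c1 := cK.
have cw1 : continuous (fun r : R => sig r ^+ m.+1 * kap r) by Ctn.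
have cw2 : continuous (fun r : R => sig r ^+ m.+2 * kap r) by Ctn.
have [M1 M10 hM1] := @continuous_bounded _ 0 pi _ cw1.
have [M2 M20 hM2] := @continuous_bounded _ 0 pi _ cw2.
set S := Int 0 pi (fun r : R => sin r ^+ m.+1).
apply/eqP; rewrite -subr_eq0; apply/eqP.
apply: (@eq0_functional _ (fun h => Int 0 pi (fun r => abel h (cos r) * (sig r ^+ m.+1 * kap r)) -
  S * Int 0 pi (fun r => h (cos r) * (sig r ^+ m.+2 * kap r))) (4 * M1 * pi + `|S| * (M2 * pi))) => //.
  move=> f f' e cf cf' fe.
  have -> (x y z w : R) : x - S * y - (z - S * w) = (x - z) - S * (y - w) by ring.
  apply: le_trans (ler_normB _ _) _; rewrite [leRHS]mulrDl; apply: lerD.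
    exact: Int_abel_le cf cf' cw1 fe hM1.
  rewrite normrM -mulrA ler_wpM2l// -IntB; [|by Ctn..].
  have -> : M2 * pi * e = e * M2 * (pi - 0) by ring.
  apply: normr_Int_le; [exact: pi_ge0|by Ctn|move=> r rp].
  by rewrite -mulrBl normrM ler_pM ?hM2// fe// cos_geN1 cos_le1.
by move=> p; rewrite Int_abel_mass_poly subrr.
Qed.

End half_angle_integrals.

Section concentration.
Context {R : realType}.

(** A nonnegative family of mass tending to M that is uniformly small away from 0 converges to M
    times the Dirac mass at 0, even against test functions moving with s. *)
Lemma cvg_concentration (psi h : R -> R -> R) (h0 : R -> R) (M : R) :
  (\forall s \near 0^'+, continuous (psi s)) ->
  (\forall s \near 0^'+, forall r, 0 <= r <= pi -> 0 <= psi s r) ->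
  (forall d e, 0 < d -> d <= pi -> 0 < e ->
     \forall s \near 0^'+, forall r, d <= r <= pi -> psi s r <= e) ->
  Int 0 pi (psi s) @[s --> 0^'+] --> M ->
  (\forall s \near 0^'+, continuous (h s)) -> continuous h0 ->
  (forall e, 0 < e -> \forall s \near 0^'+, forall r, 0 <= r <= pi -> `|h s r - h0 r| <= e) ->
  Int 0 pi (fun r => psi s r * h s r) @[s --> 0^'+] --> M * h0 0.
Proof.
move=> cpsi psi0 small mass ch ch0 hh.
have p0 := pi_gt0 R.
have [B B0 hB] := @continuous_bounded _ 0 pi _ ch0.
have lim1 : Int 0 pi (psi s) * h0 0 @[s --> 0^'+] --> M * h0 0.
  by apply: cvgM mass _; exact: cvg_cst.
apply: (cvg_sub0 _ lim1); apply/cvgrPdist_le => e e0.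
pose K := `|M| + 1; have K0 : 0 < K by rewrite ltr_wpDl.
pose e1 := e / (4 * K); have e10 : 0 < e1 by rewrite divr_gt0// mulr_gt0.
have C0 : 0 < 2 * B + e1 + 1 by move: (e1) e10 => x x0; lra.
have BB : 0 <= 2 * B + e1 by move: (e1) e10 => x x0; lra.
pose e2 := e / (2 * pi * (2 * B + e1 + 1)).
have e20 : 0 < e2 by rewrite divr_gt0// !mulr_gt0.
have /cvgrPdist_le/(_ _ e10) := ch0 0; rewrite near_nbhs => /nbhs_ballP[d /= d0 hd].
pose d' := Num.min (d / 2) pi.
have d'0 : 0 < d' by rewrite lt_min p0 divr_gt0.
have d'p : d' <= pi by rewrite ge_min lexx orbT.
have hd' r : 0 <= r -> r < d' -> `|h0 0 - h0 r| <= e1.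
  move=> r0 rd; apply: hd; rewrite /ball/= sub0r normrN ger0_norm//.
  by move: rd; rewrite lt_min => /andP[rd _]; apply: lt_trans rd _; lra.
near=> s.
have cps : continuous (psi s) by near: s.
have chs : continuous (h s) by near: s.
have P0 r : 0 <= r <= pi -> 0 <= psi s r by move: r; near: s.
have Ps r : d' <= r <= pi -> psi s r <= e2 by move: r; near: s; exact: small.
have Hs r : 0 <= r <= pi -> `|h s r - h0 r| <= e1 by move: r; near: s; exact: hh.
have mK : Int 0 pi (psi s) <= K.
  have : `|M - Int 0 pi (psi s)| <= 1 by near: s; exact: cvgr_dist_le mass _ ltr01.
  by rewrite /K ler_norml; have := ler_norm M; lra.
have h00 : `|h0 0| <= B by apply: hB; rewrite lexx ltW.
rewrite sub0r normrN /=.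
have -> : ((fun s => Int 0 pi (fun r => psi s r * h s r)) -
   (fun s => Int 0 pi (psi s) * h0 0)) s = Int 0 pi (fun r => psi s r * (h s r - h0 0)).
  rewrite [LHS]/GRing.add /= /GRing.opp /= -IntZr// -IntB; [|by Ctn..].
  by apply: eq_Int => r _; rewrite mulrBr.
pose G r := 2 * e1 * psi s r + e2 * (2 * B + e1).
have cG : continuous G by rewrite /G; Ctn.
have cF : continuous (fun r => psi s r * (h s r - h0 0)) by Ctn.
have FG r : 0 <= r <= pi -> `|psi s r * (h s r - h0 0)| <= G r.
  move=> rp; rewrite normrM ger0_norm ?P0//; have := P0 r rp; have := Hs r rp; have := hB r rp.
  rewrite /G => b1 b2 b3.
  have b4 : `|h s r - h0 0| <= `|h s r - h0 r| + `|h0 0 - h0 r| by rewrite (distrC (h0 0)) ler_distD.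
  have b5 : `|h0 0 - h0 r| <= `|h0 0| + `|h0 r| := ler_normB _ _.
  have [rd|dr] := ltP r d'.
    have /andP[r0 _] := rp; have b6 := hd' r r0 rd.
    apply: (@le_trans _ _ (psi s r * (2 * e1))); first by rewrite ler_wpM2l//; lra.
    by rewrite mulrC lerDl mulr_ge0// ltW.
  have /andP[_ rp'] := rp; have b6 := Ps r; rewrite dr rp' in b6.
  apply: (@le_trans _ _ (e2 * (2 * B + e1))); last by rewrite lerDr; exact: mulr_ge0 (mulr_ge0 (ler0n _ 2) (ltW e10)) b3.
  by rewrite ler_pM ?b6//; lra.
have IG : Int 0 pi G = 2 * e1 * Int 0 pi (psi s) + e2 * (2 * B + e1) * pi.
  rewrite IntD; [|by Ctn..].
  by rewrite IntZl// Int_cst ?subr0// ltW.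
apply: (@le_trans _ _ (Int 0 pi G)).
  rewrite ler_norml -mulN1r -IntZl//; apply/andP; split.
    have cNG : continuous (fun x => -1 * G x) by Ctn.
    by apply: (le_Int cNG cF) => r /FG; rewrite mulN1r ler_norml => /andP[].
  by apply: (le_Int cF cG) => r /FG; rewrite ler_norml => /andP[].
rewrite IG.
have E1 : 2 * e1 * Int 0 pi (psi s) <= e / 2.
  have -> : e / 2 = 2 * e1 * K by rewrite /e1; field; rewrite gt_eqF.
  by rewrite ler_wpM2l// mulr_ge0// ltW.
have E2 : e2 * (2 * B + e1) * pi <= e / 2.
  have -> : e / 2 = e2 * (2 * B + e1 + 1) * pi.
    by rewrite /e2; move: (pi : R) p0 (2 * B + e1 + 1) C0 => P p0' C C0'; field; rewrite !gt_eqF.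
  by rewrite ler_wpM2r ?(ltW p0)// ler_wpM2l ?(ltW e20)//; lra.
lra.
Unshelve. all: by end_near. Qed.

End concentration.

Section abel_init.
Context {R : realType}.
Variable m : nat.
Variables g g3 : R -> R -> R.
Hypothesis gP : radial_kernel m.+3 g.
Hypothesis g3P : radial_kernel m.+3.+2 g3.

Lemma cvg_mass_w :
  Int 0 pi (fun r => g s (cos r) * (sig r ^+ m.+2 * kap r)) @[s --> 0^'+] -->
  (Num.sqrt 2 ^+ m.+1 * sphere_vol m.+2)^-1.
Proof.
have p0 := pi_gt0 R; have cK := @continuous_kap R; have cS := @continuous_sig R.
(* [q (cos r)] is kap^-(m+1) where kap >= 1, that is for r <= pi / 2, and there
   [q (cos r) * sin r ^+ m.+2] is the desired weight. The cutoff at 1 keeps [q] continuous at the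
   antipode; the other hemisphere is negligible by [rk_decay] at x = 0 and monotonicity. *)
pose q (x : R) := (Num.max 1 (Num.sqrt (1 + x)) ^+ m.+1)^-1.
have q0 (x : R) : Num.max 1 (Num.sqrt (1 + x)) ^+ m.+1 != 0.
  by rewrite expf_eq0/= gt_eqF// lt_max ltr01.
have cq : continuous q.
  move=> x; apply: (@ctn_comp _ _ _ (fun y : R => y^-1) (fun x : R => Num.max 1 (Num.sqrt (1 + x)) ^+ m.+1)); last by ctn.
  exact: inv_continuous.
have sq2 : 1 <= Num.sqrt 2 :> R by rewrite -[leLHS]sqrtr1 ler_wsqrtr// ler1n.
have := rk_init gP cq.
have -> : q 1 / sphere_vol m.+3.-1 = (Num.sqrt 2 ^+ m.+1 * sphere_vol m.+2)^-1.
  by rewrite /q (_ : 1 + 1 = 2 :> R)// max_r// [RHS]invfM.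
move=> init; apply: (cvg_sub0 _ init); apply/cvgrPdist_le => e e0.
pose w (r : R) := sig r ^+ m.+2 * kap r - q (cos r) * sin r ^+ m.+2.
have cw : continuous w by rewrite /w; Ctn.
have [B B0 hB] := @continuous_bounded _ 0 pi _ cw.
have C0 : 0 < (B + 1) * pi by rewrite mulr_gt0// ltr_wpDl.
have e2 : 0 < e / ((B + 1) * pi) by rewrite divr_gt0.
have dec := rk_decay (isT : (0 < m.+3)%N) gP g3P (x := 0).
have /cvgrPdist_le/(_ _ e2) {}dec := dec ltac:(by rewrite oppr_le0 ler01 ltr01).
near=> s.
have s0 : 0 < s by near: s; exact: nbhs_right_gt.
have cg := rk_contr gP s0.
have gs : `|0 - g s 0| <= e / ((B + 1) * pi) by near: s.
rewrite sub0r normrN /=.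
have -> : ((fun s => Int 0 pi (fun r => g s (cos r) * (sig r ^+ m.+2 * kap r))) -
   (fun s => Int 0 pi (fun r => g s (cos r) * q (cos r) * sin r ^+ m.+3.-1))) s =
   Int 0 pi (fun r => g s (cos r) * w r).
  rewrite [LHS]/GRing.add /= /GRing.opp /= -IntB; [|by Ctn..].
  by apply: eq_Int => r _; rewrite /w mulrBr !mulrA.
have -> : e = e / ((B + 1) * pi) * (B + 1) * (pi - 0).
  by move: (pi : R) p0 (B + 1) C0 => P p0' B' C0'; field; apply/andP; split; apply: contraTneq C0' => ->; rewrite ?mul0r ?mulr0 ltxx.
apply: normr_Int_le; [exact: ltW|by Ctn|move=> r rp].
have ge0 y : -1 <= y <= 1 -> 0 <= g s y by apply: rk_ge0 gP s0.
have ci : -1 <= cos r <= 1 by rewrite cos_geN1 cos_le1.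
have k0 := kap_ge0 rp.
have [k1|k1] := leP 1 (kap r).
  have -> : w r = 0.
    rewrite /w /q sqrt_kap// max_r// -kap_sig [(kap r * sig r) ^+ _]exprMn.
    have kn : kap r ^+ m.+1 != 0 by rewrite expf_eq0/= gt_eqF// (lt_le_trans ltr01).
    by rewrite [kap r ^+ m.+2]exprS; field.
  by rewrite mulr0 normr0 mulr_ge0 ?(ltW e2)// addr_ge0.
rewrite normrM ler_pM//; last by apply: le_trans (hB r rp) _; lra.
rewrite ger0_norm ?ge0//; apply: le_trans gs; rewrite sub0r normrN ger0_norm; last first.
  by apply: ge0; rewrite oppr_le0 ler01.
apply: (rk_nondecreasing _ gP g3P s0) => //; first by case/andP: ci.
have : kap r ^+ 2 < 1 by rewrite expr_lt1.
by rewrite kap2; lra.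
Unshelve. all: by end_near. Qed.

(** The transform at cos r involves [g] only at distances at least r, where monotonicity bounds it
    by its value at distance d. *)
Lemma abel_small d e : 0 < d -> d <= pi -> 0 < e ->
  \forall s \near 0^'+, forall r, d <= r <= pi -> abel (g s) (cos r) * (sig r ^+ m.+1 * kap r) <= e.
Proof.
move=> d0 dp e0; have p0 := pi_gt0 R; have cK := @continuous_kap R; have cS := @continuous_sig R.
have cw : continuous (fun r : R => sig r ^+ m.+1 * kap r) by Ctn.
have [B B0 hB] := @continuous_bounded _ 0 pi _ cw.
have e2 : 0 < e / (4 * (B + 1)) by rewrite divr_gt0// mulr_gt0// ltr_wpDl.
have cd : -1 <= cos d < 1.
  rewrite cos_geN1/= -cos0 ltr_cos// in_itv/= ?lexx ?(ltW p0)//.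
  by rewrite (ltW d0).
have /cvgrPdist_le/(_ _ e2) dec := rk_decay (isT : (0 < m.+3)%N) gP g3P cd.
near=> s.
have s0 : 0 < s by near: s; exact: nbhs_right_gt.
have gs : `|0 - g s (cos d)| <= e / (4 * (B + 1)) by near: s.
have cg := rk_contr gP s0.
have ge0 y : -1 <= y <= 1 -> 0 <= g s y by apply: rk_ge0 gP s0.
have cdi : -1 <= cos d <= 1 by rewrite cos_geN1 cos_le1.
move=> r /andP[dr rp]; have rpi : 0 <= r <= pi by rewrite rp (le_trans (ltW d0)).
have ci : -1 <= cos r <= 1 by rewrite cos_geN1 cos_le1.
rewrite (le_trans (ler_norm _))// normrM.
have -> : e = (4 * (e / (4 * (B + 1)))) * (B + 1) by field; rewrite gt_eqF// ltr_wpDl.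
rewrite ler_pM//; last by apply: le_trans (hB r rpi) _; lra.
have z0 : abel (fun=> 0) (cos r) = 0 :> R by rewrite /abel Int0 mulr0.
rewrite -[abel _ _]subr0 -[in X in `|_ - X|]z0; apply: abel_le => //; first exact: cst_continuous.
move=> y /andP[y1 y2]; apply: le_trans gs; rewrite sub0r subr0 normrN !ger0_norm ?ge0//.
  apply: (rk_nondecreasing _ gP g3P s0) => //; rewrite ?cos_le1//.
  apply: le_trans y2 _; move: dr; rewrite le_eqVlt => /predU1P[->//|dr].
  by rewrite ltW// ltr_cos// in_itv/= ?(ltW d0).
by rewrite y1 (le_trans y2)// cos_le1.
Unshelve. all: by end_near. Qed.

Lemma abel_init (h : R -> R -> R) (h0 : R -> R) :
  (\forall s \near 0^'+, continuous (h s)) -> continuous h0 ->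
  (forall e, 0 < e -> \forall s \near 0^'+, forall r, 0 <= r <= pi -> `|h s r - h0 r| <= e) ->
  Int 0 pi (fun r => abel (g s) (cos r) * (h s r * sin r ^+ m.+1)) @[s --> 0^'+] -->
  h0 0 / (Num.sqrt 2 * sphere_vol m.+1).
Proof.
move=> ch ch0 hh; have cK := @continuous_kap R; have cS := @continuous_sig R.
have p0 := pi_gt0 R.
(* sin^(m+1) = sig^(m+1) kap kap^m: the first two factors form the weight whose mass [Int_abel_mass]
   computes, and kap^m joins the test function, contributing sqrt(2)^m at r = 0. *)
pose psi s r := abel (g s) (cos r) * (sig r ^+ m.+1 * kap r).
pose S := Int 0 pi (fun r : R => sin r ^+ m.+1).
have nr : \forall s \near (0 : R)^'+, 0 < s by exact: nbhs_right_gt.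
have ck : continuous (fun r : R => kap r ^+ m) by Ctn.
have [B B0 hB] := @continuous_bounded _ 0 pi _ ck.
have := @cvg_concentration R psi (fun s r => kap r ^+ m * h s r) (fun r => kap r ^+ m * h0 r)
  (S * (Num.sqrt 2 ^+ m.+1 * sphere_vol m.+2)^-1).
have -> : S * (Num.sqrt 2 ^+ m.+1 * sphere_vol m.+2)^-1 * (kap 0 ^+ m * h0 0) =
   h0 0 / (Num.sqrt 2 * sphere_vol m.+1).
  have S0 : 0 < S by exact: Int_sin_gt0.
  have v0 := sphere_vol_gt0 (R := R) m.+1.
  have q0 : 0 < Num.sqrt 2 :> R by rewrite sqrtr_gt0.
  have q1 : Num.sqrt 2 ^+ m != 0 :> R by rewrite expf_eq0 gt_eqF// andbF.
  have -> : sphere_vol m.+2 = sphere_vol m.+1 * S by [].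
  rewrite kap_0 exprS; move: (sphere_vol _) v0 S S0 (Num.sqrt 2) q0 q1 => v v0 {}S S0 q q0 q1.
  by field; rewrite q1 !gt_eqF.
have -> : (fun s => Int 0 pi (fun r => psi s r * (kap r ^+ m * h s r))) =
  (fun s => Int 0 pi (fun r => abel (g s) (cos r) * (h s r * sin r ^+ m.+1))).
  apply/funext => s; apply: eq_Int => r _; rewrite /psi -kap_sig [(kap r * sig r) ^+ _]exprMn !exprS.
  by move: (abel _ _) (_ ^+ m) (_ ^+ m) => a b c; ring.
apply.
- apply: filterS nr => s s0; have c := continuous_abel (rk_contr gP s0).
  by rewrite /psi; move: c; move: (abel _) => A c; Ctn.
- apply: filterS nr => s s0 r rp; rewrite /psi; apply: mulr_ge0; last first.
    exact: mulr_ge0 (exprn_ge0 _ (sig_ge0 rp)) (kap_ge0 rp).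
  rewrite !mulr_ge0 ?sqrtr_ge0//.
  apply: Int_ge0 => u u01; apply: (rk_ge0 _ gP s0) => //.
  have ci : -1 <= cos r <= 1 by rewrite cos_geN1 cos_le1.
  by have /andP[-> /le_trans->] := abel_itv ci u01; rewrite ?cos_le1.
- exact: abel_small.
- apply: (@cvg_trans _ ((fun s => S * Int 0 pi (fun r => g s (cos r) * (sig r ^+ m.+2 * kap r))) @ 0^'+)).
    by apply: near_eq_cvg; apply: filterS nr => s s0; rewrite /psi Int_abel_mass//; exact: rk_contr gP s0.
  by apply: cvgM cvg_mass_w; exact: cvg_cst.
- by apply: filterS ch => s chs; Ctn.
- by Ctn.
- move=> e e0; have e1 : 0 < e / (B + 1) by rewrite divr_gt0// ltr_wpDl.
  apply: filterS (hh _ e1) => s hs r rp; rewrite -mulrBr normrM.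
  have -> : e = (B + 1) * (e / (B + 1)) by field; rewrite gt_eqF// ltr_wpDl.
  by rewrite ler_pM// ?hs//; apply: le_trans (hB r rp) _; lra.
Qed.

End abel_init.

(** * The convolved Abel transform *)

Section zonal_moments.
Context {R : realType}.
Variable m : nat.
Local Notation n := m.+2.

Lemma ctn_zavg2 (Q : R -> R) (x : R * R) : continuous Q ->
  {for x, continuous (fun p : R * R => zavg m Q p.1 p.2)}.
Proof.
move=> cQ; apply: (@ctn_zavg _ _ _ (fun=> Q) fst snd).
- by move=> y; apply: (ctn_comp (cQ _)); ctn.
- by near=> y.
- exact: ctn_fst.
- exact: ctn_snd.
Unshelve. all: by end_near. Qed.

(** Convolution with a zonal function is symmetric: Fubini together with [zavgC]. *)
Lemma zavg_int_swap (Q u w : R -> R) : continuous Q -> continuous u -> continuous w ->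
  Int 0 pi (fun r => Int 0 pi (fun rho => u rho * zavg m Q rho r) * (w (cos r) * sin r ^+ m.+1)) =
  Int 0 pi (fun rho => u rho * zconv m Q w rho).
Proof.
move=> cQ cu cw.
have cz x : {for x, continuous (fun p : R * R => zavg m Q p.1 p.2)} by exact: ctn_zavg2.
have c1 r : continuous (zavg m Q ^~ r) by exact: continuous_zavg.
have c2 r : continuous (zavg m Q r).
  by move=> x; apply: (@continuous_sectionr _ (zavg m Q) r x); exact: cz.
transitivity (Int 0 pi (fun r => Int 0 pi (fun rho => u rho * zavg m Q rho r * (w (cos r) * sin r ^+ m.+1)))).
  by apply: eq_Int => r _; have c := c1 r; rewrite IntZr//; Ctn.
rewrite Int_swap ?pi_ge0//; last first.
  move=> x; have cz' : {for x, continuous (fun p : R * R => zavg m Q p.2 p.1)}.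
    have a1 := @ctn_fst _ _ x; have a2 := @ctn_snd _ _ x.
    exact: (@ctn_comp2 (R * R)%type R R R (zavg m Q) snd fst x (cz _) a2 a1).
  by change {for x, continuous (fun p : R * R => u p.2 * zavg m Q p.2 p.1 * (w (cos p.1) * sin p.1 ^+ m.+1))}; ctn.
apply: eq_Int => rho _; rewrite /zconv -IntZl; last exact: ctn_zconv.
by apply: eq_Int => r _; rewrite (zavgC m Q r); ring.
Qed.

Lemma continuous_zavg_int (Q u : R -> R) : continuous Q -> continuous u ->
  continuous (fun r => Int 0 pi (fun rho => u rho * zavg m Q rho r)).
Proof.
move=> cQ cu x; apply: (@continuous_Int _ _ (fun r rho => u rho * zavg m Q rho r)); first exact: pi_ge0.
  move=> y _; have a1 := @ctn_fst _ _ (x, y); have a2 := @ctn_snd _ _ (x, y).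
  have cz : {for (y, x), continuous (fun p : R * R => zavg m Q p.1 p.2)} by exact: ctn_zavg2.
  have c := (@ctn_comp2 (R * R)%type R R R (zavg m Q) snd fst (x, y) cz a2 a1).
  by ctn.
by near=> r; have c := @continuous_zavg _ m Q r cQ; Ctn.
Unshelve. all: by end_near. Qed.

Lemma zconvE (Q q : R -> R) r : zconv m Q q r =
  Int 0 pi (fun rho => (q (cos rho) * sin rho ^+ m.+1) * zavg m Q rho r).
Proof. by apply: eq_Int => rho _; rewrite mulrAC. Qed.

End zonal_moments.

Section duhamel.
Context {R : realType}.
Variable m : nat.
Local Notation n := m.+2.
Variables f g g3 g5 : R -> R -> R.
Hypothesis fP : radial_kernel n f.
Hypothesis gP : radial_kernel n.+1 g.
Hypothesis g3P : radial_kernel n.+3 g3.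
Hypothesis g5P : radial_kernel n.+3.+2 g5.
Variable t : R.
Hypothesis t0 : 0 < t.

Let c : R := (2 * n%:R - 1) / 4.

Definition abel_conv s r : R := expR (- (c * s)) * zconv m (f (t - s)) (abel (g s)) r.

(** Up to a constant, the convolution of [f (t - s)] with the antipodal profile 1 / [kap], the
    weight sin^(m+1) being absorbed as in [abel_bdry]. *)
Definition bdry_conv s r : R :=
  Int 0 pi (fun rho => (sig rho ^+ m.+1 * kap rho ^+ m) * zavg m (f (t - s)) rho r).

Definition bdry_term s r : R := expR (- (c * s)) * g s (-1) * bdry_conv s r.

(** Time is clamped inside (0, t) because [g s] is uncontrolled at s = 0 and [f (t - s)] at s =
    t. *)
Lemma continuous_bdry_term a b : 0 < a -> a <= b -> b < t ->
  continuous (fun p : R * R => bdry_term (clamp a b p.1) p.2).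
Proof.
move=> a0 ab bt.
have cK := @continuous_kap R; have cS := @continuous_sig R.
have cl s : a <= clamp a b s <= b by exact: clamp_itv.
have cl0 s : 0 < clamp a b s by case/andP: (cl s) => h _; exact: lt_le_trans h.
have clt s : 0 < t - clamp a b s by case/andP: (cl s) => _ h; rewrite subr_gt0; exact: le_lt_trans bt.
have ccl := @continuous_clamp R a b.
move=> x.
have e1 : {for x, continuous (fun p : R * R => bdry_conv (clamp a b p.1) p.2)}.
  apply: (@continuous_Int _ _ (fun (p : R * R) rho =>
    sig rho ^+ m.+1 * kap rho ^+ m * zavg m (f (t - clamp a b p.1)) rho p.2)); first exact: pi_ge0.
    move=> y _.
    have d11 : {for (x, y), continuous (fun p : (R * R) * R => p.1.1)}.
      exact: (@ctn_comp ((R * R) * R)%type (R * R)%type R fst fst (x, y) (@ctn_fst _ _ _) (@ctn_fst _ _ _)).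
    have d12 : {for (x, y), continuous (fun p : (R * R) * R => p.1.2)}.
      exact: (@ctn_comp ((R * R) * R)%type (R * R)%type R snd fst (x, y) (@ctn_snd _ _ _) (@ctn_fst _ _ _)).
    have d2 := @ctn_snd _ _ (x, y).
    have : {for (x, y), continuous (fun p : (R * R) * R => zavg m (f (t - clamp a b p.1.1)) p.2 p.1.2)}.
      apply: (@ctn_zavg _ _ _ (fun p : (R * R) * R => f (t - clamp a b p.1.1)) snd (fun p => p.1.2)) => //.
        move=> z.
        have e11 : {for (x, y, z), continuous (fun p : ((R * R) * R) * R => t - clamp a b p.1.1.1)}.
          have := (@ctn_comp (((R * R) * R) * R)%type ((R * R) * R)%type R (fun p => p.1.1) fst (x, y, z) d11 (@ctn_fst _ _ _)).
          by move=> h; ctn.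
        have e2 := @ctn_snd _ _ (x, y, z).
        have ft : {for (t - clamp a b x.1, z), continuous (fun p : R * R => f p.1 p.2)} by exact: (rk_cont fP).
        exact: (@ctn_comp2 (((R * R) * R) * R)%type R R R f (fun p => t - clamp a b p.1.1.1) snd (x, y, z) ft e11 e2).
      by near=> z; exact: rk_contr fP (clt _).
    by move=> h; ctn.
  by near=> z; have cz := @continuous_zavg _ m _ z.2 (rk_contr fP (clt z.1)); Ctn.
have e2 : {for x, continuous (fun p : R * R => g (clamp a b p.1) (-1))}.
  have gt : {for (clamp a b x.1, -1), continuous (fun p : R * R => g p.1 p.2)} by exact: (rk_cont gP).
  have a1 : {for x, continuous (fun p : R * R => clamp a b p.1)} by ctn.
  exact: (@ctn_comp (R * R)%type R R (fun s => g s (-1)) (fun p => clamp a b p.1) x (continuous_sectionl gt) a1).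
by change {for x, continuous (fun p : R * R => expR (- (c * clamp a b p.1)) * g (clamp a b p.1) (-1) * bdry_conv (clamp a b p.1) p.2)}; ctn.
Unshelve. all: by end_near. Qed.

(* Both sides have the same moments against the eigenpolynomials. *)
Lemma duhamel a b r : 0 < a -> a <= b -> b < t -> 0 <= r <= pi ->
  m.+1%:R * Int a b (fun s => bdry_term (clamp a b s) r) = abel_conv a r - abel_conv b r.
Proof.
move=> a0 ab bt rp.
have cK := @continuous_kap R; have cS := @continuous_sig R.
have [P eigP] := @exists_eigenbasis R n isT.
have cl s : a <= clamp a b s <= b by exact: clamp_itv.
have cl0 s : 0 < clamp a b s by case/andP: (cl s) => h _; exact: lt_le_trans h.
have clt s : 0 < t - clamp a b s by case/andP: (cl s) => _ h; rewrite subr_gt0; exact: le_lt_trans bt.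
have ccl := @continuous_clamp R a b.
have cw : continuous (fun r : R => sig r ^+ m.+1 * kap r ^+ m) by Ctn.
pose B s r := bdry_term (clamp a b s) r.
have cB : continuous (fun p : R * R => B p.1 p.2) by exact: continuous_bdry_term.
have cBr r' : continuous (fun s => B s r').
  by move=> s; exact: (@continuous_sectionl _ B s r' (cB (s, r'))).
have cBl s : continuous (B s).
  by move=> r'; exact: (@continuous_sectionr _ B s r' (cB (s, r'))).
have cIB : continuous (fun r => Int a b (fun s => B s r)).
  move=> x; apply: (@continuous_Int _ _ (fun r s => B s r)) => //; last by near=> z.
  move=> y _; have a1 := @ctn_fst _ _ (x, y); have a2 := @ctn_snd _ _ (x, y).
  exact: (@ctn_comp2 (R * R)%type R R R B snd fst (x, y) (cB (y, x)) a2 a1).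
have cA s : 0 < s -> s < t -> continuous (abel_conv s).
  move=> s0 st; have cg := continuous_abel (rk_contr gP s0).
  have ts : 0 < t - s by rewrite subr_gt0.
  have cq : continuous (fun rho => abel (g s) (cos rho) * sin rho ^+ m.+1).
    by move: cg; move: (abel _) => A cg; Ctn.
  have h := @continuous_zavg_int _ m (f (t - s)) _ (rk_contr fP ts) cq.
  have -> : abel_conv s = (fun r => expR (- (c * s)) *
     Int 0 pi (fun rho => abel (g s) (cos rho) * sin rho ^+ m.+1 * zavg m (f (t - s)) rho r)).
    by apply/funext => r'; rewrite /abel_conv zconvE.
  by move=> x; apply: cvgM; [exact: cvg_cst|exact: h].
have bt0 : 0 < b by exact: lt_le_trans ab.
have at' : a < t by exact: le_lt_trans bt.
have cAa := cA a a0 at'; have cAb := cA b bt0 bt.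
apply/eqP; rewrite -subr_eq0 opprB addrA; apply/eqP.
apply: (@eq0_eigen_moments _ m P eigP (fun r => m.+1%:R * Int a b (fun s => B s r) + abel_conv b r - abel_conv a r) _ _ r rp).
  by clear -cIB cAa cAb; move: (abel_conv a) (abel_conv b) cAa cAb => A A' cAa cAb; Ctn.
move=> k; have [_ _ Ek] := eigP k.
pose w r := (P k).[cos r] * sin r ^+ m.+1.
have cw' : continuous w by rewrite /w; Ctn.
pose l := ev n k : R.
have v0 := sphere_vol_gt0 (R := R) m.
pose Phi s := expR (- (c * s)) * (expR (- l * (t - s)) / sphere_vol m) * abel_mom m g s (horner (P k)).
have MA s : 0 < s -> s < t -> Int 0 pi (fun r => abel_conv s r * w r) = Phi s.
  move=> s0 st; have cg := continuous_abel (rk_contr gP s0).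
  have ts : 0 < t - s by rewrite subr_gt0.
  have cq : continuous (fun rho => abel (g s) (cos rho) * sin rho ^+ m.+1).
    by move: cg; move: (abel _) => A cg; Ctn.
  have cz := @continuous_zavg_int _ m (f (t - s)) _ (rk_contr fP ts) cq.
  transitivity (expR (- (c * s)) * Int 0 pi (fun r => Int 0 pi (fun rho => abel (g s) (cos rho) * sin rho ^+ m.+1 * zavg m (f (t - s)) rho r) * w r)).
    rewrite -IntZl; last by Ctn.
    by apply: eq_Int => r' _; rewrite /abel_conv zconvE mulrA.
  rewrite /w (zavg_int_swap m (rk_contr fP ts) cq (@continuous_horner R (P k))).
  rewrite /Phi /abel_mom -[RHS]mulrA; congr (_ * _).
  rewrite -IntZl; last by move: cg; move: (abel _) => A cg; Ctn.
  apply: eq_Int => rho _; rewrite (zconv_rk eigP _ _ fP ts) -/l.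
  by move: (abel _ _) (expR _) (sphere_vol m)^-1 => x y z; ring.
have MB s : Int 0 pi (fun r => B s r * w r) = expR (- (c * clamp a b s)) * g (clamp a b s) (-1) *
    (expR (- l * (t - clamp a b s)) / sphere_vol m * abel_bdry m (P k)).
  have ts := clt s; have cz := @continuous_zavg_int _ m _ _ (rk_contr fP ts) cw.
  transitivity (expR (- (c * clamp a b s)) * g (clamp a b s) (-1) *
     Int 0 pi (fun r => bdry_conv (clamp a b s) r * w r)).
    rewrite -IntZl; last by rewrite /bdry_conv; Ctn.
    by apply: eq_Int => r' _; rewrite /B /bdry_term mulrA.
  congr (_ * _); rewrite /w (zavg_int_swap m (rk_contr fP ts) cw (@continuous_horner R (P k))).
  rewrite /abel_bdry -IntZl; last by Ctn.
  apply: eq_Int => rho _; rewrite (zconv_rk eigP _ _ fP ts) -/l.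
  by move: (expR _) (sphere_vol m)^-1 => y z; ring.
have key : m.+1%:R * Int a b (fun s => Int 0 pi (fun r => B s r * w r)) = Phi a - Phi b.
  (* The rates cancel: - c from exp(- c s), + l from exp(- l (t - s)), and - (l - c) from
     [abel_mom_derive]. Only the antipodal source is left. *)
  have dPhi (s : R) : 0 < s -> is_derive s 1 Phi (- (m.+1%:R * (expR (- (c * s)) * g s (-1) *
      (expR (- l * (t - s)) / sphere_vol m * abel_bdry m (P k))))).
    move=> s0; have d : has_der (fun s => abel_mom m g s (horner (P k))) s
        (- (l - c) * abel_mom m g s (horner (P k)) - m.+1%:R * g s (-1) * abel_bdry m (P k)).
      have h := abel_mom_derive gP g3P g5P s0 Ek; exact: h.
    have d1 : has_der (fun s : R => expR (- (c * s))) s (expR (- (c * s)) * - c).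
      apply: (@der_comp _ (fun s : R => - (c * s)) expR _ _ _ (is_derive_expR _)).
      by apply: der_eq; [der|rewrite /=; ring].
    have d2 : has_der (fun s : R => expR (- l * (t - s))) s (expR (- l * (t - s)) * l).
      apply: (@der_comp _ (fun s : R => - l * (t - s)) expR _ _ _ (is_derive_expR _)).
      by apply: der_eq; [der|rewrite /=; ring].
    rewrite /Phi; apply: der_eq; first exact: derM (derM d1 (derM d2 (der_cst _ _))) d.
    by rewrite /=; move: (expR _) (expR _) (sphere_vol m)^-1 (abel_mom _ _ _ _) => x1 x2 x3 x4; ring.
  have cI : continuous (fun s => Int 0 pi (fun r => B s r * w r)).
    move=> x; apply: (@continuous_Int _ _ (fun s r => B s r * w r)); first exact: pi_ge0.
      by move=> y _; have h := cB (x, y); ctn.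
    by near=> z; have h := cBl z; Ctn.
  rewrite -IntZl//.
  transitivity (- Int a b (fun s => - 1 * (m.+1%:R * Int 0 pi (fun r => B s r * w r)))).
    by rewrite [in RHS]IntZl; [rewrite mulN1r opprK|Ctn].
  clear MA; clearbody Phi.
  rewrite -[RHS]opprB; congr (- _).
  apply: (FTC ab).
  - by move=> x; apply: cvgM; [exact: cvg_cst|apply: cvgM; [exact: cvg_cst|exact: cI]].
  - move=> s /andP[s1 s2]; rewrite MB clamp_id ?(ltW s1) ?(ltW s2)// mulN1r.
    exact/dPhi/(lt_trans a0).
  apply: continuous_in_subspaceT => s; rewrite inE/= in_itv/= => /andP[s1 _].
  exact: is_derive_continuous (dPhi s (lt_le_trans a0 s1)).
move: (MA a a0 at') (MA b bt0 bt) => MAa MAb.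
pose I r := Int a b (fun s => B s r).
change (Int 0 pi (fun r => (m.+1%:R * I r + abel_conv b r - abel_conv a r) * w r) = 0).
have SW : Int 0 pi (fun r => I r * w r) =
   Int a b (fun s => Int 0 pi (fun r => B s r * w r)).
  transitivity (Int 0 pi (fun r => Int a b (fun s => B s r * w r))).
    by apply: eq_Int => r' _; rewrite IntZr.
  rewrite (@Int_swap _ (fun r s => B s r * w r))//; first exact: pi_ge0.
  move=> x; apply: cvgM; last exact: (ctn_comp (cw' _) (@ctn_fst _ _ _)).
  exact: (@ctn_comp2 (R * R)%type R R R B snd fst x (cB (x.2, x.1)) (@ctn_snd _ _ _) (@ctn_fst _ _ _)).
clear MA MB; move: (abel_conv a) (abel_conv b) cAa cAb MAa MAb => A A' cAa cAb MAa MAb.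
change (continuous I) in cIB; clearbody I.
move: B cB cBr cBl SW key => {}B cB cBr cBl SW key.
clearbody Phi w.
transitivity (m.+1%:R * Int 0 pi (fun r => I r * w r) +
  Int 0 pi (fun r => A' r * w r) - Int 0 pi (fun r => A r * w r)).
  rewrite -IntZl -?IntD -?IntB; [|by Ctn..].
  by apply: eq_Int => r' _; ring.
by rewrite MAa MAb SW key; ring.
Unshelve. all: by end_near. Qed.

Lemma near0_right (Q : R -> Prop) : (\forall e \near (0 : R), Q e) -> \forall e \near 0^'+, Q e.
Proof. by move=> h; apply: filterS h => x Qx _. Qed.

Let near_t : \forall e \near (0 : R), 0 < t - e.
Proof.
have : \forall e \near (0 : R), e < t by exact: near_lt.
by apply: filterS => e; rewrite subr_gt0.
Qed.

(** As s increases to t, [f (t - s)] is the approximate identity, while [abel (g s)] moves but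
    converges uniformly on [-1, 1] by [tube]. *)
Lemma abel_conv_right r :
  abel_conv (t - e) r @[e --> 0^'+] --> expR (- (c * t)) * (abel (g t) (cos r) / sphere_vol m).
Proof.
have [P eigP] := @exists_eigenbasis R n isT.
have v0 := sphere_vol_gt0 (R := R) m.
have cgt := rk_contr gP t0.
have near_t' := near0_right near_t.
have ca : \forall e \near 0^'+, continuous (abel (g (t - e))).
  by apply: filterS near_t' => e te; apply: continuous_abel; exact: rk_contr gP te.
have unif e : 0 < e -> \forall s \near 0^'+, forall x, -1 <= x <= 1 ->
    `|abel (g (t - s)) x - abel (g t) x| <= e.
  move=> e0; apply: near0_right.
  have := @tube _ _ (fun s x => abel (g (t - s)) x) (0 : R) (-1) 1 e; rewrite subr0.
  move=> /(_ _ e0)T; have {}T := T _.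
  apply: filterS (T _) => [s h x xi|y _]; first exact/ltW/h.
  apply: (@ctn_abel _ _ (fun p : R * R => g (t - p.1)) snd); last exact: ctn_snd.
    move=> z.
    have gt' : {for (t - 0, z), continuous (fun p : R * R => g p.1 p.2)}.
      by apply: (rk_cont gP); rewrite subr0.
    have d11 : {for (0, y, z), continuous (fun p : (R * R) * R => p.1.1)}.
      exact: (@ctn_comp ((R * R) * R)%type (R * R)%type R fst fst (0, y, z) (@ctn_fst _ _ _) (@ctn_fst _ _ _)).
    have d1 : {for (0, y, z), continuous (fun p : (R * R) * R => t - p.1.1)} by ctn.
    have d2 := @ctn_snd _ _ ((0 : R), y, z).
    exact: (@ctn_comp2 ((R * R) * R)%type R R R g (fun p => t - p.1.1) snd ((0 : R), y, z) gt' d1 d2).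
  have : \forall p \near ((0 : R), y), 0 < t - p.1 by exact: (cvg_fst near_t).
  by apply: filterS => -[s x] /= ts; exact: rk_contr gP ts.
have lim := @zconv_rk_cvg _ _ _ eigP f _ (abel (g t)) r fP ca (continuous_abel cgt) unif.
apply: (@cvg_trans _ ((fun e => expR (- (c * (t - e))) *
   ((sphere_vol m * zconv m (f e) (abel (g (t - e))) r) / sphere_vol m)) @ 0^'+)).
  apply: near_eq_cvg; near=> e; rewrite /abel_conv subKr; congr (_ * _).
  by rewrite mulrAC mulfV ?mul1r// gt_eqF.
apply: cvgM; last by apply: cvgM lim _; exact: cvg_cst.
rewrite -[X in expR (- (c * X))]subr0.
by apply: (@at_right_cont _ (fun e => expR (- (c * (t - e))))); Ctn.
Unshelve. all: by end_near. Qed.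

(** As s decreases to 0, [abel (g s)] concentrates at the pole by [abel_init], and the moving test
    function is the spherical mean of [f (t - s)]. *)
Lemma abel_conv_left r :
  abel_conv e r @[e --> 0^'+] --> f t (cos r) / (Num.sqrt 2 * sphere_vol m).
Proof.
have v0 := sphere_vol_gt0 (R := R) m.
have cft := rk_contr fP t0.
have near_t' := near0_right near_t.
have ch : \forall e \near 0^'+, continuous (zavg m (f (t - e)) ^~ r).
  by apply: filterS near_t' => e te; apply: continuous_zavg; exact: rk_contr fP te.
have unif e : 0 < e -> \forall s \near 0^'+, forall rho, 0 <= rho <= pi ->
    `|zavg m (f (t - s)) rho r - zavg m (f t) rho r| <= e.
  move=> e0; apply: near0_right.
  have := @tube _ _ (fun s rho => zavg m (f (t - s)) rho r) (0 : R) 0 pi e; rewrite subr0.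
  move=> /(_ _ e0)T; have {}T := T _.
  apply: filterS (T _) => [s h x xi|y _]; first exact/ltW/h.
  apply: (@ctn_zavg _ _ _ (fun p : R * R => f (t - p.1)) snd (fun=> r)); last 2 first.
  - exact: ctn_snd.
  - exact: ctn_cst.
    move=> z.
    have gt' : {for (t - 0, z), continuous (fun p : R * R => f p.1 p.2)}.
      by apply: (rk_cont fP); rewrite subr0.
    have d11 : {for (0, y, z), continuous (fun p : (R * R) * R => p.1.1)}.
      exact: (@ctn_comp ((R * R) * R)%type (R * R)%type R fst fst (0, y, z) (@ctn_fst _ _ _) (@ctn_fst _ _ _)).
    have d1 : {for (0, y, z), continuous (fun p : (R * R) * R => t - p.1.1)} by ctn.
    have d2 := @ctn_snd _ _ ((0 : R), y, z).
    exact: (@ctn_comp2 ((R * R) * R)%type R R R f (fun p => t - p.1.1) snd ((0 : R), y, z) gt' d1 d2).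
  have : \forall p \near ((0 : R), y), 0 < t - p.1 by exact: (cvg_fst near_t).
  by apply: filterS => -[s x] /= ts; exact: rk_contr fP ts.
have lim := @abel_init _ _ _ _ gP g3P (fun e => zavg m (f (t - e)) ^~ r) (zavg m (f t) ^~ r) ch
   (@continuous_zavg _ m _ r cft) unif.
(* The mean at the pole carries the integral of sin^m, which is also the ratio of [sphere_vol m.+1]
   to [sphere_vol m]. *)
have -> : f t (cos r) / (Num.sqrt 2 * sphere_vol m) =
   expR (- (c * 0)) * (zavg m (f t) 0 r / (Num.sqrt 2 * sphere_vol m.+1)).
  have S0 := Int_sin_gt0 (R := R) m; have q0 : 0 < Num.sqrt 2 :> R by rewrite sqrtr_gt0.
  rewrite mulr0 oppr0 expR0 mul1r zavg0//=.
  by move: (f _ _) (Int _ _ _) S0 (sphere_vol m) v0 (Num.sqrt 2) q0 => F S S0 v v0' q q0; field; rewrite !gt_eqF.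
apply: (@cvg_trans _ ((fun e => expR (- (c * e)) *
   Int 0 pi (fun rho => abel (g e) (cos rho) * (zavg m (f (t - e)) rho r * sin rho ^+ m.+1))) @ 0^'+)).
  apply: near_eq_cvg; near=> e; rewrite /abel_conv; congr (_ * _).
  by apply: eq_Int => rho _; rewrite mulrA.
apply: cvgM lim.
by apply: (@at_right_cont _ (fun e => expR (- (c * e)))); Ctn.
Unshelve. all: by end_near. Qed.

Lemma bdry_term_ge0 s r : 0 < s -> s < t -> 0 <= bdry_term s r.
Proof.
move=> s0 st; rewrite /bdry_term !mulr_ge0 ?expR_ge0//.
  by apply: (rk_ge0 _ gP s0) => //; lra.
have ts : 0 < t - s by rewrite subr_gt0.
apply: Int_ge0 => rho rp; apply: mulr_ge0.
  exact: mulr_ge0 (exprn_ge0 _ (sig_ge0 rp)) (exprn_ge0 _ (kap_ge0 rp)).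
by apply: zavg_ge0 => x xi; apply: (rk_ge0 _ fP ts).
Qed.

Lemma bdry_term_cont s r : 0 < s -> s < t -> {for s, continuous (bdry_term ^~ r)}.
Proof.
move=> s0 st.
pose a := s / 2; pose b := (s + t) / 2.
have a0 : 0 < a by rewrite divr_gt0.
have ab : a < s by rewrite /a; lra.
have sb : s < b by rewrite /b; lra.
have bt : b < t by rewrite /b; lra.
have cB := continuous_bdry_term a0 (ltW (lt_trans ab sb)) bt.
have cBs : {for s, continuous (fun s => bdry_term (clamp a b s) r)}.
  exact: (@continuous_sectionl _ (fun s r => bdry_term (clamp a b s) r) s r (cB (s, r))).
have E : \forall z \near s, bdry_term (clamp a b z) r = bdry_term z r.
  near=> z; rewrite clamp_id//; apply/andP; split; apply: ltW; near: z; [exact: near_gt|exact: near_lt].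
have Es : bdry_term (clamp a b s) r = bdry_term s r by rewrite clamp_id// !ltW.
apply: (@cvg_trans _ ((fun s => bdry_term (clamp a b s) r) @ s)).
  by apply: near_eq_cvg; exact: E.
by have := cBs; rewrite /prop_for /continuous_at Es.
Unshelve. all: by end_near. Qed.

(** Let e tend to 0 in [duhamel] on [e, t - e]; nonnegativity of the integrand makes the limit the
    integral over ]0, t[. *)
Lemma bdry_term_integral r : 0 <= r <= pi ->
  (\int[lebesgue_measure]_(s in `]0%R, t[) (bdry_term s r)%:E =
   ((f t (cos r) / (Num.sqrt 2 * sphere_vol m) -
     expR (- (c * t)) * (abel (g t) (cos r) / sphere_vol m)) / m.+1%:R)%:E)%E.
Proof.
move=> rp; apply: integral_oo => //.
- by move=> s /andP[s0 st]; exact: bdry_term_cont.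
- by move=> s /andP[s0 st]; exact: bdry_term_ge0.
have lim : (abel_conv e r - abel_conv (t - e) r) / m.+1%:R @[e --> 0^'+] -->
   (f t (cos r) / (Num.sqrt 2 * sphere_vol m) -
     expR (- (c * t)) * (abel (g t) (cos r) / sphere_vol m)) / m.+1%:R.
  apply: cvgM; last exact: cvg_cst.
  by apply: cvgB; [exact: abel_conv_left|exact: abel_conv_right].
apply: cvg_trans lim; apply: near_eq_cvg; near=> e.
have e0 : 0 < e by near: e; exact: nbhs_right_gt.
have et : e < t / 2 by near: e; apply: nbhs_right_lt; rewrite divr_gt0.
have tet : t - e < t by lra.
have ete : e <= t - e by lra.
rewrite add0r -(duhamel e0 ete tet rp) mulrAC mulfV ?pnatr_eq0// mul1r.
by apply: eq_Int => s si; rewrite clamp_id.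
Unshelve. all: by end_near. Qed.

End duhamel.

(** * The volume of the sphere *)

Section sphere_volume.
Context {R : realType}.
Notation mu := (@lebesgue_measure R).
Implicit Types (k : nat) (U x : R).

(** Half of the truncated integral for Gamma((k + 1) / 2), after the substitution x = y^2. *)
Definition half_gamma k U : R := Int 0 U (fun y => y ^+ k * expR (- y ^+ 2)).

Let cw k : continuous (fun y : R => y ^+ k * expR (- y ^+ 2)).
Proof. by Ctn. Qed.

Lemma half_gamma_rec k U : 0 <= U ->
  half_gamma k.+2 U = k.+1%:R / 2 * half_gamma k U - U ^+ k.+1 * expR (- U ^+ 2) / 2.
Proof.
move=> U0.
have d (y : R) : has_der (fun y : R => y ^+ k.+1 * expR (- y ^+ 2)) y
    (k.+1%:R * (y ^+ k * expR (- y ^+ 2)) - 2 * (y ^+ k.+2 * expR (- y ^+ 2))).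
  have d1 : has_der (fun y : R => - y ^+ 2) y (- 2 * y) by apply: der_eq; [der|rewrite /=; ring].
  have d2 := @der_comp _ (fun y : R => - y ^+ 2) expR y _ _ (is_derive_expR _) d1.
  by apply: der_eq; [der|rewrite /= !exprS; ring].
have c1 : continuous (fun y : R => y ^+ k * expR (- y ^+ 2)) by exact: cw.
have c2 : continuous (fun y : R => y ^+ k.+2 * expR (- y ^+ 2)) by exact: cw.
have : Int 0 U (fun y => k.+1%:R * (y ^+ k * expR (- y ^+ 2)) - 2 * (y ^+ k.+2 * expR (- y ^+ 2))) =
   U ^+ k.+1 * expR (- U ^+ 2) - 0 ^+ k.+1 * expR (- 0 ^+ 2).
  by apply: (FTCT U0 _ d); Ctn.
rewrite expr0n/= mul0r subr0 IntB ?IntZl//; [|by Ctn..].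
rewrite -!/(half_gamma _ _) => <-; by field.
Qed.

Lemma half_gamma1 U : 0 <= U -> half_gamma 1 U = (1 - expR (- U ^+ 2)) / 2.
Proof.
move=> U0.
have d (y : R) : has_der (fun y : R => - (expR (- y ^+ 2) / 2)) y (y ^+ 1 * expR (- y ^+ 2)).
  have d1 : has_der (fun y : R => - y ^+ 2) y (- 2 * y) by apply: der_eq; [der|rewrite /=; ring].
  have d2 := @der_comp _ (fun y : R => - y ^+ 2) expR y _ _ (is_derive_expR _) d1.
  by apply: der_eq; [der|rewrite /=; field].
rewrite /half_gamma (FTCT U0 (@cw 1) d) expr0n/= oppr0 expR0; by field.
Qed.

Lemma cvg_expr_gauss k : U ^+ k * expR (- U ^+ 2) @[U --> +oo%R] --> (0 : R).
Proof.
have inv0 : k.+1`!%:R * U^-1 @[U --> +oo%R] --> (0 : R).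
  rewrite -[X in _ --> X](mulr0 (k.+1`!%:R : R)); apply: cvgM; first exact: cvg_cst.
  have g0 : \forall U \near +oo, 0 < (U : R) by exact: nbhs_pinfty_gt.
  by apply/(gtr0_cvgV0 (f := fun U : R => U) g0); exact: cvg_id.
apply: (@squeeze_cvgr _ _ _ _ (fun=> 0) (fun U => k.+1`!%:R * U^-1)) inv0; last exact: cvg_cst.
near=> U.
have U1 : 1 <= U by near: U; exact: nbhs_pinfty_ge.
have U0 : 0 < U by exact: lt_le_trans U1.
apply/andP; split; first by rewrite mulr_ge0 ?expR_ge0 ?exprn_ge0 ?ltW.
rewrite expRN ler_pdivrMr ?expR_gt0//.
have h := expR_ge1Dxn k (sqr_ge0 U).
have f0 : 0 < k.+1`!%:R :> R by rewrite ltr0n fact_gt0.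
apply: (@le_trans _ _ (k.+1`!%:R * U^-1 * (U ^+ 2 ^+ k.+1 / k.+1`!%:R))); last first.
  by rewrite ler_pM2l ?divr_gt0// (le_trans _ h)// lerDr.
have -> : k.+1`!%:R * U^-1 * (U ^+ 2 ^+ k.+1 / k.+1`!%:R) = U ^+ k * (U * U ^+ k).
  have -> : U ^+ 2 ^+ k.+1 = U * U * (U ^+ k * U ^+ k) by rewrite exprS -exprMn.
  by field; rewrite !gt_eqF.
apply: ler_peMr; first by rewrite exprn_ge0// ltW.
by rewrite -exprS exprn_ege1.
Unshelve. all: by end_near. Qed.

Lemma sphere_vol1 : sphere_vol 1 = 2 * pi :> R.
Proof. by rewrite /= (proj1 (@Int_sin01 R)). Qed.

(** Integration by parts gives a two-step recursion matching [sphere_vol_rec]. The base cases are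
    the Gauss integral and an elementary one, and consecutive values are carried in pairs. *)
Lemma cvg_half_gamma k : half_gamma k U @[U --> +oo] --> pi `^ (k.+1%:R / 2) / sphere_vol k.
Proof.
have p0 := pi_gt0 R.
suff : half_gamma k U @[U --> +oo] --> pi `^ (k.+1%:R / 2) / sphere_vol k /\
   half_gamma k.+1 U @[U --> +oo] --> pi `^ (k.+2%:R / 2) / sphere_vol k.+1 by case.
have U0 : \forall U \near +oo, 0 <= (U : R) by exact: nbhs_pinfty_ge.
elim: k => [|k [IH1 IH2]].
  split.
    have -> : pi `^ (1 / 2) / sphere_vol 0 = Num.sqrt (pi / 4) :> R.
      rewrite mul1r powR12_sqrt ?ltW//= sqrtrM ?ltW// sqrtrV// (_ : 4 = 2 ^+ 2 :> R); last by ring.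
      by rewrite sqrtr_sqr ger0_norm.
    have g := @gauss_integral_proof.cvg_integral0_gauss_sqr R.
    have : Num.sqrt (gauss_integral_proof.integral0_gauss U ^+ 2) @[U --> +oo] --> Num.sqrt (pi / 4 : R).
      by apply: continuous_cvg g; exact: sqrt_continuous.
    apply: cvg_trans; apply: near_eq_cvg; near=> U.
    rewrite sqrtr_sqr ger0_norm ?gauss_integral_proof.integral0_gauss_ge0//.
    by apply: eq_Int => y _; rewrite expr0 mul1r.
  have -> : pi `^ (2 / 2) / sphere_vol 1 = (1 - 0) / 2 :> R.
    by rewrite mulfV// powRr1 ?ltW// sphere_vol1; move: (pi : R) p0 => P P0; field; rewrite gt_eqF.
  apply: (@cvg_trans _ ((fun U => (1 - expR (- U ^+ 2)) / 2) @ +oo)).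
    by apply: near_eq_cvg; apply: filterS U0 => U /half_gamma1.
  apply: cvgM; last exact: cvg_cst.
  apply: cvgB; first exact: cvg_cst.
  have := cvg_expr_gauss 0; apply: cvg_trans; apply: near_eq_cvg; near=> U.
  by rewrite expr0 mul1r.
split => //.
have -> : pi `^ (k.+3%:R / 2) / sphere_vol k.+2 =
    k.+1%:R / 2 * (pi `^ (k.+1%:R / 2) / sphere_vol k) - 0 / 2 :> R.
  rewrite sphere_vol_rec (_ : k.+3%:R / 2 = k.+1%:R / 2 + 1 :> R); last by rewrite -!natr1; field.
  rewrite powRD; last by rewrite (gt_eqF p0) implybT.
  rewrite powRr1 ?ltW//.
  have v0 := sphere_vol_gt0 (R := R) k; have k0 : 0 < k.+1%:R :> R by rewrite ltr0n.
  move: (pi `^ _) => Q; move: (k.+1%:R : R) k0 (sphere_vol k) v0 (pi : R) p0 => K K0 v v0 P P0.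
  by field; rewrite !gt_eqF.
apply: (@cvg_trans _ ((fun U => k.+1%:R / 2 * half_gamma k U - U ^+ k.+1 * expR (- U ^+ 2) / 2) @ +oo)).
  by apply: near_eq_cvg; apply: filterS U0 => U /(half_gamma_rec k).
apply: cvgB; apply: cvgM => //; try exact: cvg_cst.
exact: cvg_expr_gauss.
Unshelve. all: by end_near. Qed.

Lemma Gamma_half k : Gamma (k.+1%:R / 2) = 2 * (pi `^ (k.+1%:R / 2) / sphere_vol k) :> R.
Proof.
pose F x : R := x `^ (k.+1%:R / 2 - 1) * expR (- x).
have FE x : 0 < x -> F x = Num.sqrt x ^+ k * expR (- Num.sqrt x ^+ 2) / Num.sqrt x.
  move=> x0; rewrite /F sqr_sqrtr ?ltW//.
  have s0 : 0 < Num.sqrt x by rewrite sqrtr_gt0.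
  have -> : k.+1%:R / 2 - 1 = k%:R / 2 - 2^-1 :> R by rewrite -natr1; field.
  rewrite powRB; last by rewrite (gt_eqF x0) implybT.
  rewrite powR12_sqrt ?ltW// [k%:R / 2]mulrC powRrM powR12_sqrt ?ltW// powR_mulrn ?ltW//.
  by rewrite mulrAC.
(* A primitive of the Gamma integrand on x > 0. For k = 0 that integrand is unbounded at 0, but [G]
   is continuous there; the lower end -1 makes the inner primitive differentiable at sqrt x = 0. *)
pose G x : R := 2 * Int (-1) (Num.sqrt x) (fun y => y ^+ k * expR (- y ^+ 2)).
have dI U : 0 <= U -> is_derive U 1 (fun U => Int (-1) U (fun y => y ^+ k * expR (- y ^+ 2)))
    (U ^+ k * expR (- U ^+ 2)).
  by move=> U0; apply: is_derive_primitive => //; apply: lt_le_trans U0; rewrite ltrN10.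
have dG x : 0 < x -> is_derive x 1 G (F x).
  move=> x0; have s0 : 0 < Num.sqrt x by rewrite sqrtr_gt0.
  have d1 := @der_sqrt _ (fun x : R => x) x 1 (der_id _) x0.
  have d2 := @der_comp _ Num.sqrt (fun U => Int (-1) U (fun y => y ^+ k * expR (- y ^+ 2))) x _ _ (dI _ (ltW s0)) d1.
  by rewrite FE//; apply: der_eq; [exact: derM (der_cst _ _) d2|rewrite /=; field; rewrite gt_eqF].
have cF x : 0 < x -> {for x, continuous F}.
  move=> x0; have s0 : 0 < Num.sqrt x by rewrite sqrtr_gt0.
  pose F' x : R := Num.sqrt x ^+ k * expR (- Num.sqrt x ^+ 2) / Num.sqrt x.
  have cF' : {for x, continuous F'}.
    rewrite /F'; have c1 := @sqrt_continuous R x; apply: ctnM; first by ctn.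
    by apply: (@ctn_comp _ _ _ (fun y : R => y^-1) Num.sqrt x _ c1); apply: inv_continuous; rewrite gt_eqF.
  have E : \forall z \near x, F' z = F z.
    by near=> z; rewrite FE//; near: z; exact: near_gt.
  apply: (@cvg_trans _ (F' @ x)); first by apply: near_eq_cvg.
  by have := cF'; rewrite /prop_for /continuous_at [F' x]/(F' x) /F' -FE.
pose a i : R := i.+1%:R^-1; pose b i : R := i.+1%:R.
have a0 i : 0 < a i by rewrite invr_gt0.
have a1 i : a i <= 1 by rewrite invf_le1// ler1n.
have b1 i : 1 <= b i by rewrite ler1n.
have ab i : a i <= b i by exact: le_trans (a1 i) (b1 i).
have cGx : continuous G.
  move=> x; have c1 := @sqrt_continuous R x.
  have c2 := @ctn_comp _ _ _ _ Num.sqrt x (is_derive_continuous (dI _ (sqrtr_ge0 x))) c1.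
  by change {for x, continuous G}; rewrite /G; ctn.
have lima : G (a i) @[i --> \oo] --> G 0.
  by apply: (cvg_comp a G); [exact: cvg_harmonic|exact: cGx].
have limb : G (b i) - G 0 @[i --> \oo] --> 2 * (pi `^ (k.+1%:R / 2) / sphere_vol k).
  have -> : (fun i => G (b i) - G 0) = (fun i => 2 * half_gamma k (Num.sqrt (b i))).
    apply/funext => i; rewrite /G sqrtr0 -mulrBr (@IntS _ (-1) 0 (Num.sqrt (b i)))//.
      by rewrite addrAC subrr add0r.
    by rewrite lerN10 sqrtr_ge0.
  apply: cvgM; first exact: cvg_cst.
  suff sb : Num.sqrt (b i) @[i --> \oo] --> +oo.
    have /cvg_pinftyP/(_ _ sb) := @cvg_half_gamma k; exact.
  apply/cvgryPge => A; exists (Num.truncn (A ^+ 2)) => // i /= iA.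
  apply: le_trans (ler_norm A) _; rewrite -sqrtr_sqr ler_wsqrtr//.
  by apply/ltW/(lt_le_trans (truncnS_gt _)); rewrite ler_nat ltnS.
have Fint : (\int[mu]_(x in `]0%R, +oo[) (F x)%:E = (2 * (pi `^ (k.+1%:R / 2) / sphere_vol k))%:E)%E.
  apply: (@integral_exhaustion _ a b).
  - by move=> i j ij; rewrite lef_pV2 ?posrE// ler_nat.
  - by move=> i j ij; rewrite ler_nat.
  - exact: ab.
  - exact: interval_open.
  - apply/seteqP; split => [x [i _]|x]; rewrite /= !in_itv/= andbT.
      by move=> /andP[+ _]; exact: lt_le_trans.
    move=> x0; pose N := Num.truncn (Num.max x x^-1).
    have : Num.max x x^-1 < N.+1%:R by exact: truncnS_gt.
    rewrite gt_max => /andP[h1 h2]; exists N => //; rewrite /= in_itv/= /a /b (ltW h1) andbT.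
    by rewrite -[leRHS]invrK lef_pV2 ?posrE ?invr_gt0// ltW.
  - by move=> x; rewrite /= in_itv/= andbT; exact: cF.
  - by move=> x; rewrite /= in_itv/= andbT => x0; rewrite mulr_ge0 ?powR_ge0 ?expR_ge0.
  have -> : (fun i => Int (a i) (b i) F) = (fun i => G (b i) - G 0 - (G (a i) - G 0)).
    apply/funext => i; transitivity (G (b i) - G (a i)); last by rewrite opprB addrA subrK.
    apply: (FTC_itv (ab i)) => x /andP[x1 _].
      by apply: cF; exact: lt_le_trans x1.
    by apply: dG; exact: lt_le_trans x1.
  rewrite -[X in _ --> X]subr0 -[X in _ - X](subrr (G 0)); apply: cvgB limb _.
  by apply: cvgB lima _; exact: cvg_cst.
by rewrite /Gamma /Rintegral Fint.
Unshelve. all: by end_near. Qed.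

Lemma omegaE k : omega k = sphere_vol k :> R.
Proof.
have v0 := sphere_vol_gt0 (R := R) k.
have p0 : 0 < pi `^ (k.+1%:R / 2) :> R by rewrite powR_gt0 ?pi_gt0.
rewrite /omega Gamma_half; move: (sphere_vol k) v0 (pi `^ _) p0 => v v0 p p0.
by field; rewrite !gt_eqF.
Qed.

End sphere_volume.

(** * The two formulas *)

Section main.
Context {R : realType}.
Notation mu := (@lebesgue_measure R).
Implicit Types (kappa : nat -> R -> R -> R).

Lemma recursion_formula kappa (n : nat) (t r : R) :
  (forall n : nat, (1 <= n)%N -> is_heat_kernel n (kappa n)) ->
  (1 <= n)%N -> 0 < t -> 0 < r < pi ->
  kappa n.+2 t r = - (expR (n%:R * t) / (2 * pi * sin r)) * 'D_1 (kappa n t) r.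
Proof.
case: n => // m hk _ t0 rp; have p0 := pi_gt0 R.
have fP := radial_kernel_of_heat_kernel (hk m.+1 isT).
have hP := radial_kernel_of_heat_kernel (hk m.+3 isT).
set f := fun t x => _ in fP; set h := fun t x => _ in hP.
have /andP[r0 rpi] := rp.
have -> : kappa m.+3 t r = h t (cos r) by rewrite /h acosc_cos// !ltW.
have d1 : has_der (fun r => f t (cos r)) r (dx f t (cos r) * - sin r).
  exact: (@der_comp _ cos (f t) _ _ _ (rk_dx fP t0 (cos_oo rp)) (is_derive_cos _)).
have d2 : is_derive r 1 (kappa m.+1 t) (dx f t (cos r) * - sin r).
  apply: is_derive_near d1; near=> z; rewrite /f acosc_cos//.
  by apply/andP; split; apply: ltW; near: z; [exact: near_gt|exact: near_lt].
have -> : 'D_1 (kappa m.+1 t) r = dx f t (cos r) * - sin r by exact: derive_val.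
rewrite (ladder _ fP hP t0 (cos_oo rp))// expRN.
have s0 : sin r != 0 by rewrite gt_eqF// sin_gt0_pi.
have e0 : expR (m.+1%:R * t) != 0 by rewrite gt_eqF// expR_gt0.
move: (h _ _) (expR _) e0 (sin r) s0 (pi : R) p0 => H E E0 S S0 P P0.
by field; rewrite S0 E0 gt_eqF.
Unshelve. all: by end_near. Qed.

(** Each half-angle sine or cosine is [sig] or [kap] over sqrt 2; the 2 m + 1 factors amount to 2^m
    sqrt 2. *)
Lemma bdry_integrand (f : R -> R) m r : continuous f ->
  (\int[mu]_(rho in `[0%R, pi])
    ((sin (rho / 2) ^+ m.+1 * cos (rho / 2) ^+ m)%:E *
     \int[mu]_(theta in `[0%R, pi]) (f (zc r rho theta) * sin theta ^+ m)%:E) =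
   ((2 ^+ m * Num.sqrt 2)^-1 *
    Int 0 pi (fun rho => (sig rho ^+ m.+1 * kap rho ^+ m) * zavg m f rho r))%:E)%E.
Proof.
move=> cf; have cz := @continuous_zavg _ m f r cf.
have cK := @continuous_kap R; have cS := @continuous_sig R.
have q0 : 0 < Num.sqrt 2 :> R by rewrite sqrtr_gt0.
have q2 : 2 = Num.sqrt 2 ^+ 2 :> R by rewrite sqr_sqrtr.
rewrite -IntZl; last by Ctn.
rewrite -EFin_Int; last by Ctn.
apply: eq_integral => rho _.
rewrite EFin_Int; last by rewrite /zc; Ctn.
rewrite -EFinM; congr (_%:E); rewrite -/(zavg m f r rho) zavgC mulrA; congr (_ * _).
have -> : 2 ^+ m = Num.sqrt 2 ^+ m * Num.sqrt 2 ^+ m :> R by rewrite -exprMn -expr2 -q2.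
rewrite /sig /kap !exprMn [Num.sqrt 2 ^+ m.+1]exprS.
have q1 : Num.sqrt 2 ^+ m != 0 :> R by rewrite expf_eq0 gt_eqF// andbF.
move: (sin _ ^+ _) (cos _ ^+ _) => A B.
move: (Num.sqrt (2 : R)) q0 q1 => q q0' {q2}; move: (q ^+ m) => Q q1.
by field; rewrite q1 gt_eqF.
Qed.

End main.

Theorem theorem1p1 (R : realType) (kappa : nat -> R -> R -> R)
    (kappaP : forall n : nat, (1 <= n)%N -> is_heat_kernel n (kappa n)) :
  (forall (n : nat) (t : R), (1 <= n)%N -> 0 < t ->
     let F (r : R) :=
       - (expR (n%:R * t) / (2 * pi * sin r)) * 'D_1 (kappa n t) r in
     [/\ forall r : R, 0 < r < pi -> kappa n.+2 t r = F r,
         F r @[r --> 0^'+] --> kappa n.+2 t 0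
       & F r @[r --> pi^'-] --> kappa n.+2 t pi])
  /\
  (forall (n : nat) (t r : R), (2 <= n)%N -> 0 < t -> 0 <= r <= pi ->
     ((kappa n t r)%:E =
      (Num.sqrt 2 * expR (- ((2 * n%:R - 1) / 4) * t))%:E *
      \int[lebesgue_measure]_(rho in `[r, pi])
        (kappa n.+1 t rho * sin rho / Num.sqrt (cos r - cos rho))%:E
      + ((n%:R - 1) * 2 ^+ (n - 1) * omega (n - 2))%:E *
        \int[lebesgue_measure]_(s in `]0%R, t[)
          ((expR (- ((2 * n%:R - 1) / 4) * s) * kappa n.+1 s pi)%:E *
           \int[lebesgue_measure]_(rho in `[0%R, pi])
             ((sin (rho / 2) ^+ (n - 1) * cos (rho / 2) ^+ (n - 2))%:E *
              \int[lebesgue_measure]_(theta in `[0%R, pi])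
                (kappa n (t - s)
                   (acos (cos r * cos rho + sin r * sin rho * cos theta))
                 * sin theta ^+ (n - 2))%:E)))%E).
Proof.
split=> [n t n0 t0 F|[|[|m]]// t r _ t0 rp].
  have FE r : 0 < r < pi -> kappa n.+2 t r = F r by move=> rp; exact: recursion_formula.
  have hP := radial_kernel_of_heat_kernel (kappaP n.+2 isT).
  have ch := rk_contr hP t0.
  have p0 := pi_gt0 R.
  (* This function is continuous on the line and agrees with the kernel on [0, pi], so the one-sided
     limits at the poles are its values there. *)
  have c : continuous (fun r => kappa n.+2 t (acosc (cos r))).
    by move=> x; apply: (@ctn_comp _ _ _ (fun x => kappa n.+2 t (acosc x)) cos); [exact: ch|exact: continuous_cos].
  have cE r : 0 < r < pi -> kappa n.+2 t (acosc (cos r)) = F r.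
    by move=> rp; rewrite -FE// acosc_cos//; case/andP: rp => /ltW -> /ltW ->.
  split=> //.
  - have := @at_right_cont _ _ 0 c; rewrite acosc_cos ?lexx ?ltW//; apply: cvg_trans.
    apply: near_eq_cvg; near=> r; rewrite cE//; apply/andP; split; near: r.
      exact: nbhs_right_gt.
    exact: nbhs_right_lt.
  - have := @at_left_cont _ _ pi c; rewrite acosc_cos ?lexx ?ltW//; apply: cvg_trans.
    apply: near_eq_cvg; near=> r; rewrite cE//; apply/andP; split; near: r.
      exact: nbhs_left_gt.
    exact: nbhs_left_lt.
have fP := radial_kernel_of_heat_kernel (kappaP m.+2 isT).
have gP := radial_kernel_of_heat_kernel (kappaP m.+3 isT).
have g3P := radial_kernel_of_heat_kernel (kappaP m.+3.+2 isT).
have g5P := radial_kernel_of_heat_kernel (kappaP m.+3.+4 isT).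
set f := fun t x => _ in fP; set g := fun t x => _ in gP.
rewrite subn1 subn2 /= omegaE.
set c := (2 * _ - 1) / 4.
have cg := rk_contr gP t0.
have g0 x : -1 <= x <= 1 -> 0 <= g t x by apply: (rk_ge0 _ gP t0).
have -> : (\int[lebesgue_measure]_(rho in `[r, pi])
    (kappa m.+3 t rho * sin rho / Num.sqrt (cos r - cos rho))%:E = (abel (g t) (cos r))%:E)%E.
  rewrite -abel_integral//; apply: eq_integral => rho; rewrite inE/= in_itv/= => /andP[r1 r2].
  by rewrite /g acosc_cos// r2 andbT; case/andP: rp => r0 _; exact: le_trans r1.
pose K : R := (2 ^+ m * Num.sqrt 2)^-1.
have q0 : 0 < Num.sqrt 2 :> R by rewrite sqrtr_gt0.
have K0 : 0 <= K by rewrite invr_ge0 mulr_ge0 ?exprn_ge0// ltW.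
(* Measurability and nonnegativity allow the constant [K] to be taken out of an integral in the
   extended reals. *)
have mB : measurable_fun (`]0, t[%classic : set R) (bdry_term m f g t ^~ r).
  apply: measurable_realfun.open_continuous_measurable_fun; first exact: interval_open.
  by move=> s; rewrite inE/= in_itv/= => /andP[s0 st]; exact: (bdry_term_cont fP gP).
have -> : (\int[lebesgue_measure]_(s in `]0%R, t[)
   ((expR (- c * s) * kappa m.+3 s pi)%:E *
    \int[lebesgue_measure]_(rho in `[0%R, pi])
      ((sin (rho / 2) ^+ m.+1 * cos (rho / 2) ^+ m)%:E *
       \int[lebesgue_measure]_(theta in `[0%R, pi])
          (kappa m.+2 (t - s) (acos (cos r * cos rho + sin r * sin rho * cos theta)) * sin theta ^+ m)%:E)) =
   K%:E * \int[lebesgue_measure]_(s in `]0%R, t[) (bdry_term m f g t s r)%:E)%E.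
  rewrite -ge0_integralZl_EFin//; last 2 first.
  - by move=> s; rewrite /= in_itv/= => /andP[s0 st]; rewrite lee_fin; exact: (bdry_term_ge0 fP gP).
  - exact/measurable_realfun.measurable_EFinP.
  apply: eq_integral => s; rewrite inE/= in_itv/= => /andP[s0 st].
  have ts : 0 < t - s by rewrite subr_gt0.
  rewrite -EFinM /bdry_term /bdry_conv.
  have -> : K * (expR (- ((2 * m.+2%:R - 1) / 4 * s)) * g s (-1) *
      Int 0 pi (fun rho => sig rho ^+ m.+1 * kap rho ^+ m * zavg m (f (t - s)) rho r)) =
    (expR (- c * s) * kappa m.+3 s pi) *
     (K * Int 0 pi (fun rho => sig rho ^+ m.+1 * kap rho ^+ m * zavg m (f (t - s)) rho r)).
    have -> : g s (-1) = kappa m.+3 s pi by rewrite /g -cospi acosc_cos ?lexx ?pi_ge0.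
    by rewrite -/c mulNr mulrCA.
  rewrite [in RHS]EFinM /K -bdry_integrand; last exact: rk_contr fP ts.
  congr (_ * _)%E; apply: eq_integral => rho _; congr (_ * _)%E.
  apply: eq_integral => theta _; congr ((_ * _)%:E).
  by rewrite /f /acosc clamp_id// zc_itv.
rewrite (bdry_term_integral fP gP g3P g5P t0 rp) -!EFinM -EFinD; congr (_%:E).
have -> : kappa m.+2 t r = f t (cos r) by rewrite /f acosc_cos.
rewrite mulNr -/c /K.
have v0 := sphere_vol_gt0 (R := R) m.
have n0 : 0 < m.+1%:R :> R by rewrite ltr0n.
have t2 : 2 ^+ m != 0 :> R by rewrite expf_eq0 pnatr_eq0 andbF.
have -> : m.+2%:R - 1 = m.+1%:R :> R by rewrite -(natr1 m.+1) addrK.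
rewrite exprS; have q2 : 2 = Num.sqrt 2 ^+ 2 :> R by rewrite sqr_sqrtr.
move: (f _ _) (abel _ _) (expR _) (sphere_vol m) v0 (m.+1%:R : R) n0 => F A E v v0 n n0.
move: (2 ^+ m) t2 => T T0.
move: (Num.sqrt 2) q0 q2 => q q0 q2.
(* Here n is the original n - 1, T = 2^m, v is the volume of S^m and q = sqrt 2. The prefactor of
   the statement cancels all of them but powers of q: f keeps coefficient 2 / q^2 = 1, and the Abel
   term gets - 2 / q = - sqrt 2, which cancels the first integral. *)
have -> : n * (2 * T) * v * ((T * q)^-1 * ((F / (q * v) - E * (A / v)) / n)) = 2 / q ^+ 2 * F - 2 / q * (E * A).
  by field; rewrite T0 !gt_eqF.
have -> : 2 / q = q by rewrite q2 expr2 mulfK// gt_eqF.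
have -> : 2 / q ^+ 2 = 1 by rewrite -q2 mulfV.
by ring.
Unshelve. all: by end_near. Qed.
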